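(* Given a process template $P$, for every edge $e$ of its reachability-unwinding $P^{\multimap}$ it is decidable which of the types blue, green, orange, red the edge $e$ has.
   Context: Fix an integer $k\ge 1$ and a finite set $\Sigma_{\mathrm{actn}}$ of rendezvous actions; let $\Sigma_{\mathrm{rdz}}=\bigcup_{a\in\Sigma_{\mathrm{actn}}}\{a_1,\dots,a_k\}$ and let $\mathfrak b$ be a fresh broadcast symbol. A process template is a finite labeled transition system $P=(S,I,R,\Sigma_{\mathrm{rdz}}\cup\{\mathfrak b\})$ with finite state set $S$, initial states $I\subseteq S$ and edges $R\subseteq S\times(\Sigma_{\mathrm{rdz}}\cup\{\mathfrak b\})\times S$, such that every $s\in S$ has an outgoing edge $(s,\mathfrak b,s')\in R$; for the given $P$ also every $\varsigma\in\Sigma_{\mathrm{rdz}}$ labels at most one edge of $R$. For a template and $N\in\mathbb N$, the RB-system has configurations $f:[N]\to S$, initial configurations those with $f(i)\in I$ for all $i$, and transitions: broadcast transitions $(f,\mathfrak b,g)$ with $(f(i),\mathfrak b,g(i))\in R$ for all $i$; and rendezvous transitions $(f,((i_1,a_1),\dots,(i_k,a_k)),g)$ where $a\in\Sigma_{\mathrm{actn}}$, $i_1,\dots,i_k\in[N]$ pairwise distinct, $(f(i_j),a_j,g(i_j))\in R$ for all $j$, and $g(i)=f(i)$ for other $i$. The infinite RB-system is the union over all $N$; runs are paths from initial configurations. For a path $\pi$, $\pi(1)$ is the sequence of edges taken by process $1$ (in a broadcast transition $(f(1),\mathfrak b,g(1))$, in a rendezvous transition with $1=i_j$ the edge $(f(1),a_j,g(1))$,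 other transitions skipped); the infinite executions are the infinite sequences $\pi(1)$ for runs $\pi$. Reachability-unwinding: define $I_0=I$, $I_i=\{s\mid (h,\mathfrak b,s)\in R,\ h\in S_{i-1}\}$ for $i>0$, and $(S_i,R_i)$ by saturation: start with $S_i=I_i$, $R_i=\emptyset$; repeatedly add an edge $(s,a_h,t)\in R\setminus R_i$ to $R_i$ and $t$ to $S_i$ whenever for every $l\in[k]$ some edge $(s',a_l,t')\in R$ has $s'\in S_i$, until a fixed point. Let $m$ be least with $(S_{m+1},I_{m+1},R_{m+1})=(S_n,I_n,R_n)$ for some $n\le m$. $P^{\multimap}$ has states $\bigcup_{i=0}^m S_i\times\{i\}$, initial states $I\times\{0\}$, rendezvous edges $((s,i),\varsigma,(t,i))$ for $(s,\varsigma,t)\in R_i$, and broadcast edges $((s,i),\mathfrak b,(t,i+1))$ ($i<m$, $s\in S_i$, $(s,\mathfrak b,t)\in R$) and $((s,m),\mathfrak b,(t,n))$ ($s\in S_m$, $(s,\mathfrak b,t)\in R$). $\mathcal P^{\multimap}$ is the infinite RB-system with template $P^{\multimap}$. Edge types of an edge $e$ of $P^{\multimap}$ (with respect to infinite executions of $\mathcal P^{\multimap}$): red if it occurs only finitely often on every infinite execution; blue if it occurs infinitely often on some infinite execution with finitely many broadcast edges, but only finitely often on every infinite execution with infinitely many broadcast edges; green if there is an infinite execution with infinitely many broadcast edges such that for every $N\in\mathbb N$ some contiguous broadcast-free segment of it contains at least $N$ occurrences of $e$; orange if it is neither red, blue, nor green. *)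

(* Defs.v *)
From HB Require Import structures.
From mathcomp Require Import all_boot.

Set Implicit Arguments.
Unset Strict Implicit.
Unset Printing Implicit Defensive.

(* Kleene's partial recursive functions, on argument lists.  These make       *)
(* decidability meaningful under classical axioms, where every predicate is   *)
(* decided by some Rocq function.                                             *)
Inductive recfun : Type :=
| RZero
| RSucc
| RProj of nat
| RComp of recfun & seq recfun
| RPrimRec of recfun & recfun
| RMu of recfun.

(* [computes f v y]: f is defined at the argument list v, with value y.       *)
Inductive computes : recfun -> seq nat -> nat -> Prop :=
| computes_zero v : computes RZero v 0
| computes_succ x v : computes RSucc (x :: v) x.+1
| computes_proj i v : i < size v -> computes (RProj i) v (nth 0 v i)
| computes_comp f gs v ws y :
    size ws = size gs ->
    (forall i, i < size gs -> computes (nth RZero gs i) v (nth 0 ws i)) ->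
    computes f ws y -> computes (RComp f gs) v y
| computes_prim0 f g v y :
    computes f v y -> computes (RPrimRec f g) (0 :: v) y
| computes_primS f g n v r y :
    computes (RPrimRec f g) (n :: v) r -> computes g [:: n, r & v] y ->
    computes (RPrimRec f g) (n.+1 :: v) y
| computes_mu f v y (w : nat -> nat) :
    (forall z, z < y -> computes f (z :: v) (w z).+1) ->
    computes f (y :: v) 0 -> computes (RMu f) v y.

Section Labels.

Variables (k : nat) (Act : finType).

(* [None] is the broadcast symbol; [Some (a, j)] is the rendezvous symbol     *)
(* a_(j+1), as indices in [k] are shifted to start from 0.                    *)
Definition label : finType := option (Act * 'I_k)%type.

Definition bcast : label := None.
Definition rdz (a : Act) (j : 'I_k) : label := Some (a, j).

Definition edge (S : finType) : finType := (S * label * S)%type.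

Record lts (S : finType) := LTS {
  init : {set S};
  edges : {set edge S}
}.

Definition is_template (S : finType) (P : lts S) : Prop :=
  forall s, exists t, (s, bcast, t) \in edges P.

Definition rdz_unique (S : finType) (P : lts S) : Prop :=
  forall (a : Act) (j : 'I_k) (s t s' t' : S),
    (s, rdz a j, t) \in edges P -> (s', rdz a j, t') \in edges P ->
    s = s' /\ t = t'.

Section System.

Variables (S : finType) (P : lts S).

Definition config (N : nat) := {ffun 'I_N -> S}.

Definition glabel (N : nat) := option (Act * {ffun 'I_k -> 'I_N})%type.

Definition transition (N : nat) (f : config N) (l : glabel N) (g : config N) :
    Prop :=
  match l with
  | None => forall i, (f i, bcast, g i) \in edges P
  | Some (a, p) =>
      [/\ injective p,
          forall j, (f (p j), rdz a j, g (p j)) \in edges P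
        & forall i, (forall j, i <> p j) -> g i = f i]
  end.

Definition is_run (N : nat) (c : nat -> config N) (l : nat -> glabel N) : Prop :=
  (forall i, c 0 i \in init P) /\
  (forall t, transition (c t) (l t) (c t.+1)).

Definition taken (N : nat) (f : config N) (l : glabel N) (g : config N)
    (i : 'I_N) : option (edge S) :=
  match l with
  | None => Some (f i, bcast, g i)
  | Some (a, p) =>
      if [pick j | p j == i] is Some j then Some (f i, rdz a j, g i) else None
  end.

(* Process 1 is [ord0], which requires at least one process; phi enumerates   *)
(* in increasing order the steps of the run in which this process moves.      *)
Definition infinite_execution (xi : nat -> edge S) : Prop :=
  exists (N : nat) (c : nat -> config N.+1) (l : nat -> glabel N.+1)
         (phi : nat -> nat),
    let move t := taken (c t) (l t) (c t.+1) ord0 in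
    [/\ is_run c l,
        {homo phi : i j / i < j},
        forall t, move t <> None <-> exists i, t = phi i
      & forall i, move (phi i) = Some (xi i)].

Definition is_bcast (e : edge S) : bool := e.1.2 == bcast.

Definition infinitely_often (Q : pred (edge S)) (xi : nat -> edge S) : Prop :=
  forall n, exists2 i, n <= i & Q (xi i).

Definition finitely_often (Q : pred (edge S)) (xi : nat -> edge S) : Prop :=
  ~ infinitely_often Q xi.

Definition red (e : edge S) : Prop :=
  forall xi, infinite_execution xi -> finitely_often (pred1 e) xi.

Definition blue (e : edge S) : Prop :=
  (exists xi, [/\ infinite_execution xi, finitely_often is_bcast xi
                & infinitely_often (pred1 e) xi]) /\
  (forall xi, infinite_execution xi -> infinitely_often is_bcast xi ->
     finitely_often (pred1 e) xi).

Definition green (e : edge S) : Prop :=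
  exists xi, [/\ infinite_execution xi, infinitely_often is_bcast xi
    & forall N, exists i len,
        let segment := [seq xi j | j <- iota i len] in
        ~~ has is_bcast segment /\ N <= count_mem e segment].

Definition orange (e : edge S) : Prop := [/\ ~ red e, ~ blue e & ~ green e].

End System.

Inductive color := Blue | Green | Orange | Red.

Definition has_type (S : finType) (P : lts S) (e : edge S) (c : color) : Prop :=
  match c with
  | Blue => blue P e
  | Green => green P e
  | Orange => orange P e
  | Red => red P e
  end.

Section Unwinding.

Variables (S : finType) (P : lts S).

Definition addable (X : {set S}) (Q : {set edge S}) (e : edge S) : bool :=
  (e \in edges P :\: Q) &&
  (if e.1.2 is Some (a, _) then
     [forall j : 'I_k, exists e' in edges P,
        (e'.1.2 == rdz a j) && (e'.1.1 \in X)]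
   else false).

Definition saturate_step (XQ : {set S} * {set edge S}) :
    {set S} * {set edge S} :=
  if [pick e | addable XQ.1 XQ.2 e] is Some e then (e.2 |: XQ.1, e |: XQ.2)
  else XQ.

(* Every effective step adds a new element of [edges P] to the second         *)
(* component, so #|edges P| steps reach the fixed point.                      *)
Definition saturate (X : {set S}) : {set S} * {set edge S} :=
  iter #|edges P| saturate_step (X, set0).

Definition bcast_image (X : {set S}) : {set S} :=
  [set t | [exists h in X, (h, bcast, t) \in edges P]].

(* [layer i] is (I_i, (S_i, R_i)).                                            *)
Fixpoint layer (i : nat) : {set S} * ({set S} * {set edge S}) :=
  let X := if i is j.+1 then bcast_image (layer j).2.1 else init P in
  (X, saturate X).

Definition layer_states (i : nat) : {set S} := (layer i).2.1.
Definition layer_edges (i : nat) : {set edge S} := (layer i).2.2.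

Lemma layer_repeats : exists m, layer m.+1 \in mkseq layer m.+1.
Proof.
case: (boolP [exists m : 'I_#|{: {set S} * ({set S} * {set edge S})}|,
                layer m.+1 \in mkseq layer m.+1]) => [/existsP[m Hm]|].
  by exists m.
rewrite negb_exists => /forallP Hno.
set T : finType := ({set S} * ({set S} * {set edge S}))%type in Hno.
have Huniq j : j <= #|{: T}| -> uniq (mkseq layer j.+1).
  elim: j => [//|j IHj] Hj.
  rewrite /mkseq -[j.+2]addn1 iotaD map_cat cats1 rcons_uniq.
  by rewrite (Hno (Ordinal Hj)) IHj // ltnW.
by have := uniq_leq_size (Huniq _ (leqnn _)) (fun x _ => mem_enum predT x);
  rewrite size_mkseq -cardE ltnn.
Qed.

(* The numbers m and n of the lasso; by minimality of m the first m + 1       *)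
(* layers are pairwise distinct, so n is the only index it can be.            *)
Definition lasso_end : nat := ex_minn layer_repeats.
Definition lasso_start : nat := index (layer lasso_end.+1) (mkseq layer lasso_end.+1).

Definition ustate : finType :=
  {x : S * 'I_lasso_end.+1 | x.1 \in layer_states x.2}.

Definition base (x : ustate) : S := (val x).1.
Definition level (x : ustate) : nat := (val x).2.

Definition unwinding_edge (e : edge ustate) : bool :=
  let: (x, l, y) := e in
  if l is Some _ then
    (level y == level x) && ((base x, l, base y) \in layer_edges (level x))
  else
    (level y == if level x < lasso_end then (level x).+1 else lasso_start) &&
    ((base x, l, base y) \in edges P).

Definition unwinding : lts ustate :=
  {| init := [set x | (base x \in init P) && (level x == 0)];
     edges := [set e | unwinding_edge e] |}.

End Unwinding.

(* Inputs and outputs as numbers: a set of numbers is the binary expansion    *)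
(* with these positions; the edge (s, l, t) of a template with n states has   *)
(* the position (s * n + t) * #|label| + l, where labels are numbered by      *)
(* [enum_rank], the alphabet being fixed.                                     *)
Definition label_code (l : label) : nat := enum_rank l.

Definition edge_position (n : nat) (e : edge 'I_n) : nat :=
  (e.1.1 * n + e.2) * #|{: label}| + label_code e.1.2.

Definition template_code (n : nat) (P : lts 'I_n) : seq nat :=
  [:: n; \sum_(s in init P) 2 ^ s; \sum_(e in edges P) 2 ^ edge_position e].

Definition unwinding_edge_code (n : nat) (P : lts 'I_n) (e : edge (ustate P)) :
    seq nat :=
  let: (x, l, y) := e in
  [:: nat_of_ord (base x); level x; label_code l; nat_of_ord (base y); level y].

Definition color_code (c : color) : nat :=
  match c with Blue => 0 | Green => 1 | Orange => 2 | Red => 3 end.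

End Labels.

(* Main.v *)
(* A flow assigns multiplicities to the edges of the unwinding, balanced at    *)
(* every state and equal on the k edges of a rendezvous.  Counting the edges   *)
(* taken by all processes between two repetitions of a configuration gives a   *)
(* flow; if these are separated by broadcasts, its support moreover populates  *)
(* itself, forwards from the targets and backwards from the sources of its     *)
(* broadcast edges.  Conversely, such a support is realised with enough        *)
(* processes as in continuous Petri nets: scale the flow, first mark all its   *)
(* states, and unmark them last.  Only the numbers of processes in each state  *)
(* matter, because some process takes the edge infinitely often and processes  *)
(* are interchangeable.  So an edge is                                         *)
(* - on an execution with finitely many broadcasts infinitely often iff it     *)
(*   lies on a flow of rendezvous edges ([rdz_cycle]);                         *)
(* - on an execution with infinitely many broadcasts infinitely often iff it   *)
(*   lies in a self-populating support ([recurrent]);                          *)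
(* - green iff it also lies on a flow of rendezvous edges in this support      *)
(*   ([pumpable]).                                                             *)
(* All this is decided by bounded search, as an edge on a flow is on a flow    *)
(* whose size is bounded by the double description method.                     *)
Require Import Defs.
From HB Require Import structures.
From mathcomp Require Import all_boot zify.
From Stdlib Require Import Classical ClassicalEpsilon.

Set Implicit Arguments.
Unset Strict Implicit.
Unset Printing Implicit Defensive.

(** * Closure properties of the recursive functions *)

(** With a fixed number of processes there are finitely many configurations, so an infinite run
    repeats one. In the unwinding all processes are always on one level ([step_level]), and on a
    level an action has at most one edge for each of its k roles. So the k edges of a rendezvous are
    taken equally often, and the traffic between two repetitions is a flow ([traffic_flow]). If the
    window ends in a broadcast, its states are reached inside the support from targets of broadcast
    edges and, in reverse time, from their sources; the support is a circulation
    ([traffic_circulation]). A long broadcast-free segment contains a repetition of its own, whence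
    a flow of rendezvous edges ([execution_pumpable]).

    Conversely, each level with its actions is a Petri net. The number of processes being free,
    reachability up to scaling is enough, and for this the marking equation with forward and
    backward coverability suffices ([fires_scaled]). [circulation_block] realises it by processes
    and inserts any number of rounds of a rendezvous loop; [circulation_run] glues the blocks. Such
    a run can be started because broadcasts and saturation put arbitrarily many processes into all
    states of a level at once ([u_populated]). By pigeonhole one process does what is wanted, and it
    can be renamed to process 1 ([run_infinitely_often], [run_green]). So the colour is determined
    by [pumpable], [recurrent] and [rdz_cycle] ([semantic_colorP]).

    Flows are the natural solutions of a homogeneous linear system, and a solution using a given
    edge can be replaced by one with bounded entries and no larger support ([small_solution]). All
    searches are thereby bounded. They are written as functions on numbers, shown to be recursive
    ([computable_ncolor]) and to agree with the semantic conditions ([ncolorE]). Classical logic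
    enters the correctness proof only, not the program. *)

Definition computable (d : nat) (f : seq nat -> nat) : Prop :=
  exists p, forall v, size v = d -> computes p v (f v).

Lemma computable_ext d f g :
  (forall v, size v = d -> f v = g v) -> computable d f -> computable d g.
Proof. by move=> fg [p Hp]; exists p => v sv; rewrite -fg //; apply: Hp. Qed.

Lemma computable_comp d F (gs : seq (seq nat -> nat)) :
  computable (size gs) F ->
  (forall i, i < size gs -> computable d (nth (fun=> 0) gs i)) ->
  computable d (fun v => F [seq g v | g <- gs]).
Proof.
move=> [pF HF] Hgs.
have [ps [sps Hps]] : exists ps : seq recfun, size ps = size gs /\
    forall v i, size v = d -> i < size gs ->
      computes (nth RZero ps i) v (nth (fun=> 0) gs i v).
  elim: gs Hgs {HF} => [|g gs IH] Hgs; first by exists [::].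
  have [ps [sps Hps]] := IH (fun i => Hgs i.+1).
  have [p Hp] := Hgs 0 isT.
  exists (p :: ps); split=> [|v [|i] sv Hi] /=; [by rewrite sps|exact: Hp|].
  exact: Hps.
exists (RComp pF ps) => v sv.
apply: (@computes_comp _ _ _ [seq g v | g <- gs]).
- by rewrite size_map.
- move=> i Hi; rewrite sps in Hi.
  by rewrite (nth_map (fun=> 0)) //; apply: Hps.
- by apply: HF; rewrite size_map.
Qed.

(** Written with [behead] so that, for a numeral index, [proj] of a shortened list is convertible to
    a later [proj] of the whole list. Terms under bounded sums and searches, which see the arguments
    behind new variables, then match by conversion. *)
Definition proj (i : nat) (v : seq nat) : nat := head 0 (iter i behead v).

Lemma projE i v : proj i v = nth 0 v i.
Proof.
rewrite /proj; elim: i v => [|i IH] v; first by case: v.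
by rewrite iterSr IH; case: v => //=; rewrite nth_nil.
Qed.

Lemma computable_proj i d : i < d -> computable d (proj i).
Proof.
move=> Hi; exists (RProj i) => v sv; rewrite projE.
by apply: computes_proj; rewrite sv.
Qed.

Lemma computable_succ : computable 1 (fun v => (proj 0 v).+1).
Proof. by exists RSucc => -[|x []] //= _; apply: computes_succ. Qed.

Lemma map_proj d v :
  size v = d -> [seq g v | g <- [seq proj i | i <- iota 0 d]] = v.
Proof.
move=> <-; rewrite -map_comp; apply: (@eq_from_nth _ 0).
  by rewrite size_map size_iota.
rewrite size_map size_iota => i Hi.
by rewrite (nth_map 0) ?size_iota // nth_iota //= projE.
Qed.

Section Lifting.

Variable d : nat.
Implicit Types a b c : seq nat -> nat.

Lemma computable1 (F : nat -> nat) :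
  computable 1 (fun v => F (proj 0 v)) ->
  forall a, computable d a -> computable d (fun v => F (a v)).
Proof.
move=> HF a Ha; apply: (computable_comp (gs := [:: a]) HF).
by case.
Qed.

Lemma computable2 (F : nat -> nat -> nat) :
  computable 2 (fun v => F (proj 0 v) (proj 1 v)) ->
  forall a1 a2, computable d a1 -> computable d a2 ->
  computable d (fun v => F (a1 v) (a2 v)).
Proof.
move=> HF a1 a2 H1 H2; apply: (computable_comp (gs := [:: a1; a2]) HF).
by case=> [|[]].
Qed.

Lemma computable3 (F : nat -> nat -> nat -> nat) :
  computable 3 (fun v => F (proj 0 v) (proj 1 v) (proj 2 v)) ->
  forall a1 a2 a3, computable d a1 -> computable d a2 -> computable d a3 ->
  computable d (fun v => F (a1 v) (a2 v) (a3 v)).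
Proof.
move=> HF a1 a2 a3 H1 H2 H3.
by apply: (computable_comp (gs := [:: a1; a2; a3]) HF); do 3?case=> //.
Qed.

Lemma computable4 (F : nat -> nat -> nat -> nat -> nat) :
  computable 4 (fun v => F (proj 0 v) (proj 1 v) (proj 2 v) (proj 3 v)) ->
  forall a1 a2 a3 a4, computable d a1 -> computable d a2 -> computable d a3 ->
  computable d a4 ->
  computable d (fun v => F (a1 v) (a2 v) (a3 v) (a4 v)).
Proof.
move=> HF a1 a2 a3 a4 H1 H2 H3 H4.
by apply: (computable_comp (gs := [:: a1; a2; a3; a4]) HF); do 4?case=> //.
Qed.

Lemma computable5 (F : nat -> nat -> nat -> nat -> nat -> nat) :
  computable 5
    (fun v => F (proj 0 v) (proj 1 v) (proj 2 v) (proj 3 v) (proj 4 v)) ->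
  forall a1 a2 a3 a4 a5, computable d a1 -> computable d a2 ->
  computable d a3 -> computable d a4 -> computable d a5 ->
  computable d (fun v => F (a1 v) (a2 v) (a3 v) (a4 v) (a5 v)).
Proof.
move=> HF a1 a2 a3 a4 a5 H1 H2 H3 H4 H5.
by apply: (computable_comp (gs := [:: a1; a2; a3; a4; a5]) HF); do 5?case=> //.
Qed.

Lemma computable_const (x : nat) : computable d (fun=> x).
Proof.
elim: x => [|x IH]; first by exists RZero => v _; apply: computes_zero.
exact: (computable1 computable_succ IH).
Qed.

End Lifting.

(** Counter and previous value precede the arguments, as in [RPrimRec]; there the recursion depth is
    an argument, here any computable function, supplied by composition with all projections. *)
Lemma computable_rec d (n b : seq nat -> nat)
    (s : nat -> nat -> seq nat -> nat) :
  computable d n -> computable d b ->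
  computable d.+2 (fun v => s (head 0 v) (head 0 (behead v))
                              (behead (behead v))) ->
  computable d
    (fun v => nat_rect (fun=> nat) (b v) (fun m r => s m r v) (n v)).
Proof.
move=> Hn [pb Hb] [ps Hs].
pose F v := nat_rect (fun=> nat) (b (behead v))
  (fun m r => s m r (behead v)) (head 0 v).
have HF : computable d.+1 F.
  exists (RPrimRec pb ps) => -[//|m v] [sv].
  rewrite /F /=; elim: m => [|m IH] /=; first by apply/computes_prim0/Hb.
  by apply: (computes_primS IH); apply: (Hs [:: m, _ & v]); rewrite /= sv.
apply: (@computable_ext d
  (fun v => F [seq g v | g <- n :: [seq proj i | i <- iota 0 d]])).
  by move=> v sv; rewrite /F /= map_proj.
apply: computable_comp; first by rewrite /= size_map size_iota.
case=> [//|i] /=; rewrite size_map size_iota => Hi.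
by rewrite (nth_map 0) ?size_iota // nth_iota //; apply: computable_proj.
Qed.

Lemma computable_iter d (n b : seq nat -> nat) (s : nat -> seq nat -> nat) :
  computable d n -> computable d b ->
  computable d.+2 (fun v => s (head 0 (behead v)) (behead (behead v))) ->
  computable d (fun v => iter (n v) (s^~ v) (b v)).
Proof.
move=> Hn Hb Hs; apply: computable_ext (computable_rec Hn Hb Hs) => v _.
by elim: (n v) => //= m ->.
Qed.

(** * Bounded sums, arithmetic and bounded search *)

Definition bsum (n : nat) (F : nat -> nat) : nat := \sum_(i < n) F i.

Lemma bsumS n F : bsum n.+1 F = bsum n F + F n.
Proof. exact: big_ord_recr. Qed.

Lemma computable_add : computable 2 (fun v => proj 0 v + proj 1 v).
Proof.
apply: (@computable_ext _ (fun v => iter (proj 0 v) succn (proj 1 v))).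
  by move=> v _; rewrite iter_succn addnC.
apply: computable_iter; [exact: computable_proj|exact: computable_proj|].
exact: (computable1 computable_succ (computable_proj (i := 1) _)).
Qed.

Lemma computable_pred : computable 1 (fun v => (proj 0 v).-1).
Proof.
apply: (@computable_ext _
  (fun v => nat_rect (fun=> nat) 0 (fun m _ => m) (proj 0 v))).
  by move=> v _; case: (proj 0 v).
apply: (computable_rec (s := fun m _ _ => m)).
- exact: computable_proj.
- exact: computable_const.
- exact: (computable_proj (i := 0)).
Qed.

Lemma computable_sub : computable 2 (fun v => proj 0 v - proj 1 v).
Proof.
apply: (@computable_ext _ (fun v => iter (proj 1 v) predn (proj 0 v))).
  by move=> v _; rewrite iter_predn.
apply: computable_iter; [exact: computable_proj|exact: computable_proj|].
exact: (computable1 computable_pred (computable_proj (i := 1) _)).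
Qed.

Lemma computable_bsum d (n : seq nat -> nat) (F : nat -> seq nat -> nat) :
  computable d n -> computable d.+1 (fun v => F (head 0 v) (behead v)) ->
  computable d (fun v => bsum (n v) (F^~ v)).
Proof.
move=> Hn HF; apply: (@computable_ext _ (fun v =>
  nat_rect (fun=> nat) 0 (fun m r => r + F m v) (n v))).
  move=> v _; rewrite /bsum; elim: (n v) => [|m /= ->]; first by rewrite big_ord0.
  by rewrite big_ord_recr.
apply: (computable_rec (s := fun m r v => r + F m v)) => //.
  exact: computable_const.
apply: (computable2 computable_add); first exact: (computable_proj (i := 1)).
have [p Hp] := HF.
(* The recursion puts the partial sum in second position; these projections skip it, as the summand
   sees only the index and the arguments. *)
pose gs := proj 0 :: [seq proj i.+2 | i <- iota 0 d].
have sgs : size gs = d.+1 by rewrite /= size_map size_iota.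
have Hgs i : i < size gs -> computable d.+2 (nth (fun=> 0) gs i).
  case: i => [|i]; rewrite sgs => Hi; first exact: computable_proj.
  rewrite /= (nth_map 0) ?size_iota // nth_iota //.
  exact: computable_proj.
rewrite -sgs in HF; apply: computable_ext (computable_comp HF Hgs) => -[|m [|r v]] //= [sv].
congr F; rewrite -map_comp; apply: (@eq_from_nth _ 0).
  by rewrite size_map size_iota.
rewrite size_map size_iota => i Hi.
by rewrite (nth_map 0) ?size_iota // nth_iota //= projE.
Qed.

Lemma computable_mul : computable 2 (fun v => proj 0 v * proj 1 v).
Proof.
apply: (@computable_ext _ (fun v => iter (proj 0 v) (addn (proj 1 v)) 0)).
  by move=> v _; rewrite iter_addn_0 mulnC.
apply: (computable_iter (s := fun m v => proj 1 v + m)).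
- exact: computable_proj.
- exact: computable_const.
- apply: (computable2 computable_add);
    [exact: (computable_proj (i := 3))|exact: (computable_proj (i := 1))].
Qed.

Lemma computable_exp : computable 2 (fun v => proj 0 v ^ proj 1 v).
Proof.
apply: (@computable_ext _ (fun v => iter (proj 1 v) (muln (proj 0 v)) 1)).
  by move=> v _; rewrite iter_muln_1.
apply: (computable_iter (s := fun m v => proj 0 v * m)).
- exact: computable_proj.
- exact: computable_const.
- apply: (computable2 computable_mul);
    [exact: (computable_proj (i := 2))|exact: (computable_proj (i := 1))].
Qed.

Lemma computable_eq0 : computable 1 (fun v => proj 0 v == 0).
Proof.
apply: (@computable_ext _ (fun v => 1 - proj 0 v)).
  by move=> v _; case: (proj 0 v).
exact: (computable2 computable_sub (computable_const _ _) (computable_proj _)).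
Qed.

Ltac computes_leaf :=
  first [ exact: (computable_proj (i := 0)) | exact: (computable_proj (i := 1))
        | exact: (computable_proj (i := 2)) | exact: (computable_proj (i := 3))
        | exact: (computable_proj (i := 4)) | exact: (computable_proj (i := 5))
        | exact: (computable_proj (i := 6)) | exact: (computable_proj (i := 7))
        | exact: (computable_proj (i := 8)) | exact: (computable_proj (i := 9))
        | exact: (computable_proj (i := 10)) | exact: (computable_const _ _)
        | assumption ].

Section Boolean.

Variable d : nat.

Lemma computable_leq a b :
  computable d a -> computable d b -> computable d (fun v => a v <= b v).
Proof.
move=> Ha Hb; rewrite /leq.
exact: (computable1 (F := fun x => x == 0) computable_eq0 (computable2 computable_sub Ha Hb)).
Qed.

Lemma computable_eq a b :
  computable d a -> computable d b -> computable d (fun v => a v == b v).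
Proof.
move=> Ha Hb; apply: (@computable_ext _
  (fun v => ((a v - b v) + (b v - a v) == 0))); first by move=> v _; congr nat_of_bool; lia.
apply: (computable1 (F := fun x => x == 0) computable_eq0).
apply: (computable2 computable_add); exact: (computable2 computable_sub).
Qed.

Lemma computable_neg (P : seq nat -> bool) :
  computable d (fun v => P v) -> computable d (fun v => ~~ P v).
Proof.
move=> HP; apply: computable_ext (computable1 (F := fun x => x == 0) computable_eq0 HP) => v _.
by case: (P v).
Qed.

Lemma computable_and (P Q : seq nat -> bool) :
  computable d (fun v => P v) -> computable d (fun v => Q v) ->
  computable d (fun v => P v && Q v).
Proof.
move=> HP HQ; apply: computable_ext (computable2 computable_mul HP HQ) => v _.
by rewrite mulnb.
Qed.

Lemma computable_or (P Q : seq nat -> bool) :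
  computable d (fun v => P v) -> computable d (fun v => Q v) ->
  computable d (fun v => P v || Q v).
Proof.
move=> HP HQ; apply: computable_ext
  (computable_neg (computable_and (computable_neg HP) (computable_neg HQ))) => v _.
by rewrite negb_and !negbK.
Qed.

Lemma computable_imp (P Q : seq nat -> bool) :
  computable d (fun v => P v) -> computable d (fun v => Q v) ->
  computable d (fun v => P v ==> Q v).
Proof.
move=> HP HQ; apply: computable_ext (computable_or (computable_neg HP) HQ) => v _.
by rewrite implybE.
Qed.

Lemma computable_if (P : seq nat -> bool) a b :
  computable d (fun v => P v) -> computable d a -> computable d b ->
  computable d (fun v => if P v then a v else b v).
Proof.
move=> HP Ha Hb.
apply: (@computable_ext _ (fun v => P v * a v + ~~ P v * b v)).
  by move=> v _; case: (P v); rewrite /= ?mul1n ?mul0n ?addn0.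
apply: (computable2 computable_add); apply: (computable2 computable_mul) => //.
exact: computable_neg.
Qed.

End Boolean.

Lemma computable_has d (n : seq nat -> nat) (P : nat -> seq nat -> bool) :
  computable d n -> computable d.+1 (fun v => P (head 0 v) (behead v)) ->
  computable d (fun v => has (P^~ v) (iota 0 (n v))).
Proof.
move=> Hn HP.
have H := computable_neg (computable1 (F := fun x => x == 0) computable_eq0 (computable_bsum (F := fun i v => P i v) Hn HP)).
apply: computable_ext H => v _; congr nat_of_bool.
rewrite /bsum sum_nat_eq0 negb_forall; apply/existsP/hasP => [[i]|[i]].
  by rewrite eqb0 negbK => Pi; exists (val i); rewrite ?mem_iota ?ltn_ord.
by rewrite mem_iota => Hi Pi; exists (Ordinal Hi); rewrite /= Pi.
Qed.

Lemma computable_all d (n : seq nat -> nat) (P : nat -> seq nat -> bool) :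
  computable d n -> computable d.+1 (fun v => P (head 0 v) (behead v)) ->
  computable d (fun v => all (P^~ v) (iota 0 (n v))).
Proof.
move=> Hn HP; have H := computable_neg HP.
apply: computable_ext
  (computable_neg (computable_has (P := fun i v => ~~ P i v) Hn H)) => v _.
by rewrite -all_predC; congr nat_of_bool; apply: eq_all => i /=; rewrite negbK.
Qed.

(** The first hit is the number of nonempty initial segments without a hit, so bounded search is a
    bounded sum and needs no minimisation operator. *)
Lemma find_iota n (P : pred nat) :
  find P (iota 0 n) = bsum n (fun i => ~~ has P (iota 0 i.+1)).
Proof.
elim: n => [|n IH]; first by rewrite /bsum big_ord0.
have E : has P (iota 0 n.+1) = has P (iota 0 n) || P n.
  by rewrite -addn1 iotaD has_cat /= orbF.
rewrite bsumS -IH E -addn1 iotaD find_cat add0n size_iota [find P (iota n 1)]/=.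
case: (boolP (has P (iota 0 n))) => [_|H]; first by rewrite addn0.
by rewrite (hasNfind H) size_iota /=; case: (P n).
Qed.

(** In the sum of [find_iota] the test sits under two bound variables, the summation index and the
    searched number; of these two extra arguments it reads only the first. *)
Lemma computable_find d (n : seq nat -> nat) (P : nat -> seq nat -> bool) :
  computable d n -> computable d.+2 (fun v => P (head 0 v) (behead (behead v))) ->
  computable d (fun v => find (P^~ v) (iota 0 (n v))).
Proof.
move=> Hn HP.
apply: (@computable_ext _ (fun v => bsum (n v) (fun i => ~~ has (P^~ v) (iota 0 i.+1)))).
  by move=> v _; rewrite find_iota.
apply: (computable_bsum (F := fun i v => ~~ has (P^~ v) (iota 0 i.+1))) => //.
apply: computable_neg.
apply: (computable_has (P := fun i v => P i (behead v))) => //.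
exact: (computable1 computable_succ (computable_proj (i := 0) _)).
Qed.

(** The quotient counts the positive multiples of the divisor up to [m]; the guard gives 0 for
    divisor 0. *)
Lemma divn_bsum m d : m %/ d = bsum m (fun i => (0 < d) && (i.+1 * d <= m)).
Proof.
case: (posnP d) => [->|d0]; first by rewrite /bsum big1.
rewrite /bsum (eq_bigr (fun i : 'I_m => (i < m %/ d : nat))); last first.
  by move=> i _; rewrite leq_divRL.
rewrite -big_mkcond /= sum1_card.
rewrite (eq_card (B := [pred i : 'I_m | i < m %/ d])) //.
have le : m %/ d <= m by apply: leq_div.
by rewrite -sum1_card (big_ord_narrow le) sum1_card card_ord.
Qed.

Lemma computable_div : computable 2 (fun v => proj 0 v %/ proj 1 v).
Proof.
apply: (@computable_ext _ (fun v => bsum (proj 0 v)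
  (fun i => (0 < proj 1 v) && (i.+1 * proj 1 v <= proj 0 v)))).
  by move=> v _; rewrite divn_bsum.
apply: (computable_bsum (F := fun i v =>
  (0 < proj 1 v) && (i.+1 * proj 1 v <= proj 0 v))); first by computes_leaf.
apply: computable_and; apply: computable_leq; try computes_leaf.
apply: (computable2 computable_mul); last by computes_leaf.
by apply: (computable1 computable_succ); computes_leaf.
Qed.

Lemma computable_mod : computable 2 (fun v => proj 0 v %% proj 1 v).
Proof.
apply: (@computable_ext _
  (fun v => proj 0 v - proj 0 v %/ proj 1 v * proj 1 v)).
  by move=> v _; rewrite {1}(divn_eq (proj 0 v) (proj 1 v)) addKn.
apply: (computable2 computable_sub); first by computes_leaf.
apply: (computable2 computable_mul); last by computes_leaf.
exact: computable_div.
Qed.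

(** * Small solutions of homogeneous linear systems *)

Section SmallSolutions.

Variable E : finType.
Implicit Types (q : pred E * pred E) (x : E -> nat) (g h : {ffun E -> nat}).

Definition dot (l : pred E) x : nat := \sum_(e | l e) x e.

(** An equation is a pair of sets of unknowns with equal sums. Equations are addressed by index
    because predicates have no decidable equality. *)
Definition solves (qs : seq (pred E * pred E)) x : Prop :=
  forall i, i < size qs ->
    let q := nth (pred0 : pred E, pred0 : pred E) qs i in dot q.1 x = dot q.2 x.

(** A combination in the elimination step has two terms, each a coefficient of at most [v * b] times
    an entry of at most [b]. *)
Definition growth (v b : nat) : nat := 2 * (v * b) * b.

Definition solution_bound (v r : nat) : nat := iter r (growth v) 1.

Lemma dot_le v b l x : #|E| <= v -> (forall e, x e <= b) -> dot l x <= v * b.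
Proof.
move=> Hv Hx; apply: leq_trans (leq_mul Hv (leqnn b)).
rewrite -sum_nat_const /dot big_mkcond /=.
by apply: leq_sum => e _; case: ifP.
Qed.

Lemma solution_bound_gt0 v r : 0 < v -> 0 < solution_bound v r.
Proof.
by move=> v0; elim: r => //= r IH; rewrite /growth !muln_gt0 v0 IH.
Qed.

(* The double description method: a solution of one more equation is combined *)
(* from pairs of generators on which the equation errs in opposite directions. *)
Lemma small_generators v qs x :
  #|E| <= v -> solves qs x ->
  exists2 m, 0 < m & exists2 gs : seq {ffun E -> nat},
    {in gs, forall g, solves qs g /\
      forall e, g e <= solution_bound v (size qs)} &
    forall e, m * x e = \sum_(g <- gs) g e.
Proof.
move=> Hv; elim: qs => [_|[l r] qs IH Hx].
  (* Without equations the unit vectors generate everything. *)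
  exists 1 => //.
  exists (flatten [seq nseq (x e) [ffun e' => (e' == e : nat)] | e <- enum E]).
    move=> g /flattenP[s /mapP[e _ ->]] /nseqP[-> _]; split=> // e'.
    by rewrite ffunE; case: (_ == _).
  move=> e; rewrite mul1n big_flatten big_map big_enum /=.
  under eq_bigr => e' _ do rewrite big_nseq iter_addn_0 ffunE.
  rewrite (bigD1 e) //= eqxx mul1n big1 ?addn0 // => e' ne.
  by rewrite eq_sym (negbTE ne).
have [m m0 [gs Hgs Egs]] := IH (fun i => Hx i.+1).
have Hlr : dot l x = dot r x by exact: (Hx 0 isT).
have Edot (a : pred E) : m * dot a x = \sum_(g <- gs) dot a g.
  rewrite /dot big_distrr /= exchange_big /=.
  by apply: eq_bigr => e _; rewrite Egs.
pose P := [seq g : {ffun E -> nat} <- gs | dot r g < dot l g].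
pose N := [seq g : {ffun E -> nat} <- gs | dot l g < dot r g].
pose Z := [seq g : {ffun E -> nat} <- gs | dot l g == dot r g].
have split3 (F : {ffun E -> nat} -> nat) :
    \sum_(g <- gs) F g =
    \sum_(g <- P) F g + \sum_(g <- N) F g + \sum_(g <- Z) F g.
  have key (p : pred {ffun E -> nat}) :
      \sum_(g <- filter p gs) F g = \sum_(g <- gs) p g * F g.
    rewrite big_filter big_mkcond; apply: eq_bigr => g _.
    by case: (p g); rewrite ?mul1n.
  rewrite !key -!big_split; apply: eq_bigr => g _ /=.
  by case: ltngtP => _; lia.
pose V := \sum_(g <- P) (dot l g - dot r g).
pose V' := \sum_(g <- N) (dot r g - dot l g).
(* Since [x] solves the new equation, the errors of the generators in the two directions cancel in
   total. *)
have EV : V = V'.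
  have H : \sum_(g <- gs) dot l g = \sum_(g <- gs) dot r g.
    by rewrite -!Edot Hlr.
  rewrite !split3 in H.
  have HZ : \sum_(g <- Z) dot l g = \sum_(g <- Z) dot r g.
    by rewrite !big_filter; apply: eq_bigr => g /eqP.
  have HP : \sum_(g <- P) dot l g = V + \sum_(g <- P) dot r g.
    rewrite /V !big_filter -big_split; apply: eq_bigr => g Hg /=; lia.
  have HN : \sum_(g <- N) dot r g = V' + \sum_(g <- N) dot l g.
    rewrite /V' !big_filter -big_split; apply: eq_bigr => g Hg /=; lia.
  by lia.
have grow (e : E) : solution_bound v (size qs) <= growth v (solution_bound v (size qs)).
  have v0 : 0 < v by apply: leq_trans Hv; apply/card_gt0P; exists e.
  have := solution_bound_gt0 (size qs) v0; rewrite /growth.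
  move: (solution_bound _ _) => b b0; nia.
have HZ : {in Z, forall g, solves ((l, r) :: qs) g /\
      forall e, g e <= solution_bound v (size qs).+1}.
  move=> g; rewrite mem_filter => /andP[/eqP Eg gin].
  have [Sg Bg] := Hgs _ gin; split=> [[|i] Hi|e] //=; first exact: Sg.
  exact: leq_trans (Bg e) (grow e).
case: (posnP V) => V0.
  exists m => //; exists Z => // e; rewrite Egs split3.
  have zero (s : seq {ffun E -> nat}) (F : {ffun E -> nat} -> nat) :
      \sum_(g <- s) F g = 0 -> {in s, forall g, 0 < F g} -> s = [::].
    case: s => //= g s; rewrite big_cons => H /(_ g (mem_head _ _)); lia.
  rewrite (zero P _ V0); last by move=> g; rewrite mem_filter; lia.
  rewrite EV in V0; rewrite (zero N _ V0); last by move=> g; rewrite mem_filter; lia.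
  by rewrite !big_nil.
(* Each of the two is weighted by the error of the other, so that the errors cancel. *)
pose comb g h : {ffun E -> nat} :=
  [ffun e => (dot r h - dot l h) * g e + (dot l g - dot r g) * h e].
have dot_comb a g h : dot a (comb g h) =
    (dot r h - dot l h) * dot a g + (dot l g - dot r g) * dot a h.
  rewrite /dot !big_distrr -big_split; apply: eq_bigr => e _.
  by rewrite ffunE.
(* Summed over all pairs, the generators in [P] get the factor [V'] and those in [N] the factor [V],
   which are equal; [Z] is repeated [V] times to match. *)
exists (V * m); first by rewrite muln_gt0 V0.
exists ([seq comb g h | g <- P, h <- N] ++ flatten (nseq V Z)).
  move=> g'; rewrite mem_cat => /orP[/allpairsP[[g h] /= [gP hN ->]]|]; last first.
    by move=> /flattenP[s /nseqP[-> _] gZ]; apply: HZ.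
  move: gP hN; rewrite !mem_filter => /andP[gP gin] /andP[hN hin].
  have [Sg Bg] := Hgs _ gin; have [Sh Bh] := Hgs _ hin.
  split=> [[|i] Hi|e] /=; last 1 first.
  - rewrite ffunE /growth.
    have := dot_le r Hv Bh; have := dot_le l Hv Bg; have := Bg e; have := Bh e.
    move: (solution_bound _ _) (dot _ _) (dot _ _) (dot _ _) (dot _ _) (h e) (g e).
    by move=> b a1 a2 a3 a4 a5 a6 *; nia.
  - rewrite !dot_comb.
    move: (dot _ _) (dot _ _) (dot _ _) (dot _ _) gP hN => a1 a2 a3 a4; nia.
  - by rewrite !dot_comb Sg // Sh.
move=> e; rewrite big_cat big_allpairs_dep /= [X in _ = _ + X]big_flatten /=.
rewrite big_nseq iter_addn_0 -mulnA Egs split3.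
have -> : \sum_(g <- P) \sum_(h <- N) comb g h e =
    V' * \sum_(g <- P) g e + V * \sum_(h <- N) h e.
  rewrite big_distrr [V * _]big_distrl -big_split; apply: eq_bigr => g _ /=.
  rewrite big_distrl big_distrr -big_split; apply: eq_bigr => h _ /=.
  by rewrite ffunE.
by rewrite -EV; lia.
Qed.

(** A multiple of [x] is a sum of generators, so one of them is positive at [e]; nothing cancels
    among natural numbers, so its support lies in that of [x]. *)
Lemma small_solution v qs x e :
  #|E| <= v -> solves qs x -> 0 < x e ->
  exists g : {ffun E -> nat},
    [/\ solves qs g, forall e', g e' <= solution_bound v (size qs),
        forall e', 0 < g e' -> 0 < x e' & 0 < g e].
Proof.
move=> Hv Hx xe; have [m m0 [gs Hgs Egs]] := small_generators Hv Hx.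
have /hasP[g gin ge] : has (fun g : {ffun E -> nat} => 0 < g e) gs.
  rewrite -[has _ _]negbK -all_predC; apply/negP => /allP H.
  have : m * x e > 0 by rewrite muln_gt0 m0.
  rewrite Egs big_seq big1 // => g /H /=; lia.
have [Sg Bg] := Hgs _ gin; exists g; split=> // e' ge'.
have : 0 < m * x e'; last by rewrite muln_gt0 => /andP[].
by rewrite Egs (big_rem g gin) /= addn_gt0 ge'.
Qed.

(** The decision procedure uses only upper bounds for the numbers of unknowns and equations. *)
Lemma solution_bound_mono v v' r r' : 0 < v -> v <= v' -> r <= r' ->
  solution_bound v r <= solution_bound v' r'.
Proof.
move=> v0 vv'; rewrite /solution_bound /growth; elim: r' r => [|r' IH] [|r] //= Hr.
  apply: leq_trans (IH 0 isT) _.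
  have := solution_bound_gt0 r' (leq_trans v0 vv'); rewrite /solution_bound /growth.
  by move: (iter _ _ _) => b b0; nia.
have := IH r Hr; move: (iter _ _ _) (iter _ _ _) => b b' H.
by apply: leq_mul => //; rewrite leq_mul2l /= leq_mul.
Qed.

End SmallSolutions.

(** * Reachability in continuous Petri nets *)

(** A classical truth value, for proofs and specifications only; the program does not depend on
    it. *)
Definition asb (Q : Prop) : bool :=
  if excluded_middle_informative Q then true else false.

Lemma asbP (Q : Prop) : reflect Q (asb Q).
Proof. by rewrite /asb; case: excluded_middle_informative => H; constructor. Qed.

Section Firing.

Variables (T A : finType).
Implicit Types (c d r : T -> nat) (sg : seq A).

(** Firing sequences of a Petri net, [r] being the part of the marking that a transition leaves
    alone. Markings are compared pointwise, which avoids functional extensionality. *)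
Inductive fires (pre post : A -> T -> nat) :
  seq A -> (T -> nat) -> (T -> nat) -> Prop :=
| fires_nil c d : c =1 d -> fires pre post [::] c d
| fires_cons a sg c r d : (forall y, c y = pre a y + r y) ->
    fires pre post sg (fun y => post a y + r y) d ->
    fires pre post (a :: sg) c d.

Section Net.

Variables pre post : A -> T -> nat.
Local Notation fires := (fires pre post).

Definition amount (F : A -> T -> nat) sg (y : T) : nat := \sum_(a <- sg) F a y.

Lemma amount_rev F sg y : amount F (rev sg) y = amount F sg y.
Proof. by rewrite /amount (perm_big sg) // perm_rev. Qed.

Lemma amount_count F sg y : amount F sg y = \sum_a count_mem a sg * F a y.
Proof.
rewrite /amount; elim: sg => [|a sg IH]; first by rewrite big_nil big1.
rewrite big_cons IH (bigD1 a) //= [in RHS](bigD1 a) //= eqxx mulnDl mul1n -addnA.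
congr (_ + (_ + _)); apply: eq_bigr => b; rewrite eq_sym => /negbTE ->.
by rewrite add0n.
Qed.

Lemma fires_ext sg c c' d d' : c =1 c' -> d =1 d' -> fires sg c d -> fires sg c' d'.
Proof.
move=> cc dd H; elim: H c' cc d' dd => {sg c d} [c d cd|a sg c r d Hc _ IH] c' cc d' dd.
  by constructor => y; rewrite -cc -dd.
by apply: (fires_cons (r := r)) => [y|]; [rewrite -cc|apply: IH].
Qed.

Lemma fires_cat sg tau c d e : fires sg c d -> fires tau d e -> fires (sg ++ tau) c e.
Proof.
elim=> {sg c d} [c d cd|a sg c r d Hc _ IH] H /=.
  by apply: fires_ext H => // y.
by apply: fires_cons Hc _; apply: IH.
Qed.

Lemma fires_add r sg c d : fires sg c d ->
  fires sg (fun y => c y + r y) (fun y => d y + r y).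
Proof.
elim=> {sg c d} [c d cd|a sg c s d Hc _ IH]; first by constructor => y; rewrite cd.
apply: (fires_cons (r := fun y => s y + r y)); first by move=> y; rewrite Hc addnA.
by apply: fires_ext IH => // y; rewrite addnA.
Qed.

Lemma fires_sum sg tau c c' d d' : fires sg c d -> fires tau c' d' ->
  fires (sg ++ tau) (fun y => c y + c' y) (fun y => d y + d' y).
Proof.
move=> H H'; apply: fires_cat (fires_add c' H) _.
by apply: fires_ext (fires_add d H') => y; rewrite addnC.
Qed.

Lemma fires_mul n sg c d : fires sg c d ->
  fires (flatten (nseq n sg)) (fun y => n * c y) (fun y => n * d y).
Proof.
move=> H; elim: n => [|n IH] /=; first by constructor.
by apply: fires_ext (fires_sum H IH) => y; rewrite mulSn.
Qed.

Lemma fires_loop n sg c : fires sg c c -> fires (flatten (nseq n sg)) c c.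
Proof.
by move=> H; elim: n => [|n IH] /=; [constructor|apply: fires_cat H IH].
Qed.

(** The marking equation of Petri nets. *)
Lemma fires_eq sg c d : fires sg c d ->
  forall y, d y + amount pre sg y = c y + amount post sg y.
Proof.
rewrite /amount.
elim=> {sg c d} [c d cd|a sg c r d Hc _ IH] y; first by rewrite !big_nil cd.
by rewrite !big_cons Hc; have := IH y; lia.
Qed.

(** A marking that covers the whole consumption in advance permits the firings in any order. *)
Lemma fires_big sg c d :
  (forall y, amount pre sg y <= c y) ->
  (forall y, d y + amount pre sg y = c y + amount post sg y) ->
  fires sg c d.
Proof.
rewrite /amount.
elim: sg c => [|a sg IH] c Hc Hd.
  by constructor => y; have := Hd y; rewrite !big_nil; lia.
apply: (fires_cons (r := fun y => c y - pre a y)) => [y|].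
  by have := Hc y; rewrite big_cons; lia.
apply: IH => y; have := Hc y; have := Hd y; rewrite !big_cons; lia.
Qed.

(** The places that can be marked from some multiple of [c] form a set closed under the transitions
    of [V], which therefore contains [Z]; adding up the individual runs marks all of [Z] at once. *)
Lemma fires_cover (V : {set A}) (Z : {set T}) c :
  (forall X : {set T}, (forall y, 0 < c y -> y \in X) ->
     (forall a, a \in V -> (forall y, 0 < pre a y -> y \in X) ->
        forall y, 0 < post a y -> y \in X) -> Z \subset X) ->
  exists n sg d, [/\ {subset sg <= V}, fires sg (fun y => n * c y) d
                   & forall y, y \in Z -> 0 < d y].
Proof.
move=> HZ.
pose reached (B : {set T}) := exists n sg d,
  [/\ {subset sg <= V}, fires sg (fun y => n * c y) d
    & forall y, y \in B -> 0 < d y].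
have reachedU (B C : {set T}) : reached B -> reached C -> reached (B :|: C).
  move=> [n [sg [d [sV H Hd]]]] [m [tau [e [tV H' He]]]].
  exists (n + m), (sg ++ tau), (fun y => d y + e y); split.
  - by move=> a; rewrite mem_cat => /orP[/sV|/tV].
  - by apply: fires_ext (fires_sum H H') => // y; rewrite mulnDl.
  - by move=> y; rewrite inE => /orP[/Hd|/He]; lia.
have reached0 : reached set0.
  exists 0, [::], (fun=> 0); split=> // [|y]; last by rewrite inE.
  by constructor.
have reached_big (B : {set T}) : (forall y, y \in B -> reached [set y]) -> reached B.
  move=> H.
  suff Hs (s : seq T) : {subset s <= B} -> reached [set y in s].
    by have := Hs (enum B); rewrite set_enum; apply=> y; rewrite mem_enum.
  elim: s => [|y s IH] sB; first by rewrite set_nil.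
  rewrite set_cons; apply: reachedU; first by apply/H/sB/mem_head.
  by apply: IH => z zs; apply: sB; rewrite inE zs orbT.
have sub : Z \subset [set y | asb (reached [set y])].
  apply: HZ => [y cy|a aV Ha y py]; rewrite inE; apply/asbP.
    exists 1, [::], c; split=> // [|z]; last by rewrite inE => /eqP ->.
    by constructor => z; rewrite mul1n.
  have [|n [sg [d [sV H Hd]]]] := reached_big [set z | 0 < pre a z].
    by move=> z; rewrite inE => /Ha; rewrite inE => /asbP.
  (* [K] copies of a run that marks all inputs of [a] supply enough tokens to fire [a]. *)
  pose K := \sum_z pre a z.
  have HK z : pre a z <= K * d z.
    case: (posnP (pre a z)) => [->//|pz]; have := Hd z; rewrite inE => /(_ pz) dz.
    have : pre a z <= K by rewrite /K (bigD1 z) //= leq_addr.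
    by move=> /leq_trans; apply; rewrite leq_pmulr.
  exists (K * n), (flatten (nseq K sg) ++ [:: a]),
    (fun z => post a z + (K * d z - pre a z)); split.
  - move=> b; rewrite mem_cat inE => /orP[/flattenP[s /nseqP[-> _] /sV]//|/eqP -> //].
  - apply: fires_cat.
      by apply: fires_ext (fires_mul K H) => // z; rewrite mulnA.
    apply: (fires_cons (r := fun z => K * d z - pre a z)); last by constructor.
    by move=> z; rewrite subnKC.
  - by move=> z; rewrite inE => /eqP ->; lia.
have [n [sg [d [sV H Hd]]]] : reached Z.
  by apply: reached_big => y /(subsetP sub); rewrite inE => /asbP.
by exists n, sg, d.
Qed.

End Net.

(** Reversed sequences fire in the net with inputs and outputs exchanged; so [fires_cover] also
    serves for unmarking. *)
Lemma fires_rev pre post sg c d : fires pre post sg c d -> fires post pre (rev sg) d c.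
Proof.
elim=> {sg c d} [c d cd|a sg c r d Hc _ IH]; first by constructor.
rewrite rev_cons -cats1; apply: fires_cat IH _.
by apply: (fires_cons (r := r)); [|constructor].
Qed.

(* First mark every place of [Z], last unmark what [d] does not mark; in       *)
(* between all places stay marked, so that after scaling the remaining firings *)
(* can be done in small portions.                                              *)
Lemma fires_scaled pre post (V : {set A}) (Z : {set T}) c d (x : A -> nat) (M : nat) :
  (forall a, (0 < x a) = (a \in V)) ->
  (forall y, d y + \sum_a x a * pre a y = c y + \sum_a x a * post a y) ->
  (forall a y, a \in V -> 0 < pre a y -> y \in Z) ->
  (forall X : {set T}, (forall y, 0 < c y -> y \in X) ->
     (forall a, a \in V -> (forall y, 0 < pre a y -> y \in X) ->
        forall y, 0 < post a y -> y \in X) -> Z \subset X) ->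
  (forall X : {set T}, (forall y, 0 < d y -> y \in X) ->
     (forall a, a \in V -> (forall y, 0 < post a y -> y \in X) ->
        forall y, 0 < pre a y -> y \in X) -> Z \subset X) ->
  exists2 K, 0 < K & exists sg tau q,
    [/\ fires pre post sg (fun y => K * c y) q,
        fires pre post tau q (fun y => K * d y),
        forall a, (a \in sg ++ tau) = (a \in V)
      & forall y, y \in Z -> M <= q y].
Proof.
move=> Vx bal preZ fwd bwd.
have [n1 [s1 [d1 [s1V H1 d1Z]]]] := fires_cover fwd.
have [n2 [s2 [d2 [s2V H2 d2Z]]]] := fires_cover bwd.
have {}H2 := fires_rev H2.
(* Large enough for the scalings of both covering runs and, for every transition, larger than its
   number of firings in both runs together. *)
pose K := n1 + n2 + size s1 + size s2 + 1.
pose m0 y := d1 y + (K - n1) * c y.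
pose m1 y := d2 y + (K - n2) * d y.
have G1 : fires pre post s1 (fun y => K * c y) m0.
  apply: fires_ext (fires_add (fun y => (K - n1) * c y) H1) => // y.
  by rewrite -mulnDl; congr (_ * _); rewrite /K; lia.
have G2 : fires pre post (rev s2) m1 (fun y => K * d y).
  apply: fires_ext (fires_add (fun y => (K - n2) * d y) H2) => // y.
  by rewrite -mulnDl; congr (_ * _); rewrite /K; lia.
have Kcount a : count_mem a s1 + count_mem a s2 < K.
  have H (s : seq A) : count_mem a s <= size s by exact: count_size.
  by have := H s1; have := H s2; rewrite /K; lia.
(* The firings left over when both covering runs are deducted; still positive exactly on [V]. *)
pose u a := K * x a - (count_mem a s1 + count_mem a s2).
have ux a : K * x a = u a + (count_mem a s1 + count_mem a s2).
  rewrite /u subnK //; case: (posnP (x a)) => [xa|xa].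
    have aV : a \notin V by rewrite -Vx xa.
    rewrite !(count_memPn _) //; apply: contra aV; [exact: s2V|exact: s1V].
  apply: (@leq_trans (K * 1)); last by rewrite leq_mul2l xa orbT.
  by have := Kcount a; lia.
have u0 a : (0 < u a) = (a \in V).
  rewrite -Vx; apply/idP/idP => [|xa]; first by rewrite /u; case: (x a) => //; lia.
  rewrite /u subn_gt0; apply: (@leq_trans (K * 1)); last by rewrite leq_mul2l xa orbT.
  by have := Kcount a; lia.
pose Y := flatten [seq nseq (u a) a | a <- enum A].
have totY F y : amount F Y y = \sum_a u a * F a y.
  rewrite /amount big_flatten big_map big_enum /=.
  by apply: eq_bigr => a _; rewrite big_nseq iter_addn_0 mulnC.
have memY a : (a \in Y) = (a \in V).
  rewrite -u0; apply/flattenP/idP => [[s /mapP[b _ ->] /nseqP[-> //]]|ua].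
  by exists (nseq (u a) a); [apply/map_f/mem_enum|rewrite mem_nseq ua /=].
have balY y : m1 y + amount pre Y y = m0 y + amount post Y y.
  have := fires_eq G1 y; have := fires_eq G2 y; have := congr1 (muln K) (bal y).
  have E F : K * (\sum_a x a * F a y) = amount F Y y + amount F s1 y + amount F s2 y.
    rewrite totY !amount_count big_distrr -!big_split; apply: eq_bigr => a _ /=.
    by rewrite mulnA ux !mulnDl addnA.
  by rewrite !mulnDr !E !amount_rev; lia.
(* As many tokens on every place of [Z] pay for a whole round [Y] and exceed [M]. *)
pose lam := M + \sum_y amount pre Y y + 1.
have preY y : amount pre Y y <= (if y \in Z then lam else 0).
  case: ifPn => [_|yZ].
    rewrite /lam; have : amount pre Y y <= \sum_z amount pre Y z.
      by rewrite (bigD1 y) //= leq_addr.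
    by lia.
  rewrite leqn0 totY sum_nat_eq0; apply/forallP => a /=; rewrite muln_eq0.
  case: (posnP (u a)) => //= ua; rewrite -leqn0 leqNgt; apply: contra yZ => py.
  by apply: preZ py; rewrite -u0.
(* After [h] of the [lam] rounds the marking interpolates between [lam * m0] and [lam * m1]; as [m0]
   and [m1] are positive on [Z], it is at least [lam] there. *)
have G3 h : h <= lam -> fires pre post (flatten (nseq h Y)) (fun y => lam * m0 y)
    (fun y => (lam - h) * m0 y + h * m1 y).
  elim: h => [_|h IH Hh] /=; first by constructor => y; lia.
  have -> : Y ++ flatten (nseq h Y) = flatten (nseq h Y) ++ Y.
    by elim: h {IH Hh} => [|h IH] /=; rewrite ?cats0 // -catA -IH.
  apply: fires_cat (IH (ltnW Hh)) _; apply: fires_big => y.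
    apply: leq_trans (preY y) _; case: ifP => // yZ.
    have m0y : 0 < m0 y by have := d1Z y yZ; rewrite /m0; lia.
    have m1y : 0 < m1 y by have := d2Z y yZ; rewrite /m1; lia.
    have : (lam - h) * 1 + h * 1 <= (lam - h) * m0 y + h * m1 y.
      by apply: leq_add; rewrite leq_mul2l ?m0y ?m1y orbT.
    by lia.
  have -> : lam - h = (lam - h.+1).+1 by lia.
  by have := balY y; rewrite !mulSn; lia.
exists (lam * K); first by rewrite muln_gt0 /lam /K; lia.
exists (flatten (nseq lam s1)), (flatten (nseq lam Y) ++ flatten (nseq lam (rev s2))),
  (fun y => lam * m0 y); split.
- by apply: fires_ext (fires_mul lam G1) => // y; rewrite mulnA.
- apply: fires_cat (G3 _ (leqnn _)) _.
  by apply: fires_ext (fires_mul lam G2) => y; rewrite ?mulnA // subnn mul0n.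
- move=> a; apply/idP/idP; rewrite !mem_cat.
    case/or3P => /flattenP[s /nseqP[-> _]]; [exact: s1V|by rewrite memY|].
    by rewrite mem_rev; apply: s2V.
  move=> aV; apply/orP; right; apply/orP; left.
  by apply/flattenP; exists Y; rewrite ?memY // mem_nseq eqxx andbT /lam; lia.
- move=> y yZ; have := d1Z y yZ => dy; apply: (@leq_trans (lam * 1)); first by rewrite /lam; lia.
  by rewrite leq_mul2l /m0; lia.
Qed.

End Firing.

(** * Infinite runs *)

(** [phi i] is the least time up to which more than [i] marked times occur. The last clause matches
    time windows with contiguous ranges of indices, as [green] speaks of contiguous segments. *)
Lemma enumerate_infinite (b : pred nat) :
  (forall t, exists2 t', t <= t' & b t') ->
  exists phi : nat -> nat,
    [/\ {homo phi : i j / i < j}, forall t, b t <-> exists i, t = phi i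
      & forall t1 t2, t1 <= t2 -> exists i n,
          [seq phi j | j <- iota i n] = [seq t <- iota t1 (t2 - t1) | b t]].
Proof.
move=> Hb; pose idx t := count b (iota 0 t).
have idxS t : idx t.+1 = idx t + b t.
  by rewrite /idx -addn1 iotaD count_cat /= addn0.
have idx_mono t1 t2 : t1 <= t2 -> idx t1 <= idx t2.
  by move=> /subnK <-; rewrite /idx addnC iotaD count_cat leq_addr.
have idx_inf i : exists t, i < idx t.+1.
  elim: i => [|i [t Ht]].
    by have [t _ bt] := Hb 0; exists t; rewrite idxS bt addn1.
  have [t' le bt] := Hb t.+1; exists t'; rewrite idxS bt addn1 ltnS.
  exact: leq_trans Ht (idx_mono _ _ le).
pose phi i := ex_minn (idx_inf i).
have phiP i : b (phi i) /\ idx (phi i) = i.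
  rewrite /phi; case: ex_minnP => t Ht Hmin.
  have le : idx t <= i.
    case: t Ht Hmin => [//|t] _ Hmin; rewrite leqNgt; apply/negP => /Hmin.
    by rewrite ltnn.
  by move: Ht; rewrite idxS; case: (b t) => /=; lia.
have phiK t : b t -> phi (idx t) = t.
  rewrite /phi => bt; case: ex_minnP => s Hs /(_ t); rewrite idxS bt addn1 => /(_ (leqnn _)) le.
  apply/eqP; rewrite eqn_leq le leqNgt; apply/negP => lt.
  by have := leq_trans Hs (idx_mono _ _ lt); rewrite ltnn.
exists phi; split.
- move=> i j ij; rewrite ltnNge; apply/negP => /idx_mono.
  by rewrite !(proj2 (phiP _)) leqNgt ij.
- move=> t; split=> [bt|[i ->]]; last by case: (phiP i).
  by exists (idx t); rewrite phiK.
- move=> t1 t2 le12; move: (t2 - t1) => n {t2 le12}.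
  exists (idx t1), (idx (t1 + n) - idx t1).
  elim: n => [|n IH]; first by rewrite addn0 subnn.
  rewrite addnS idxS -[in RHS]addn1 iotaD filter_cat -IH /=.
  have := idx_mono _ _ (leq_addr n t1) => le.
  case: ifPn => bt /=; last by rewrite addn0 cats0.
  by rewrite addnC -addnBA // addnC iotaD map_cat /= subnKC // phiK.
Qed.

(** * Gluing finite paths into an infinite one *)

Section Concatenation.

Variables (X L : Type) (R : X -> L -> X -> Prop).
Implicit Types (f g : X) (w : seq (X * L * X)).

Fixpoint okpath f w : Prop :=
  if w is x :: w' then [/\ x.1.1 = f, R f x.1.2 x.2 & okpath x.2 w'] else True.

Definition endpoint f w : X := last f [seq x.2 | x <- w].

Lemma okpath_cat f w w' :
  okpath f (w ++ w') <-> okpath f w /\ okpath (endpoint f w) w'.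
Proof.
rewrite /endpoint; elim: w f => [|x w IH] f /=; first by split=> // -[].
split=> [[-> ? /IH[? ?]] //|[[-> ? ?] ?]]; split=> //; exact/IH.
Qed.

Lemma endpoint_cat f w w' : endpoint f (w ++ w') = endpoint (endpoint f w) w'.
Proof. by rewrite /endpoint map_cat last_cat. Qed.

Lemma okpath_nth f w d i : okpath f w -> i < size w ->
  let x := nth d w i in R x.1.1 x.1.2 x.2 /\
  (i.+1 < size w -> (nth d w i.+1).1.1 = x.2).
Proof.
elim: w f i => [//|x w IH] f [|i] /= [xf Rx Hw] Hi; last exact: (IH x.2 i Hw Hi).
by split=> [|]; [rewrite xf|case: w Hw {IH Hi} => //= y w []].
Qed.

Definition segment_of (c : nat -> X) (l : nat -> L) (t n : nat) :=
  [seq (c s, l s, c s.+1) | s <- iota t n].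

(** Dependent choice along an invariant. The index [r] lets the demands on the blocks grow, and the
    block boundaries [tau] are kept so that these demands can be read off the infinite path. *)
Lemma infinite_path (Inv : nat -> X -> Prop)
    (Good : nat -> seq (X * L * X) -> Prop) f0 :
  Inv 0 f0 ->
  (forall r f, Inv r f -> exists w,
     [/\ 0 < size w, okpath f w, Inv r.+1 (endpoint f w) & Good r w]) ->
  exists c l tau,
    [/\ c 0 = f0, forall t, R (c t) (l t) (c t.+1), forall r, r <= tau r
      & forall r, Good r (segment_of c l (tau r) (tau r.+1 - tau r))].
Proof.
move=> I0 HI.
pose blk r f := epsilon (inhabits [::]) (fun w =>
  [/\ 0 < size w, okpath f w, Inv r.+1 (endpoint f w) & Good r w]).
have blkP r f : Inv r f ->
  [/\ 0 < size (blk r f), okpath f (blk r f), Inv r.+1 (endpoint f (blk r f))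
    & Good r (blk r f)].
  by move=> If; exact: (epsilon_spec (inhabits [::]) _ (HI r f If)).
pose st := nat_rect (fun=> X) f0 (fun r f => endpoint f (blk r f)).
have Ist r : Inv r (st r) by elim: r => [//|r IH] /=; case: (blkP r _ IH).
(* [W r] consists of the first [r] blocks. No block is empty, so step [t] of the path is settled in
   [W t.+1]. *)
pose B r := blk r (st r); pose W r := flatten (mkseq B r).
have WS r : W r.+1 = W r ++ B r.
  by rewrite /W /mkseq -addn1 iotaD map_cat flatten_cat /= cats0.
have okW r : okpath f0 (W r) /\ endpoint f0 (W r) = st r.
  elim: r => [//|r [okr er]]; rewrite WS endpoint_cat er; split=> //.
  by apply/okpath_cat; split=> //; rewrite er; case: (blkP _ _ (Ist r)).
have szB r : 0 < size (B r) by case: (blkP _ _ (Ist r)).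
have szW r : r <= size (W r).
  by elim: r => // r IH; rewrite WS size_cat; have := szB r; lia.
have [d _] : exists d : X * L * X, True.
  by have := szB 0; case: (B 0) => // d w _; exists d.
have pre r n : W (r + n) = W r ++ flatten [seq B i | i <- iota r n].
  by rewrite /W /mkseq iotaD map_cat flatten_cat.
have nthW r s t : t < size (W r) -> t < size (W s) -> nth d (W r) t = nth d (W s) t.
  wlog rs : r s / r <= s.
    by move=> H Hr Hs; case: (leqP r s) => [|/ltnW] rs; [apply: H|rewrite (H s r)].
  by move=> Hr _; rewrite -(subnKC rs) pre nth_cat Hr.
pose c t := (nth d (W t.+1) t).1.1; pose l t := (nth d (W t.+1) t).1.2.
have c2 t : c t.+1 = (nth d (W t.+1) t).2 /\
    R (c t) (l t) (nth d (W t.+1) t).2.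
  have H1 := szW t.+1; have H2 := szW t.+2.
  have [Ht] := okpath_nth d (proj1 (okW t.+2)) (ltnW H2).
  rewrite /c /l (nthW t.+1 t.+2 t) //; last exact: ltnW.
  by move=> /(_ H2) ->; split.
exists c, l, (fun r => size (W r)); split=> //.
- rewrite /c WS; have := szB 0; case: (blkP _ _ (Ist 0)) => _ + _ _.
  by rewrite -/(B 0); case: (B 0) => //= x w [].
- by move=> t; have [-> ] := c2 t.
- move=> r; have [_ _ _] := blkP _ _ (Ist r); rewrite -/(B r).
  congr Good; apply: (@eq_from_nth _ d).
    by rewrite size_map size_iota WS size_cat addKn.
  move=> i Hi; rewrite (nth_map 0) ?size_iota; last by rewrite WS size_cat addKn.
  rewrite nth_iota; last by rewrite WS size_cat addKn.
  have [-> _] := c2 (size (W r) + i).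
  have lt : size (W r) + i < size (W r.+1) by rewrite WS size_cat ltn_add2l.
  have E : nth d (W (size (W r) + i).+1) (size (W r) + i) = nth d (B r) i.
    rewrite (nthW (size (W r) + i).+1 r.+1 _ (szW _) lt).
    by rewrite WS nth_cat ltnNge leq_addr /= addKn.
  by rewrite /c /l E; case: (nth d (B r) i) => -[].
Qed.

End Concatenation.

(** * Executions of one process; pigeonhole over processes *)

Section Executions.

Variables (k : nat) (Act T : finType) (Q : lts k Act T).
Local Notation glab := (glabel k Act).

Definition swap0 (N : nat) (p i : 'I_N.+1) : 'I_N.+1 :=
  if i == ord0 then p else if i == p then ord0 else i.

Lemma swap0K N (p : 'I_N.+1) : involutive (swap0 p).
Proof.
move=> i; rewrite /swap0.
case: (eqVneq i ord0) => [->|i0]; first by rewrite eqxx; case: eqP.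
case: (eqVneq i p) => [->|ip]; first by rewrite eqxx.
by rewrite (negbTE i0) (negbTE ip).
Qed.

(** Executions are those of process 1; the transposition [swap0 p] gives its role to process [p].
    Infinitely many moves make the execution infinite. *)
Lemma execution_of_process N (c : nat -> config T N.+1) (l : nat -> glab N.+1) p :
  let move t := taken (c t) (l t) (c t.+1) p in
  is_run Q c l -> (forall t, exists2 t', t <= t' & move t' != None) ->
  exists xi, [/\ infinite_execution Q xi,
    forall q : pred (edge k Act T), infinitely_often q xi <->
      forall t, exists t' e, [/\ t <= t', move t' = Some e & q e]
  & forall t1 t2, t1 <= t2 -> exists i n,
      [seq xi j | j <- iota i n] = pmap move (iota t1 (t2 - t1))].
Proof.
move=> move [Hinit Hstep] inf.
have [phi [phi_homo phiP phi_seg]] := enumerate_infinite inf.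
have [e0 _] : exists e : edge k Act T, True.
  by have [t _] := inf 0; case: (move t) => // e _; exists e.
pose xi i := odflt e0 (move (phi i)).
have xiE i : move (phi i) = Some (xi i).
  have /phiP : exists j, phi i = phi j by exists i.
  by rewrite /xi; case: (move (phi i)).
exists xi; split.
- exists N, (fun t => [ffun i => c t (swap0 p i)]).
  exists (fun t => if l t is Some (a, r) then Some (a, [ffun j => swap0 p (r j)])
                   else None), phi.
  have moveE t : taken [ffun i => c t (swap0 p i)]
     (if l t is Some (a, r) then Some (a, [ffun j => swap0 p (r j)]) else None)
     [ffun i => c t.+1 (swap0 p i)] ord0 = move t.
    rewrite /move /taken; case: (l t) => [[a r]|]; rewrite !ffunE /swap0 eqxx //.
    rewrite (eq_pick (Q := fun j => r j == p)) // => j /=; rewrite ffunE.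
    by rewrite -[RHS](can_eq (swap0K p)) /swap0 eqxx; case: (eqVneq p ord0) => [->|].
  split=> //.
  + split=> [i|t]; first by rewrite ffunE.
    move: (Hstep t); rewrite /transition; case: (l t) => [[a r]|] => [[rinj Hr Hid]|H].
      split=> [j1 j2|j|i Hi].
      * by rewrite !ffunE => /(can_inj (swap0K p))/rinj.
      * by rewrite !ffunE swap0K.
      * rewrite !ffunE; apply: Hid => j Ej; apply: (Hi j).
        by rewrite ffunE -Ej swap0K.
    by move=> i; rewrite !ffunE.
  + by move=> t; rewrite moveE; split=> [/eqP/phiP|/phiP/eqP].
  + by move=> i; rewrite moveE.
- move=> q; split=> [H t|H n].
    have [i ti qi] := H t; exists (phi i), (xi i); split=> //.
    apply: leq_trans ti _; elim: i {qi} => // i IH.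
    exact: leq_ltn_trans IH (phi_homo _ _ (ltnSn i)).
  have [t [e [nt Et qe]]] := H (phi n).
  have /phiP [i Ei] : move t != None by rewrite Et.
  exists i; last by move: (xiE i); rewrite -Ei Et => -[<-].
  rewrite leqNgt; apply/negP => /phi_homo; rewrite -Ei; lia.
- move=> t1 t2 /phi_seg [i [n Eseg]]; exists i, n.
  elim: (iota i n) (iota t1 (t2 - t1)) Eseg => [|j s IH] s'.
    by elim: s' => //= t s' IH; case: (move t) => //=.
  elim: s' => //= t s' IHs'; case Et: (move t) => [e|] //=.
  by case=> Ejt /IH ->; move: (xiE j); rewrite Ejt Et => -[->].
Qed.

Definition takers N (e : edge k Act T) (x : config T N * glab N * config T N) : nat :=
  \sum_(p < N) (taken x.1.1 x.1.2 x.2 p == Some e).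

(** If every [p] failed at some [r], all would fail at the maximum of these [r]. With [F r p] saying
    that [p] occurs from time [r] on, this is the infinite pigeonhole principle. *)
Lemma antitone_pigeonhole (I : finType) (F : nat -> I -> Prop) :
  (forall r s p, r <= s -> F s p -> F r p) ->
  (forall r, exists p, F r p) -> exists p, forall r, F r p.
Proof.
move=> mono HF; apply: NNPP => no.
have bad p : exists r, ~ F r p.
  by apply: NNPP => H; apply: no; exists p => r; apply: NNPP => H'; apply: H; exists r.
have [r Hr] : exists r : {ffun I -> nat}, forall p, ~ F (r p) p.
  exists [ffun p => epsilon (inhabits 0) (fun r => ~ F r p)] => p; rewrite ffunE.
  exact: (epsilon_spec (inhabits 0) _ (bad p)).
have [p Fp] := HF (\max_p r p).
by apply: (Hr p); apply: mono Fp; apply: leq_bigmax.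
Qed.

(** Some process takes [e] infinitely often. Every process moves in every broadcast, so its
    broadcast edges correspond to the broadcasts of the run. *)
Lemma run_infinitely_often N (c : nat -> config T N.+1) (l : nat -> glab N.+1) e :
  is_run Q c l ->
  (forall t, exists2 t', t <= t' & 0 < takers e (c t', l t', c t'.+1)) ->
  exists xi, [/\ infinite_execution Q xi, infinitely_often (pred1 e) xi,
    (forall t, exists2 t', t <= t' & l t' = None) ->
      infinitely_often (@is_bcast k Act T) xi
  & (exists t, forall t', t <= t' -> l t' <> None) ->
      finitely_often (@is_bcast k Act T) xi].
Proof.
move=> Hrun He.
pose F t p := exists2 t', t <= t' & taken (c t') (l t') (c t'.+1) p = Some e.
have [p Hp] : exists p, forall t, F t p.
  apply: antitone_pigeonhole => [r s p rs [t' st Et]|t].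
    by exists t' => //; apply: leq_trans st.
  have [t' tt' Ht'] := He t.
  have /existsP[p Hp] : [exists p, taken (c t') (l t') (c t'.+1) p == Some e].
    rewrite -[[exists p, _]]negbK negb_exists; apply/negP => /forallP no.
    by move: Ht'; rewrite /takers big1 // => p _; rewrite (negbTE (no p)).
  by exists p, t' => //; apply/eqP.
have [|xi [Hxi xiP _]] := execution_of_process (p := p) Hrun.
  by move=> t; have [t' ? E] := Hp t; exists t' => //; rewrite E.
exists xi; split=> //.
- by apply/xiP => t; have [t' tt' Et] := Hp t; exists t', e; rewrite /= eqxx.
- move=> Hb; apply/xiP => t; have [t' tt' Et] := Hb t.
  by exists t', (c t' p, bcast k Act, c t'.+1 p); rewrite Et.
- move=> [t Ht] /xiP /(_ t) [t' [e' [tt' Et be]]]; apply: (Ht _ tt').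
  move: Et; rewrite /taken; case: (l t') => [[a r]|] //.
  by case: pickP => // j _ [Ee]; move: be; rewrite -Ee.
Qed.

Lemma run_green N (c : nat -> config T N.+1) (l : nat -> glab N.+1) e :
  is_run Q c l ->
  (forall t, exists2 t', t <= t' & l t' = None) ->
  (forall r, exists t n, (forall s, t <= s < t + n -> l s <> None) /\
     r <= \sum_(t <= s < t + n) takers e (c s, l s, c s.+1)) ->
  green Q e.
Proof.
move=> Hrun Hb Hseg.
pose F r p := exists t n, (forall s, t <= s < t + n -> l s <> None) /\
  r <= \sum_(t <= s < t + n) (taken (c s) (l s) (c s.+1) p == Some e).
have [p Hp] : exists p, forall r, F r p.
  apply: antitone_pigeonhole => [r s p rs [t [n [Hl Hs]]]|r].
    by exists t, n; split=> //; apply: leq_trans Hs.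
  (* Shared by [N.+1] processes, so many occurrences leave at least [r] to one of them. *)
  have [t [n [Hl Hs]]] := Hseg (r * N.+1).
  move: Hs; rewrite /takers exchange_big /= => Hs.
  have [p Hp] : exists p : 'I_N.+1,
      r <= \sum_(t <= s < t + n) (taken (c s) (l s) (c s.+1) p == Some e).
    case: (posnP r) => [->|r0]; first by exists ord0.
    apply: NNPP => no; move: Hs; rewrite leqNgt => /negP; apply.
    apply: (@leq_ltn_trans (\sum_(p < N.+1) r.-1)).
      apply: leq_sum => p _; rewrite -ltnS prednK // ltnNge; apply/negP => H.
      by apply: no; exists p.
    by rewrite sum_nat_const card_ord mulnC ltn_mul2r prednK ?leqnn.
  by exists p, t, n.
have [|xi [Hxi xiP xiseg]] := execution_of_process (p := p) Hrun.
  move=> t; have [t' tt' Et] := Hb t; exists t' => //.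
  by rewrite Et.
exists xi; split=> //.
  apply/xiP => t; have [t' tt' Et] := Hb t.
  by exists t', (c t' p, bcast k Act, c t'.+1 p); rewrite Et.
move=> r; have [t [n [Hl Hs]]] := Hp r.
have [i [m Eseg]] := xiseg t (t + n) (leq_addr _ _).
exists i, m; rewrite Eseg addKn; split.
  apply/hasPn => e'; rewrite mem_pmap => /mapP[s].
  rewrite mem_iota => /Hl; rewrite /taken; case: (l s) => [[a q]|] // _.
  by case: pickP => // j _ [->].
apply: leq_trans Hs _; rewrite /index_iota addKn.
elim: (iota t n) => [|s s' IH] /=; first by rewrite big_nil.
rewrite big_cons; case: (taken _ _ _ p) => [e'|] //=.
by rewrite leq_add2l.
Qed.

End Executions.

(** * From runs to flows *)

Section Characterization.

Variables (k : nat) (Act T : finType) (Q : lts k Act T) (lev : T -> nat).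
Local Notation edg := (edge k Act T).
Local Notation glab := (glabel k Act).
Local Notation is_bc := (@is_bcast k Act T).

Definition source (e : edg) : T := e.1.1.
Definition target (e : edg) : T := e.2.

(** One action on two levels counts as two different rendezvous, hence the comparison of levels. *)
Definition synchronized (e e' : edg) : bool :=
  if (e.1.2, e'.1.2) is (Some (a, _), Some (b, _)) then
    (a == b) && (lev (source e) == lev (source e'))
  else false.

Definition flow (g : edg -> nat) : Prop :=
  [/\ forall e, 0 < g e -> e \in edges Q,
      forall x, \sum_(e | source e == x) g e = \sum_(e | target e == x) g e
    & forall e e', e \in edges Q -> e' \in edges Q -> synchronized e e' -> g e = g e'].

(** For sources and targets: processes brought in by the broadcast edges of [U] can populate all
    sources through rendezvous of [U]. Exchanging [s] and [t] says the same with time reversed. *)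
Definition covers (U : {set edg}) (s t : edg -> T) : Prop :=
  forall X : {set T},
    (forall e, e \in U -> is_bc e -> t e \in X) ->
    (forall e, e \in U -> ~~ is_bc e ->
       (forall e', e' \in U -> synchronized e e' -> s e' \in X) -> t e \in X) ->
    forall e, e \in U -> s e \in X.

Definition circulation (U : {set edg}) : Prop :=
  [/\ U \subset edges Q,
      forall e, e \in U -> exists g,
        [/\ flow g, forall e', 0 < g e' -> e' \in U & 0 < g e],
      covers U source target & covers U target source].

Definition rdz_cycle (U : {set edg}) (e : edg) : Prop :=
  exists g, [/\ flow g, forall e', 0 < g e' -> e' \in U,
    forall e', is_bc e' -> g e' = 0 & 0 < g e].

Definition recurrent (e : edg) : Prop :=
  exists U, circulation U /\ e \in U.

Definition pumpable (e : edg) : Prop :=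
  exists U, [/\ circulation U, e \in U & rdz_cycle U e].

Hypothesis rdz_lev : forall x a j y,
  (x, rdz a j, y) \in edges Q -> lev y = lev x.
Variable nxt : nat -> nat.
Hypothesis bcast_lev : forall x y,
  (x, bcast k Act, y) \in edges Q -> lev y = nxt (lev x).
Hypothesis rdz_uniq : forall a j x y x' y',
  (x, rdz a j, y) \in edges Q -> (x', rdz a j, y') \in edges Q ->
  lev x = lev x' -> x = x' /\ y = y'.
Hypothesis init_lev : forall x, x \in init Q -> lev x = 0.

Section Step.

Variables (N : nat) (f : config T N) (l : glab N) (g : config T N).
Hypothesis Hstep : transition Q f l g.

Lemma takenP p : if taken f l g p is Some e then
   [/\ e \in edges Q, source e = f p & target e = g p] else f p = g p.
Proof.
move: Hstep; rewrite /transition /taken; case: l => [[a r] [rinj Hr Hid]|H] //.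
case: pickP => [j /eqP <-|no]; first by split.
by rewrite Hid // => j E; have := no j; rewrite E eqxx.
Qed.

Lemma takers_edge e : 0 < takers e (f, l, g) -> e \in edges Q.
Proof.
rewrite lt0n sum_nat_eq0 negb_forall => /existsP[p] /=.
by rewrite eqb0 negbK => /eqP E; have := takenP p; rewrite E => -[].
Qed.

Definition count_at (f : config T N) (x : T) : nat := \sum_(p < N) (f p == x).

(** Each process either stays or contributes one edge from [f p] to [g p]. *)
Lemma takers_balance x :
  count_at f x + \sum_(e | target e == x) takers e (f, l, g) =
  count_at g x + \sum_(e | source e == x) takers e (f, l, g).
Proof.
have ex (q : pred edg) : \sum_(e | q e) takers e (f, l, g) =
    \sum_(p < N) \sum_(e | q e) (taken f l g p == Some e) by exact: exchange_big.
rewrite !ex -!big_split; apply: eq_bigr => p _ /=.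
have sum1 (q : pred edg) (o : option edg) :
    \sum_(e | q e) (o == Some e) = if o is Some e then q e : nat else 0.
  case: o => [e|]; last by rewrite big1.
  rewrite big_mkcond (bigD1 e) //= eqxx big1 ?addn0; first by case: (q e).
  move=> e' ne; case: (q e') => //; apply/eqP; rewrite eqb0.
  by apply: contra ne => /eqP[->].
rewrite !sum1; have := takenP p.
by case: (taken f l g p) => [e [_ -> ->]|->]; lia.
Qed.

(** On a common level the edge of a role is unique, so the process in role [j] takes [e] exactly
    when action and level agree, and no other process does. *)
Lemma takers_rdz e a j : (forall p q, lev (f p) = lev (f q)) ->
  e \in edges Q -> e.1.2 = rdz a j ->
  takers e (f, l, g) = if l is Some (b, r) then
    (a == b) && (lev (source e) == lev (f (r j))) : nat else 0.
Proof.
move=> Hlev; case: e => [[x lab] y] /= He Elab; subst lab; rewrite /source /=.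
move: Hstep; rewrite /takers /transition /taken.
case: l => [[b r] [rinj Hr Hid]|H]; last first.
  by rewrite big1 // => p _; apply/eqP; rewrite eqb0; apply/negP => /eqP[].
rewrite (bigD1 (r j)) //= big1 ?addn0 => [|p pj].
  case: pickP => [j' /eqP /rinj ->|/(_ j)]; last by rewrite eqxx.
  apply: congr1; apply/eqP/andP => [[-> -> _]|[/eqP ab /eqP Ex]]; first by [].
  by subst b; have [-> ->] := rdz_uniq He (Hr j) Ex.
case: pickP => [j' /eqP Ej'|//]; apply/eqP; rewrite eqb0.
by apply/negP => /eqP [_ _ Ej _]; move: pj; rewrite -Ej' Ej eqxx.
Qed.

Lemma takers_bcast e : is_bc e -> 0 < takers e (f, l, g) -> l = None.
Proof.
move=> be; rewrite lt0n sum_nat_eq0 negb_forall => /existsP[p] /=.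
rewrite eqb0 negbK /taken; case: l => [[a r]|] //.
by case: pickP => // j _ /eqP[E]; move: be; rewrite -E.
Qed.

Lemma takers_taken p e : taken f l g p = Some e -> 0 < takers e (f, l, g).
Proof. by move=> E; rewrite /takers (bigD1 p) //= E eqxx. Qed.

Lemma takers_same e e' : (forall p q, lev (f p) = lev (f q)) ->
  e \in edges Q -> e' \in edges Q -> synchronized e e' ->
  takers e (f, l, g) = takers e' (f, l, g).
Proof.
move=> Hlev He He'; rewrite /synchronized.
case El: e.1.2 => [[a j]|] //; case El': e'.1.2 => [[b j']|] //.
move=> /andP[/eqP ab /eqP Elev]; subst b.
rewrite (takers_rdz Hlev He El) (takers_rdz Hlev He' El') Elev.
by case: l => [[b r]|] //; rewrite (Hlev (r j) (r j')).
Qed.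

(** Only broadcasts change the level, and they move every process to the successor level. *)
Lemma step_level : (forall p q, lev (f p) = lev (f q)) ->
  forall p q, lev (g p) = lev (g q).
Proof.
move=> Hlev; have Hp p : lev (g p) = if l is Some _ then lev (f p) else nxt (lev (f p)).
  move: Hstep; rewrite /transition; case: l => [[a r] [rinj Hr Hid]|H].
    case: (pickP (fun j => r j == p)) => [j /eqP <-|no].
      exact: rdz_lev (Hr j).
    by rewrite Hid // => j E; have := no j; rewrite E eqxx.
  exact: bcast_lev (H p).
by move=> p q; rewrite !Hp; case: l => [_|]; rewrite (Hlev p q).
Qed.

End Step.

(** * Traffic between two repetitions of a configuration *)

Section Cycles.

Variables (N : nat) (c : nat -> config T N) (l : nat -> glab N).
Hypothesis Hrun : is_run Q c l.

Lemma run_level t p q : lev (c t p) = lev (c t q).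
Proof.
have [Hi Hs] := Hrun; elim: t p q => [|t IH] p q.
  by rewrite !init_lev.
exact: step_level (Hs t) IH p q.
Qed.

Definition traffic t1 t2 (e : edg) : nat :=
  \sum_(t1 <= t < t2) takers e (c t, l t, c t.+1).

Lemma traffic_gt0 t1 t2 e : 0 < traffic t1 t2 e ->
  exists t, [/\ t1 <= t, t < t2 & 0 < takers e (c t, l t, c t.+1)].
Proof.
move=> H; apply: NNPP => no; move: H; rewrite /traffic big_nat big1 // => t /andP[t1t tt2].
apply/eqP; rewrite -leqn0 leqNgt; apply/negP => H; apply: no; exists t; split=> //.
Qed.

Lemma traffic_ge t1 t2 t e : t1 <= t -> t < t2 ->
  0 < takers e (c t, l t, c t.+1) -> 0 < traffic t1 t2 e.
Proof.
move=> t1t tt2 H; rewrite /traffic (bigD1_seq t) ?iota_uniq //=.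
  by rewrite addn_gt0 H.
by rewrite mem_index_iota t1t.
Qed.

(** The balances of the single steps telescope, and the two equal end configurations cancel. *)
Lemma traffic_flow t1 t2 : t1 <= t2 -> c t1 = c t2 -> flow (traffic t1 t2).
Proof.
have [Hi Hs] := Hrun; move=> le12 E12; split=> [e|x|e e' He He' ee'].
- by move=> /traffic_gt0[t [_ _ /takers_edge]]; apply.
- have H n : count_at (c t1) x + \sum_(e | target e == x) traffic t1 (t1 + n) e =
      count_at (c (t1 + n)) x + \sum_(e | source e == x) traffic t1 (t1 + n) e.
    elim: n => [|n IH].
      by rewrite addn0; congr (_ + _); rewrite !big1 // => e _; rewrite /traffic big_geq.
    have E (q : pred edg) : \sum_(e | q e) traffic t1 (t1 + n.+1) e =
       \sum_(e | q e) traffic t1 (t1 + n) e +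
       \sum_(e | q e) takers e (c (t1 + n), l (t1 + n), c (t1 + n).+1).
      rewrite -big_split; apply: eq_bigr => e _.
      by rewrite /traffic addnS big_nat_recr //= leq_addr.
    by have := takers_balance (Hs (t1 + n)) x; rewrite !E addnS; lia.
  by have := H (t2 - t1); rewrite subnKC // -E12; lia.
- by apply: eq_bigr => t _; apply: takers_same => //; apply: run_level.
Qed.

Lemma takers_ex t e : 0 < takers e (c t, l t, c t.+1) ->
  exists p, taken (c t) (l t) (c t.+1) p = Some e.
Proof.
rewrite lt0n sum_nat_eq0 negb_forall => /existsP[p] /=.
by rewrite eqb0 negbK => /eqP Ep; exists p.
Qed.

(** The window ends with a broadcast into its initial configuration. So the states of [c t1] are
    targets of broadcast edges, and forward closure reaches the later configurations one by one;
    likewise the states of [c t2] are sources of broadcast edges, and backward closure descends from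
    there. *)
Lemma traffic_circulation t1 t2 :
  t1 <= t2 -> l t2 = None -> c t1 = c t2.+1 ->
  circulation [set e | 0 < traffic t1 t2.+1 e].
Proof.
have [Hi Hs] := Hrun; move=> le12 lt2 E12.
set U := [set e | _].
have UP t e p : t1 <= t -> t <= t2 -> taken (c t) (l t) (c t.+1) p = Some e -> e \in U.
  move=> t1t tt2 Et; rewrite inE; apply: (traffic_ge t1t) => //.
  exact: takers_taken Et.
have Usame t e e' p : t1 <= t -> t <= t2 -> e' \in U -> synchronized e e' ->
    taken (c t) (l t) (c t.+1) p = Some e ->
    exists q, taken (c t) (l t) (c t.+1) q = Some e'.
  move=> t1t tt2; rewrite inE => /traffic_gt0[s [_ _ /takers_edge He']] ee' Et.
  apply: takers_ex; have := takers_taken Et.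
  have := takenP (Hs t) p; rewrite Et => -[He _ _].
  by rewrite (takers_same (Hs t) (run_level t) He _ ee') //; apply: He'.
have Ub t p : t1 <= t -> t <= t2 -> l t = None ->
    (c t p, bcast k Act, c t.+1 p) \in U.
  by move=> t1t tt2 lt; apply: (UP t _ p) => //; rewrite lt.
have Uex e : e \in U -> exists t p, [/\ t1 <= t, t <= t2, source e = c t p & target e = c t.+1 p].
  rewrite inE => /traffic_gt0[t [t1t tt2 /takers_ex[p Ep]]].
  by exists t, p; have := takenP (Hs t) p; rewrite Ep => -[].
have flowU : flow (traffic t1 t2.+1) by apply: traffic_flow => //; apply: leqW.
split.
- apply/subsetP => e; rewrite inE => /traffic_gt0[t [_ _]].
  exact: takers_edge (Hs t) _.
- move=> e; rewrite inE => He; exists (traffic t1 t2.+1).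
  by split=> // e'; rewrite inE.
- move=> X Xb Xr e /Uex[t [p [t1t tt2 -> _]]].
  rewrite -(subnKC t1t) in tt2 *; move: (t - t1) p tt2 => n {t t1t}.
  elim: n => [|n IH] p; rewrite ?addn0 => Hn.
    rewrite E12; have := Xb (c t2 p, bcast k Act, c t2.+1 p).
    by apply=> //; apply: Ub.
  rewrite addnS in Hn *.
  have Xn q : c (t1 + n) q \in X by apply/IH/ltnW.
  have le1 := leq_addr n t1; have le2 := ltnW Hn.
  have := takenP (Hs (t1 + n)) p; case Et: taken => [e'|]; last by move=> <-.
  move=> [_ _ <-]; have e'U := UP _ _ _ le1 le2 Et.
  case: (boolP (is_bc e')) => be'; first exact: Xb.
  apply: Xr => // e2 e2U e'e2.
  have [q Eq] := Usame _ _ _ _ le1 le2 e2U e'e2 Et.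
  by have := takenP (Hs (t1 + n)) q; rewrite Eq => -[_ -> _].
- move=> X Xb Xr.
  have H n p : n <= t2 - t1 -> c (t2 - n) p \in X.
    elim: n p => [|n IH] p Hn; rewrite ?subn0.
      have := Xb (c t2 p, bcast k Act, c t2.+1 p).
      by apply=> //; apply: Ub.
    have En : t2 - n = (t2 - n.+1).+1 by lia.
    have Xn q : c (t2 - n.+1).+1 q \in X by rewrite -En; apply/IH/ltnW.
    have le1 : t1 <= t2 - n.+1 by lia.
    have le2 : t2 - n.+1 <= t2 by lia.
    have := takenP (Hs (t2 - n.+1)) p; case Et: taken => [e'|]; last by move=> ->.
    move=> [_ <- _]; have e'U := UP _ _ _ le1 le2 Et.
    case: (boolP (is_bc e')) => be'; first exact: Xb.
    apply: Xr => // e2 e2U e'e2.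
    have [q Eq] := Usame _ _ _ _ le1 le2 e2U e'e2 Et.
    by have := takenP (Hs (t2 - n.+1)) q; rewrite Eq => -[_ _ ->].
  have Xt t p : t1 <= t -> t <= t2 -> c t p \in X.
    by move=> t1t tt2; rewrite -(subKn tt2); apply: H; lia.
  move=> e /Uex[t [p [t1t tt2 _ ->]]].
  (* Edges of the last step end in [c t2.+1], which is [c t1] again. *)
  case: (ltngtP t t2) => [tt2'|t2t|->]; [exact: Xt (leqW t1t) tt2'|lia|].
  by rewrite -E12; apply: Xt.
Qed.

End Cycles.

Lemma homo_ltn_ge (phi : nat -> nat) : {homo phi : i j / i < j} -> forall i, i <= phi i.
Proof.
by move=> phi_homo; elim=> // i IH; apply: leq_ltn_trans IH (phi_homo _ _ (ltnSn i)).
Qed.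

(** * What an infinite execution implies for an edge *)

Section Necessity.

Variables (N : nat) (c : nat -> config T N.+1) (l : nat -> glab N.+1).
Variables (phi : nat -> nat) (xi : nat -> edg).
Hypothesis Hrun : is_run Q c l.
Hypothesis phi_homo : {homo phi : i j / i < j}.
Local Notation move t := (taken (c t) (l t) (c t.+1) ord0).
Hypothesis phiP : forall t, move t <> None <-> exists i, t = phi i.
Hypothesis phi_xi : forall i, move (phi i) = Some (xi i).

Lemma edge_times e : infinitely_often (pred1 e) xi ->
  forall t, exists2 t', t <= t' & 0 < takers e (c t', l t', c t'.+1).
Proof.
move=> He t; have [i ti /eqP Ei] := He t; exists (phi i).
  exact: leq_trans ti (homo_ltn_ge phi_homo i).
by apply: (takers_taken (p := ord0)); rewrite phi_xi Ei.
Qed.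

Lemma bcast_times : infinitely_often is_bc xi ->
  forall t, exists2 t', t <= t' & l t' = None.
Proof.
move=> Hb t; have [i ti Hi] := Hb t; exists (phi i).
  exact: leq_trans ti (homo_ltn_ge phi_homo i).
exact: takers_bcast Hi (takers_taken (phi_xi i)).
Qed.

Lemma bcast_index t : l t = None -> exists2 i, t = phi i & is_bc (xi i).
Proof.
move=> lt; have [i Ei] : exists i, t = phi i by apply/phiP; rewrite lt.
by exists i => //; move: (phi_xi i); rewrite -Ei /taken lt => -[<-].
Qed.

Lemma no_bcast_times : finitely_often is_bc xi ->
  exists t, forall t', t <= t' -> l t' <> None.
Proof.
move=> Hb; apply: NNPP => no; apply: Hb => n.
have [t tn lt] : exists2 t, phi n <= t & l t = None.
  apply: NNPP => H; apply: no; exists (phi n) => t tn lt; apply: H; by exists t.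
have [i Ei bi] := bcast_index lt; exists i => //.
by rewrite leqNgt; apply/negP => /phi_homo; rewrite -Ei; lia.
Qed.

(** After the last broadcast some configuration recurs forever; the flow is the traffic between two
    of its visits with [e] taken in between. *)
Lemma execution_rdz_cycle e : infinitely_often (pred1 e) xi ->
  finitely_often is_bc xi -> rdz_cycle (edges Q) e.
Proof.
move=> /edge_times He /no_bcast_times [t0 Ht0].
have [f Hf] : exists f, forall r, exists2 t, r <= t & c t = f.
  apply: antitone_pigeonhole => [r s f rs [t st Et]|r].
    by exists t => //; apply: leq_trans st.
  by exists (c r), r.
have [t1 t01 E1] := Hf t0; have [t t1t Ht] := He t1; have [t2 tt2 E2] := Hf t.+1.
exists (traffic c l t1 t2); split.
- by apply: (traffic_flow Hrun); [lia|rewrite E1].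
- by move=> e' /traffic_gt0[s [_ _]]; apply: takers_edge; case: Hrun.
- move=> e' be'; apply/eqP; rewrite -leqn0 leqNgt; apply/negP => /traffic_gt0.
  by move=> [s [t1s _ /(takers_bcast be')]]; apply: Ht0; lia.
- exact: traffic_ge Ht.
Qed.

Lemma recurring_config : infinitely_often is_bc xi ->
  exists f, forall r, exists t, [/\ r <= t, l t = None & c t.+1 = f].
Proof.
move=> /bcast_times Hb.
apply: antitone_pigeonhole => [r s f rs [t [st lt Et]]|r].
  by exists t; split=> //; apply: leq_trans st.
by have [t rt lt] := Hb r; exists (c t.+1), t.
Qed.

Lemma execution_recurrent e : infinitely_often (pred1 e) xi ->
  infinitely_often is_bc xi -> recurrent e.
Proof.
move=> /edge_times He /recurring_config [f Hf].
have [t1 [_ _ E1]] := Hf 0; have [t t1t Ht] := He t1.+1.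
have [t2 [tt2 lt2 E2]] := Hf t.
exists [set e' | 0 < traffic c l t1.+1 t2.+1 e']; split.
  by apply: (traffic_circulation Hrun) => //; [lia|rewrite E1].
by rewrite inE; apply: traffic_ge Ht; lia.
Qed.

(** A broadcast-free segment with more occurrences of [e] than configurations repeats a
    configuration between two of them, which gives the rendezvous flow. The circulation is the
    traffic of a larger window, between two broadcasts into a recurring configuration. *)
Lemma execution_pumpable e : infinitely_often is_bc xi ->
  (forall r, exists i n, let s := [seq xi j | j <- iota i n] in
     ~~ has is_bc s /\ r <= count_mem e s) ->
  pumpable e.
Proof.
move=> /recurring_config [f Hf] Hseg.
have [t1 [_ _ E1]] := Hf 0.
(* The summand [t1.+1] pays for occurrences with index at most [t1]; the others happen after time
   [t1], because [phi j] is at least [j], and still outnumber the configurations. *)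
have [i [n [nb cnt]]] := Hseg (t1.+1 + #|{: config T N.+1}|.+1).
pose J := [seq j <- iota i n | (xi j == e) && (t1 < j)].
have szJ : #|{: config T N.+1}| < size J.
  move: cnt; rewrite count_map size_filter.
  have -> : count (preim xi (pred1 e)) (iota i n) =
      count (fun j => (xi j == e) && (t1 < j)) (iota i n) +
      count (fun j => (xi j == e) && (j <= t1)) (iota i n).
    elim: (iota i n) => //= j s ->; case: (xi j == e) => //=.
    by case: ltnP => /=; lia.
  have : count (fun j => (xi j == e) && (j <= t1)) (iota i n) <= t1.+1.
    rewrite -size_filter -(size_iota 0 t1.+1); apply: uniq_leq_size.
      by rewrite filter_uniq ?iota_uniq.
    by move=> j; rewrite mem_filter => /andP[/andP[_ jt] _]; rewrite mem_iota; lia.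
  lia.
have [j [j' [jJ j'J jj' Ec]]] : exists j j', [/\ j \in J, j' \in J, j < j' & c (phi j) = c (phi j')].
  apply: NNPP => no.
  have inj : {in J &, injective (fun j => c (phi j))}.
    move=> j j' jJ j'J Ec; case: (ltngtP j j') => // jj'; case: no.
      by exists j, j'.
    by exists j', j.
  have := uniq_leq_size (s1 := [seq c (phi j) | j <- J]) (s2 := enum {: config T N.+1}).
  rewrite size_map -cardE leqNgt szJ map_inj_in_uniq // filter_uniq ?iota_uniq //.
  by move=> H; suff: false by []; apply: H => // x _; rewrite mem_enum.
move: jJ j'J; rewrite !mem_filter => /andP[/andP[/eqP Ej t1j] ji] /andP[_ j'i].
have [t2 [jt2 lt2 E2]] := Hf (phi j').
have pj := homo_ltn_ge phi_homo j; have pjj' := phi_homo jj'.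
have Hnb t : phi j <= t -> t < phi j' -> l t <> None.
  move=> jt tj' /bcast_index [i' Ei' bi'].
  move/hasPn: nb => /(_ (xi i')); rewrite bi'; move=> H; suff: false by [].
  apply: H; apply: map_f; move: ji j'i; rewrite !mem_iota.
  have : j <= i' by rewrite leqNgt; apply/negP => /phi_homo; rewrite -Ei'; lia.
  have : i' < j'.
    rewrite ltnNge leq_eqVlt; apply/negP => /orP[/eqP E|/phi_homo].
      by move: tj'; rewrite Ei' E ltnn.
    by rewrite -Ei'; lia.
  by lia.
have Htk : 0 < takers e (c (phi j), l (phi j), c (phi j).+1).
  by apply: (takers_taken (p := ord0)); rewrite phi_xi Ej.
exists [set e' | 0 < traffic c l t1.+1 t2.+1 e']; split.
- by apply: (traffic_circulation Hrun) => //; [lia|rewrite E1].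
- by rewrite inE; apply: traffic_ge Htk; lia.
- exists (traffic c l (phi j) (phi j')); split.
  + by apply: (traffic_flow Hrun) => //; apply: ltnW.
  + move=> e' /traffic_gt0[s [js sj' Hs]]; rewrite inE.
    by apply: traffic_ge Hs; lia.
  + move=> e' be'; apply/eqP; rewrite -leqn0 leqNgt; apply/negP => /traffic_gt0.
    by move=> [s [t1s ss /(takers_bcast be')]]; apply: Hnb.
  + by apply: traffic_ge Htk.
Qed.

End Necessity.
End Characterization.

(** * From flows to runs *)

Lemma sum_injective_le (J I : finType) (p : J -> I) (F : I -> nat) :
  injective p -> \sum_j F (p j) <= \sum_i F i.
Proof.
move=> pinj; rewrite -(big_imset F (h := p) (A := J)) /=; last by move=> ? ? _ _ /pinj.
rewrite [leqRHS](bigID (mem [set p j | j in J])) /= leq_addr //.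
Qed.

(** The element of a given rank in a fibre of [s] is sent to the element of the same rank in the
    corresponding fibre of [f]. *)
Lemma injective_matching (J I T : finType) (s : J -> T) (f : I -> T) :
  (forall x, \sum_j (s j == x) <= \sum_i (f i == x)) ->
  exists p : J -> I, injective p /\ forall j, f (p j) = s j.
Proof.
move=> H.
have card_sum (K : finType) (h : K -> T) x : \sum_i (h i == x) = #|[pred i | h i == x]|.
  by rewrite -sum1_card [RHS]big_mkcond; apply: eq_bigr => i _; rewrite inE; case: (h i == x).
have lt j : index j (enum [pred j' | s j' == s j]) < size (enum [pred i | f i == s j]).
  rewrite -cardE -card_sum; apply: leq_trans (H (s j)).
  by rewrite card_sum cardE index_mem mem_enum inE eqxx.
case: (pickP (@predT J)) => [j0 _|noJ]; last first.
  have no (j : J) : False by have := noJ j.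
  by exists (fun j => False_rect I (no j)); split=> j; case: (no j).
have [i0 _] : exists i : I, True.
  by have := lt j0; case: (enum [pred i | f i == s j0]) => // i; exists i.
pose p j := nth i0 (enum [pred i | f i == s j]) (index j (enum [pred j' | s j' == s j])).
have pP j : f (p j) = s j.
  by have := mem_nth i0 (lt j); rewrite mem_enum inE => /eqP.
exists p; split=> // j j' E.
have Es : s j = s j' by rewrite -!pP E.
have lt' := lt j'; move: E; rewrite /p -Es in lt' * => /eqP.
rewrite nth_uniq ?enum_uniq // => /eqP Ei.
have inE' j1 : s j1 = s j -> j1 \in enum [pred j' | s j' == s j].
  by move=> E1; rewrite mem_enum inE E1.
exact: (index_inj j (inE' j erefl) (inE' j' (esym Es)) Ei).
Qed.

(** * Realising firings and broadcasts by processes *)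

Section Lifting.

Variables (k : nat) (Act T : finType) (Q : lts k Act T) (lev : T -> nat).
Variable nxt : nat -> nat.
Local Notation edg := (edge k Act T).
Local Notation glab := (glabel k Act).
Local Notation is_bc := (@is_bcast k Act T).

Hypothesis rdz_lev : forall x a j y,
  (x, rdz a j, y) \in edges Q -> lev y = lev x.
Hypothesis bcast_lev : forall x y,
  (x, bcast k Act, y) \in edges Q -> lev y = nxt (lev x).
Hypothesis rdz_uniq : forall a j x y x' y',
  (x, rdz a j, y) \in edges Q -> (x', rdz a j, y') \in edges Q ->
  lev x = lev x' -> x = x' /\ y = y'.
Hypothesis Qtemplate : is_template Q.
Hypothesis rdz_complete : forall x a j y j',
  (x, rdz a j, y) \in edges Q ->
  exists x' y', (x', rdz a j', y') \in edges Q /\ lev x' = lev x.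

Definition performs (a : Act) (e : edg) : bool :=
  if e.1.2 is Some (b, _) then b == a else false.

(** Level [i] is seen as a Petri net with the states as places and the actions as transitions. *)
Definition consumption (i : nat) (a : Act) (x : T) : nat :=
  \sum_(e in edges Q | performs a e && (lev (source e) == i)) (source e == x).

Definition production (i : nat) (a : Act) (x : T) : nat :=
  \sum_(e in edges Q | performs a e && (lev (source e) == i)) (target e == x).

(** An action without edges on the level consumes nothing, so the net fires it freely although
    processes need not be able to perform it. *)
Definition enabled_at (i : nat) (a : Act) : Prop :=
  exists2 e, e \in edges Q & performs a e /\ lev (source e) = i.

(** Completeness and uniqueness of roles leave one edge per role, so sums over edges become sums
    over roles. *)
Lemma enabled_edges i a : enabled_at i a ->
  exists E : 'I_k -> edg, [/\ forall j, [/\ E j \in edges Q, (E j).1.2 = rdz a j & lev (source (E j)) = i]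
    & forall F : edg -> nat,
        \sum_(e in edges Q | performs a e && (lev (source e) == i)) F e = \sum_j F (E j)].
Proof.
move=> [[[x l] y] He]; rewrite /performs /source /=; case: l He => [[b j0] He [/eqP ba Hx]|He [//]]; rewrite ba in He.
have ex j : exists e, [/\ e \in edges Q, e.1.2 = rdz a j & lev (source e) = i].
  have [x' [y' [He' Hx']]] := rdz_complete j He.
  by exists (x', rdz a j, y'); rewrite /source /= Hx'.
pose E j := epsilon (inhabits (x, Some (a, j0), y)) (fun e => [/\ e \in edges Q, e.1.2 = rdz a j & lev (source e) = i]).
have EP j : [/\ E j \in edges Q, (E j).1.2 = rdz a j & lev (source (E j)) = i].
  exact: (epsilon_spec (inhabits _) _ (ex j)).
exists E; split=> // F.
have Einj : injective E.
  by move=> j j' Ejj; have [_ + _] := EP j; rewrite Ejj; have [_ -> _] := EP j' => -[].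
rewrite -(big_imset F (h := E) (A := 'I_k)) /=; last by move=> ? ? _ _ /Einj.
apply: eq_bigl => -[[x' l] y'] /=; rewrite /performs /source /=.
apply/idP/imsetP => [|[j _ E']]; last first.
  have [H1 H2 H3] := EP j; rewrite -E' /source /= in H1 H2 H3.
  by rewrite H1 H2 H3 /rdz /= !eqxx.
case: l => [[b1 j] /and3P[He' /eqP Eb /eqP Hx']|]; last by rewrite andbF.
subst b1; exists j => //; have [] := EP j; rewrite /source.
case: (E j) => [[x2 l2] y2] /= H1 H2 H3; subst l2.
by have [|-> ->] := rdz_uniq H1 He'; first by rewrite H3.
Qed.

Lemma lift_rdz N (f : config T N) i a :
  (forall p, lev (f p) = i) -> enabled_at i a ->
  (forall x, consumption i a x <= count_at f x) ->
  exists r g, [/\ transition Q f (Some (a, r)) g,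
    forall p, lev (g p) = i,
    forall x, count_at g x + consumption i a x = count_at f x + production i a x
  & forall e, e \in edges Q -> performs a e -> lev (source e) = i ->
      0 < takers e (f, Some (a, r), g)].
Proof.
move=> Hf /enabled_edges[E [EP Esum]] Hpre.
have [|p [pinj fp]] := @injective_matching _ _ _ (fun j => source (E j)) f.
  by move=> x; rewrite -(Esum (fun e => (source e == x) : nat)); apply: Hpre.
pose g : config T N := [ffun q => if [pick j | p j == q] is Some j then target (E j) else f q].
have gp j : g (p j) = target (E j).
  rewrite ffunE; case: pickP => [j' /eqP /pinj -> //|/(_ j)]; by rewrite eqxx.
have gid q : (forall j, q <> p j) -> g q = f q.
  by move=> no; rewrite ffunE; case: pickP => // j /eqP E'; case: (no j).
pose r : {ffun 'I_k -> 'I_N} := [ffun j => p j].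
have rE j : r j = p j by rewrite ffunE.
have Htr : transition Q f (Some (a, r)) g.
  split=> [j j'|j|q Hq].
  - by rewrite !rE => /pinj.
  - rewrite !rE fp gp; have [+ + _] := EP j; rewrite /source /target.
    by case: (E j) => [[x l] y] /= + El; rewrite El.
  - by apply: gid => j E'; apply: (Hq j); rewrite rE.
have lev_eq q q' : lev (f q) = lev (f q') by rewrite !Hf.
exists r, g; split=> //.
- move=> q; case: (pickP (fun j => p j == q)) => [j /eqP <-|no]; last first.
    by rewrite gid // => j E'; have := no j; rewrite E' eqxx.
  rewrite gp; have [+ + <-] := EP j; rewrite /source /target.
  by case: (E j) => [[x l] y] /= + El; rewrite El; apply: rdz_lev.
- move=> x; rewrite /consumption /production !Esum /count_at.
  rewrite (bigID (mem [set p j | j in 'I_k])) [in RHS](bigID (mem [set p j | j in 'I_k])) /=.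
  rewrite !big_imset /=; try by move=> ? ? _ _ /pinj.
  have -> : \sum_(q < N | q \notin [set p j | j in 'I_k]) (g q == x) =
            \sum_(q < N | q \notin [set p j | j in 'I_k]) (f q == x).
    apply: eq_bigr => q /imsetP no; rewrite gid // => j Ej; apply: no.
    by exists j.
  have -> : \sum_(j in 'I_k) (f (p j) == x) = \sum_j (source (E j) == x).
    by apply: eq_bigr => j _; rewrite fp.
  have -> : \sum_(j in 'I_k) (g (p j) == x) = \sum_j (target (E j) == x).
    by apply: eq_bigr => j _; rewrite gp.
  exact: etrans (addnC _ _) (etrans (congr1 (addn _) (addnC _ _)) (addnA _ _ _)).
- move=> e He; rewrite /performs; case El: e.1.2 => [[b j]|] // /eqP Eb Hi; subst b.
  by rewrite (takers_rdz rdz_uniq Htr lev_eq He El) Hi Hf !eqxx.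
Qed.

(** Markings are only lower bounds for the numbers of processes, so surplus processes do no harm. *)
Lemma lift_fires N (f : config T N) i sg c d :
  fires (consumption i) (production i) sg c d ->
  (forall p, lev (f p) = i) -> (forall x, c x <= count_at f x) ->
  (forall a, a \in sg -> enabled_at i a) ->
  exists w : seq (config T N * glab N * config T N), let g := endpoint f w in
    [/\ okpath (@transition _ _ _ Q N) f w, forall p, lev (g p) = i,
        forall x, d x <= count_at g x, all (fun x => isSome x.1.2) w
      & forall a e, e \in edges Q -> performs a e -> lev (source e) = i ->
          count_mem a sg <= \sum_(x <- w) takers e x].
Proof.
move=> H; elim: H f => {sg c d} [c d cd|a sg c r d Hc _ IH] f Hf Hcf Hen.
  by exists [::]; split=> //= x; rewrite -cd.
have [|x|s [g [Htr Hg Hcount Htk]]] := lift_rdz (a := a) Hf.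
- by apply: Hen; rewrite mem_head.
- by apply: leq_trans (Hcf x); rewrite Hc leq_addr.
have [//|x|b bs|w [Hw1 Hw2 Hw3 Hw4 Hw5]] := IH g.
- by have := Hcount x; have := Hcf x; rewrite Hc; lia.
- by apply: Hen; rewrite inE bs orbT.
exists ((f, Some (a, s), g) :: w); split=> //= b e He Hb Hi.
rewrite big_cons; apply: leq_add; last exact: Hw5 Hb Hi.
by case: eqP => // E; apply: Htk => //; rewrite E.
Qed.

(** [z e] processes are sent along each broadcast edge [e]. A broadcast moves everyone, so each
    remaining process takes some broadcast edge of its state, which a template provides. *)
Lemma lift_bcast N (f : config T N) i (z : edg -> nat) :
  (forall p, lev (f p) = i) ->
  (forall x, \sum_(e in edges Q | is_bc e && (lev (source e) == i) && (source e == x)) z e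
     <= count_at f x) ->
  exists g, [/\ transition Q f None g, forall p, lev (g p) = nxt i,
    forall y, \sum_(e in edges Q | is_bc e && (lev (source e) == i) && (target e == y)) z e
      <= count_at g y
  & forall e, e \in edges Q -> is_bc e -> lev (source e) = i ->
      z e <= takers e (f, None, g)].
Proof.
move=> Hf Hz.
pose ok e := (e \in edges Q) && (is_bc e && (lev (source e) == i)).
pose z' e := if ok e then z e else 0.
(* One element for each process that is assigned to an edge. *)
pose J : finType := {e : edg & 'I_(z' e)}.
have sumJ (F : edg -> nat) : \sum_(j : J) F (tag j) = \sum_e z' e * F e.
  rewrite -(sig_big_dep (fun _ => true) (fun _ _ => true) (fun e (_ : 'I_(z' e)) => F e)) /=.
  by apply: eq_bigr => e _; rewrite sum_nat_const card_ord.
have sumz (q : pred edg) : \sum_(e in edges Q | is_bc e && (lev (source e) == i) && q e) z e =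
    \sum_(j : J) q (tag j).
  rewrite (sumJ (fun e => q e : nat)) big_mkcond; apply: eq_bigr => e _ /=.
  by rewrite /z' /ok; case: (e \in edges Q); case: (is_bc e); case: (lev (source e) == i); case: (q e); rewrite /= ?muln1 ?muln0 ?mul0n.
have Jok (j : J) : ok (tag j).
  case: j => e /= r; have : 0 < z' e by apply: leq_ltn_trans (ltn_ord r).
  by rewrite /z'; case: (ok e).
have [|p [pinj fp]] := @injective_matching _ _ _ (fun j : J => source (tag j)) f.
  by move=> x; have := Hz x; rewrite (sumz (fun e => source e == x)).
pose dflt x := epsilon (inhabits x) (fun y => (x, bcast k Act, y) \in edges Q).
have dfltP x : (x, bcast k Act, dflt x) \in edges Q.
  exact: (epsilon_spec (inhabits x) _ (Qtemplate x)).
pose g : config T N := [ffun q => if [pick j | p j == q] is Some j then target (tag j) else dflt (f q)].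
have gp j : g (p j) = target (tag j).
  rewrite ffunE; case: pickP => [j' /eqP /pinj -> //|/(_ j)]; by rewrite eqxx.
have tagE (j : J) : (source (tag j), bcast k Act, target (tag j)) = tag j.
  have := Jok j; rewrite /ok /is_bcast /source /target.
  by case: (tag j) => [[x l] y] /= /and3P[_ /eqP ->].
have Htr : transition Q f None g.
  move=> q /=; case: (pickP (fun j => p j == q)) => [j /eqP <-|no].
    by rewrite fp gp tagE; case/andP: (Jok j).
  by rewrite [g q]ffunE; case: pickP => [j|_]; rewrite ?no.
exists g; split=> //.
- by move=> q; rewrite (bcast_lev (Htr q)) Hf.
- move=> y; rewrite (sumz (fun e => target e == y)) /count_at.
  apply: leq_trans (sum_injective_le (fun q => (g q == y) : nat) pinj).
  by apply: leq_sum => j _; rewrite gp.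
- move=> e He be Hi; have -> : z e = \sum_(j : J) (tag j == e).
    rewrite (sumJ (fun e' => (e' == e) : nat)) (bigD1 e) //= eqxx muln1 big1 ?addn0.
      by rewrite /z' /ok He be Hi eqxx.
    by move=> e' /negbTE ->; rewrite muln0.
  apply: leq_trans (sum_injective_le (fun q => (taken f None g q == Some e) : nat) pinj).
  apply: leq_sum => j _; rewrite /= fp gp tagE.
  by rewrite [X in _ <= nat_of_bool X](_ : _ = (tag j == e)).
Qed.

End Lifting.

(** * Runs that realise a circulation or a rendezvous cycle *)

Section Sufficiency.

Variables (k : nat) (Act T : finType) (Q : lts k Act T) (lev : T -> nat).
Variables m n0 : nat.
Local Notation edg := (edge k Act T).
Local Notation glab := (glabel k Act).
Local Notation is_bc := (@is_bcast k Act T).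
Local Notation pre := (consumption Q lev).
Local Notation post := (production Q lev).
Local Notation acts := (@performs k Act T).
Local Notation enabled_at := (enabled_at Q lev).
Local Notation src := (@source k Act T).
Local Notation tgt := (@target k Act T).
Local Notation same := (@synchronized k Act T lev).
Local Notation flow := (flow Q lev).

Definition nxt (i : nat) : nat := if i < m then i.+1 else n0.

Hypothesis n0m : n0 <= m.
Hypothesis lev_le : forall x, lev x <= m.
Hypothesis rdz_lev : forall x a j y,
  (x, rdz a j, y) \in edges Q -> lev y = lev x.
Hypothesis bcast_lev : forall x y,
  (x, bcast k Act, y) \in edges Q -> lev y = nxt (lev x).
Hypothesis rdz_uniq : forall a j x y x' y',
  (x, rdz a j, y) \in edges Q -> (x', rdz a j, y') \in edges Q ->
  lev x = lev x' -> x = x' /\ y = y'.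
Hypothesis Qtemplate : is_template Q.
Hypothesis rdz_complete : forall x a j y j',
  (x, rdz a j, y) \in edges Q ->
  exists x' y', (x', rdz a j', y') \in edges Q /\ lev x' = lev x.

Definition populated (i M : nat) : Prop :=
  exists N (f0 : config T N) (w : seq (config T N * glab N * config T N)),
    [/\ forall p, f0 p \in init Q, okpath (@transition _ _ _ Q N) f0 w,
        forall p, lev (endpoint f0 w p) = i
      & forall x, lev x = i -> M <= count_at (endpoint f0 w) x].

Hypothesis Qpop : forall x M, populated (lev x) M.

Lemma rdz_edge_lev e : e \in edges Q -> ~~ is_bc e -> lev (tgt e) = lev (src e).
Proof.
by case: e => [[x [[a j]|]] y] //= He _; apply: rdz_lev He.
Qed.

Lemma bc_edge_lev e : e \in edges Q -> is_bc e -> lev (tgt e) = nxt (lev (src e)).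
Proof. by case: e => [[x [[a j]|]] y] //= He _; apply: bcast_lev He. Qed.

Lemma acts_rdz a e : acts a e -> ~~ is_bc e.
Proof. by case: e => [[x [[b j]|]] y]. Qed.

Lemma rdz_acts e : ~~ is_bc e -> exists a, acts a e.
Proof. by case: e => [[x [[b j]|]] y] // _; exists b; rewrite /performs /= eqxx. Qed.

Lemma same_acts a e e' : acts a e -> acts a e' -> lev (src e) = lev (src e') -> same e e'.
Proof.
rewrite /performs /synchronized; case: e.1.2 => [[b j]|] // /eqP ->.
by case: e'.1.2 => [[b' j']|] // /eqP -> ->; rewrite !eqxx.
Qed.

Lemma acts_same a e e' : acts a e -> same e e' -> acts a e' /\ lev (src e) = lev (src e').
Proof.
rewrite /performs /synchronized; case: e.1.2 => [[b j]|] // /eqP ->.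
by case: e'.1.2 => [[b' j']|] // /andP[/eqP -> /eqP ->].
Qed.

Section Flow.

Variable z : edg -> nat.
Hypothesis Hz : flow z.

(** Synchronized edges carry equal amounts, so the maximum is their common value, and 0 for an
    action without edges on the level. *)
Definition firing (i : nat) (a : Act) : nat :=
  \max_(e in edges Q | acts a e && (lev (src e) == i)) z e.

Lemma firingE i a e : e \in edges Q -> acts a e -> lev (src e) = i -> firing i a = z e.
Proof.
move=> He Ha Hi; case: Hz => _ _ Hsame; apply/eqP; rewrite eqn_leq; apply/andP; split.
  apply/bigmax_leqP => e' /and3P[He' Ha' /eqP Hi'].
  by rewrite (Hsame e' e) // (same_acts Ha' Ha) // Hi' Hi.
by apply: leq_bigmax_cond; rewrite He Ha Hi eqxx.
Qed.

Lemma firing_gt0 i a : 0 < firing i a ->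
  exists e, [/\ e \in edges Q, acts a e, lev (src e) = i & 0 < z e].
Proof.
move=> H; apply: NNPP => no; move: H; rewrite ltnNge => /negP; apply.
apply/bigmax_leqP => e /and3P[He Ha /eqP Hi]; rewrite leqNgt; apply/negP => ze.
by apply: no; exists e.
Qed.

Lemma firing_sum i (h : edg -> T) y :
  \sum_a firing i a *
    \sum_(e in edges Q | acts a e && (lev (src e) == i)) (h e == y) =
  \sum_(e | [&& h e == y, ~~ is_bc e & lev (src e) == i]) z e.
Proof.
transitivity (\sum_a \sum_e
    (if [&& e \in edges Q, acts a e, lev (src e) == i & h e == y] then z e else 0)).
  apply: eq_bigr => a _; rewrite big_distrr /= big_mkcond /=; apply: eq_bigr => e _.
  case: (boolP (e \in edges Q)) => //= He; case: (boolP (acts a e)) => //= Ha.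
  case: eqP => //= Hi; case: (h e == y); last by rewrite muln0.
  by rewrite muln1 (firingE He Ha Hi).
rewrite exchange_big [RHS]big_mkcond; apply: eq_bigr => e _ /=.
case: (boolP (is_bc e)) => be /=.
  rewrite andbF big1 // => a _; case: (boolP (acts a e)) => [/acts_rdz|_].
    by rewrite be.
  by rewrite andbF.
have [a Ha] := rdz_acts be; rewrite (bigD1 a) //= big1 ?addn0.
  rewrite Ha /=; case: (boolP (e \in edges Q)) => He /=.
    by case: (h e == y); case: (lev (src e) == i).
  have -> : z e = 0.
    by apply/eqP; rewrite -leqn0 leqNgt; apply: contra He; case: Hz => + _ _; apply.
  by case: ifP.
move=> b ba; case: (boolP (acts b e)) => [Hb|]; last by rewrite andbF.
case/eqP: ba; move: Ha Hb; rewrite /performs; case: e.1.2 => [[b' j]|] //.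
by move=> /eqP -> /eqP.
Qed.

Definition entering (i : nat) (y : T) : nat :=
  if lev y == i then \sum_(e | (tgt e == y) && is_bc e) z e else 0.

Definition leaving (i : nat) (y : T) : nat :=
  if lev y == i then \sum_(e | (src e == y) && is_bc e) z e else 0.

(** Restricted to a level, a flow is a solution of the marking equation, from the processes that
    broadcasts bring in to those that broadcasts take away. *)
Lemma flow_balance i y :
  leaving i y + \sum_a firing i a * pre i a y =
  entering i y + \sum_a firing i a * post i a y.
Proof.
rewrite /consumption /production !firing_sum /leaving /entering.
have zE e : z e != 0 -> e \in edges Q by rewrite -lt0n; case: Hz => + _ _; apply.
case: eqP => [Hy|ny]; last first.
  rewrite !big1 // => e /and3P[/eqP E be /eqP Hi].
    apply/eqP; case: eqP => // /eqP ze; case: ny.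
    by rewrite -E (rdz_edge_lev (zE e ze) be).
  by case: ny; rewrite -E.
case: Hz => _ Hb _; have := Hb y.
rewrite (bigID is_bc) [in RHS](bigID is_bc) /=.
have -> : \sum_(e | (src e == y) && ~~ is_bc e) z e =
    \sum_(e | [&& src e == y, ~~ is_bc e & lev (src e) == i]) z e.
  by apply: eq_bigl => e; case: eqP => //= ->; rewrite Hy eqxx andbT.
have -> : \sum_(e | (tgt e == y) && ~~ is_bc e) z e =
    \sum_(e | [&& tgt e == y, ~~ is_bc e & lev (src e) == i]) z e.
  rewrite !(big_mkcond (fun e => _ && _)) /=; apply: eq_bigr => e _.
  case: (eqVneq (z e) 0) => [->|ze]; first by do 2 case: ifP.
  case: eqP => //= E; case: (boolP (is_bc e)) => //= be.
  by rewrite -(rdz_edge_lev (zE e ze) be) E Hy eqxx.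
by [].
Qed.

End Flow.

Lemma flow_sum (I : finType) (P : pred I) (g : I -> edg -> nat) :
  (forall u, P u -> flow (g u)) -> flow (fun e => \sum_(u | P u) g u e).
Proof.
move=> H; split=> [e|x|e e' He He' ee'].
- rewrite lt0n sum_nat_eq0 negb_forall => /existsP[u]; rewrite negb_imply -lt0n.
  by case/andP => Pu; case: (H u Pu) => + _ _; apply.
- rewrite exchange_big [RHS]exchange_big /=; apply: eq_bigr => u Pu.
  by case: (H u Pu).
- by apply: eq_bigr => u Pu; case: (H u Pu) => _ _; apply.
Qed.

Section Circulation.

Variable U : {set edg}.
Hypothesis HU : circulation Q lev U.

(** The sum of one flow for each edge of [U] has exactly [U] as its support. *)
Lemma circulation_flow : exists2 z, flow z & forall e, (0 < z e) = (e \in U).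
Proof.
have [_ Hcov _ _] := HU.
pose good u g := [/\ flow g, forall e', 0 < g e' -> e' \in U & 0 < g u].
pose g u := epsilon (inhabits (fun _ : edg => 0)) (good u).
have gP u : u \in U -> good u (g u).
  by move=> uU; exact: (epsilon_spec (inhabits _) _ (Hcov u uU)).
exists (fun e => \sum_(u | u \in U) g u e).
  by apply: flow_sum => u /gP[].
move=> e; apply/idP/idP => [|eU].
  rewrite lt0n sum_nat_eq0 negb_forall => /existsP[u]; rewrite negb_imply -lt0n.
  by case/andP => /gP[_ + _]; apply.
by rewrite (bigD1 e) //= addn_gt0; case: (gP e eU) => _ _ ->.
Qed.

Lemma circulation_edge e : e \in U -> e \in edges Q.
Proof. by case: HU => /subsetP + _ _ _; apply. Qed.

Lemma circulation_same e e' : e \in U -> e' \in edges Q -> same e e' -> e' \in U.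
Proof.
have [z [_ _ zs] zU] := circulation_flow; rewrite -!zU => eU He' ee'.
by rewrite -(zs e e') // circulation_edge // -zU.
Qed.

Definition active (i : nat) : {set Act} :=
  [set a | [exists e in U, acts a e && (lev (src e) == i)]].

Definition touched (i : nat) : {set T} :=
  [set y | [exists e in U, [&& ~~ is_bc e, lev (src e) == i & (src e == y) || (tgt e == y)]]].

Lemma activeP i a e : a \in active i -> e \in edges Q -> acts a e ->
  lev (src e) = i -> e \in U.
Proof.
rewrite inE => /existsP[e' /and3P[e'U Ha' /eqP Hi']] He Ha Hi.
by apply: (circulation_same e'U He); apply: same_acts Ha' Ha _; rewrite Hi Hi'.
Qed.

Lemma weight_gt0 (h : edg -> T) i a y :
  0 < \sum_(e in edges Q | acts a e && (lev (src e) == i)) (h e == y) ->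
  exists e, [/\ e \in edges Q, acts a e, lev (src e) = i & h e = y].
Proof.
rewrite lt0n sum_nat_eq0 negb_forall => /existsP[e].
by rewrite negb_imply eqb0 negbK => /andP[/and3P[? ? /eqP ?] /eqP ?]; exists e.
Qed.

Lemma weight_ge (h : edg -> T) i a e : e \in edges Q -> acts a e -> lev (src e) = i ->
  0 < \sum_(e' in edges Q | acts a e' && (lev (src e') == i)) (h e' == h e).
Proof.
move=> He Ha Hi; rewrite (bigD1 e) /=; last by rewrite He Ha Hi eqxx.
by rewrite eqxx.
Qed.

Lemma pre_touched i a y : a \in active i -> 0 < pre i a y -> y \in touched i.
Proof.
move=> aV /weight_gt0[e [He Ha Hi Hy]]; rewrite inE; apply/existsP; exists e.
by rewrite (activeP aV He Ha Hi) (acts_rdz Ha) Hi Hy !eqxx.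
Qed.

(** Transfers [covers], which concerns all levels, to the net of a single level. The abstract ends
    [s] and [t] allow both directions of time. *)
Lemma covers_touched (s t : edg -> T) i (X : {set T}) :
  (forall e, e \in edges Q -> ~~ is_bc e -> lev (s e) = lev (src e) /\ lev (t e) = lev (src e)) ->
  (forall e, (s e = src e /\ t e = tgt e) \/ (s e = tgt e /\ t e = src e)) ->
  covers lev U s t ->
  (forall e, e \in U -> is_bc e -> lev (t e) = i -> t e \in X) ->
  (forall a, a \in active i ->
    (forall y, 0 < \sum_(e in edges Q | acts a e && (lev (src e) == i)) (s e == y) -> y \in X) ->
    forall y, 0 < \sum_(e in edges Q | acts a e && (lev (src e) == i)) (t e == y) -> y \in X) ->
  touched i \subset X.
Proof.
move=> Hlev Hst Hcov Hb Hr.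
have Hcl e : e \in U -> ~~ is_bc e -> lev (src e) = i ->
    (forall e', e' \in U -> same e e' -> s e' \in X) -> t e \in X.
  move=> eU be Hi Hs; have He := circulation_edge eU; have [a Ha] := rdz_acts be.
  have aV : a \in active i by rewrite inE; apply/existsP; exists e; rewrite eU Ha Hi eqxx.
  apply: (Hr a aV) => [y /weight_gt0[e' [He' Ha' Hi' <-]]|]; last exact: weight_ge.
  by apply: Hs (activeP aV He' Ha' Hi') _; apply: same_acts Ha Ha' _; rewrite Hi Hi'.
(* With all states of the other levels added, the closure conditions hold trivially there. *)
pose X' := X :|: [set y | lev y != i].
have HX' e : e \in U -> s e \in X'.
  apply: Hcov => {}e eU be.
    by rewrite !inE orbC; case: eqP => //= Hi; apply: Hb.
  move=> Hs; rewrite !inE orbC; case: eqP => //= Hi.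
  have [_ Ht] := Hlev e (circulation_edge eU) be.
  apply: Hcl => //; first by rewrite -Ht.
  move=> e' e'U ee'; move: (Hs e' e'U ee'); rewrite !inE.
  have [a Ha] := rdz_acts be; have [Ha' Hi'] := acts_same Ha ee'.
  have [Hs' _] := Hlev e' (circulation_edge e'U) (acts_rdz Ha').
  by rewrite Hs' -Hi' -Ht Hi eqxx orbF.
have HX e : e \in U -> ~~ is_bc e -> lev (src e) = i -> s e \in X.
  move=> eU be Hi; have := HX' e eU; rewrite !inE.
  by have [-> _] := Hlev e (circulation_edge eU) be; rewrite Hi eqxx orbF.
have HXt e : e \in U -> ~~ is_bc e -> lev (src e) = i -> t e \in X.
  move=> eU be Hi; apply: Hcl => // e' e'U ee'.
  have [a Ha] := rdz_acts be; have [Ha' Hi'] := acts_same Ha ee'.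
  by apply: HX e'U (acts_rdz Ha') _; rewrite -Hi'.
apply/subsetP => y; rewrite inE => /existsP[e /and4P[eU be /eqP Hi]].
have H1 := HX e eU be Hi; have H2 := HXt e eU be Hi.
by case: (Hst e) => -[E1 E2]; rewrite E1 in H1; rewrite E2 in H2; case/orP => /eqP <-.
Qed.

(** What one visit to level [i] has to do: turn arrivals into departures, using exactly the active
    actions. It is split at a marking [q] that is large on all touched states, where a rendezvous
    loop can be inserted. *)
Definition portion (z : edg -> nat) (M i K : nat) : Prop :=
  exists sg tau q,
    [/\ fires (pre i) (post i) sg (fun y => K * entering z i y) q,
        fires (pre i) (post i) tau q (fun y => K * leaving z i y),
        forall a, (a \in sg ++ tau) = (a \in active i)
      & forall y, y \in touched i -> M <= q y].

Lemma portion_mul z M i K n : 0 < n -> portion z M i K -> portion z M i (n * K).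
Proof.
move=> n_gt0 [sg [tau [q [H1 H2 Hm Hq]]]].
exists (flatten (nseq n sg)), (flatten (nseq n tau)), (fun y => n * q y); split.
- by apply: fires_ext (fires_mul n H1) => // y; rewrite mulnA.
- by apply: fires_ext (fires_mul n H2) => // y; rewrite mulnA.
- move=> a; rewrite -Hm !mem_cat.
  have E (s : seq Act) : (a \in flatten (nseq n s)) = (a \in s).
    apply/flattenP/idP => [[s' /nseqP[-> _]]//|as'].
    by exists s; rewrite // mem_nseq eqxx n_gt0.
  by rewrite !E.
- by move=> y /Hq H; apply: leq_trans H _; rewrite leq_pmull.
Qed.

Lemma portion_exists z M i : flow z -> (forall e, (0 < z e) = (e \in U)) ->
  exists2 K, 0 < K & portion z M i K.
Proof.
move=> Hz zU; have [_ _ fwd bwd] := HU.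
have [||||a|K K0 H] := @fires_scaled T Act (pre i) (post i) (active i) (touched i)
  (entering z i) (leaving z i) (firing z i) M; last by exists K.
- move=> a; apply/idP/idP => [/firing_gt0[e [He Ha Hi ze]]|].
    by rewrite inE; apply/existsP; exists e; rewrite -zU ze Ha Hi eqxx.
  rewrite inE => /existsP[e /and3P[eU Ha /eqP Hi]].
  by rewrite (firingE Hz (circulation_edge eU) Ha Hi) zU.
- by move=> y; rewrite flow_balance.
- by move=> a y; apply: pre_touched.
- move=> X Hc Hr; apply: (covers_touched (s := src) (t := tgt)) fwd _ _ => //.
  + by move=> e He be; rewrite rdz_edge_lev.
  + by move=> e; left.
  + move=> e eU be Hi; apply: Hc; rewrite /entering Hi eqxx (bigD1 e) /=; last by rewrite eqxx.
    by rewrite addn_gt0 zU eU.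
- move=> Hc Hr; apply: (covers_touched (s := tgt) (t := src)) bwd _ _ => //.
  + by move=> e He be; rewrite rdz_edge_lev.
  + by move=> e; right.
  + move=> e eU be Hi; apply: Hc; rewrite /leaving Hi eqxx (bigD1 e) /=; last by rewrite eqxx.
    by rewrite addn_gt0 zU eU.
Qed.

(** The departures of one level are the arrivals of the next, so one scaling has to serve all
    levels. *)
Lemma portion_uniform z M : flow z -> (forall e, (0 < z e) = (e \in U)) ->
  exists2 K, 0 < K & forall i, i <= m -> portion z M i K.
Proof.
move=> Hz zU; elim: m => [|m' [K K0 HK]].
  have [K K0 HK] := portion_exists M 0 Hz zU; exists K => // i.
  by rewrite leqn0 => /eqP ->.
have [K' K'0 HK'] := portion_exists M m'.+1 Hz zU.
exists (K' * K) => [|i]; first by rewrite muln_gt0 K0 K'0.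
rewrite leq_eqVlt => /orP[/eqP ->|]; first by rewrite mulnC; apply: portion_mul.
by rewrite ltnS => /HK; apply: portion_mul.
Qed.

(** No broadcast leads back to a level before the loop, so by induction on the level nothing in [U]
    can populate it. *)
Lemma circulation_level e : e \in U -> n0 <= lev (src e).
Proof.
have [_ _ fwd _] := HU.
suff H i : i < n0 -> forall e, e \in U -> lev (src e) <> i.
  by move=> eU; rewrite leqNgt; apply/negP => /H /(_ _ eU).
elim/ltn_ind: i => i IH i_lt {}e eU Ei.
pose X := [set x | lev x != i].
suff : src e \in X by rewrite inE Ei eqxx.
apply: fwd eU => e' e'U be'; rewrite inE; last first.
  have [a Ha] := rdz_acts be'.
  move=> /(_ e' e'U (same_acts Ha Ha erefl)); rewrite inE.
  by rewrite rdz_edge_lev // circulation_edge.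
apply/eqP; rewrite bc_edge_lev // ?circulation_edge // /nxt.
case: ltnP => [_ E|_]; last by lia.
by apply: (IH (lev (src e')) _ _ e' e'U) => //; lia.
Qed.

End Circulation.

Lemma nxt_loop i : n0 <= i -> i <= m -> n0 <= nxt i /\ nxt i <= m.
Proof. by rewrite /nxt; case: ltnP; lia. Qed.

(** The loop of the lasso has [m - n0 + 1] levels. *)
Lemma nxt_return i r : n0 <= i -> i <= m -> iter (r * (m - n0).+1) nxt i = i.
Proof.
move=> ni im; elim: r => // r IH.
rewrite mulSn iterD IH.
have up d : i + d <= m -> iter d nxt i = i + d.
  elim: d => [|d IHd] Hd; first by rewrite addn0.
  by rewrite iterS IHd ?/nxt; [case: ltnP; lia|lia].
have up0 d : n0 + d <= m -> iter d nxt n0 = n0 + d.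
  elim: d => [|d IHd] Hd; first by rewrite addn0.
  by rewrite iterS IHd ?/nxt; [case: ltnP; lia|lia].
have -> : (m - n0).+1 = (i - n0) + (m - i).+1 by lia.
rewrite iterD iterS up ?subnKC // {2}/nxt ltnn up0; lia.
Qed.

Lemma segment_of_cat (X L : Type) (c : nat -> X) (l : nat -> L) t n u v :
  segment_of c l t n = u ++ v ->
  u = segment_of c l t (size u) /\ v = segment_of c l (t + size u) (size v).
Proof.
move=> E; have En : n = size u + size v.
  by rewrite -size_cat -E size_map size_iota.
move: E; rewrite En /segment_of iotaD map_cat => E.
have := congr1 (take (size u)) E; have := congr1 (drop (size u)) E.
by rewrite drop_size_cat ?take_size_cat ?size_map ?size_iota // drop_size_cat // take_size_cat.
Qed.

Lemma sum_segment_of (X L : Type) (c : nat -> X) (l : nat -> L) t n F :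
  \sum_(x <- segment_of c l t n) F x = \sum_(t <= s < t + n) F (c s, l s, c s.+1).
Proof. by rewrite /segment_of big_map /index_iota addKn. Qed.

Definition rdz_loop (U : {set edg}) (i : nat) (sg : seq Act) : Prop :=
  (forall a, a \in sg -> exists e, [/\ e \in U, acts a e & lev (src e) = i]) /\
  (forall y, amount (pre i) sg y = amount (post i) sg y).

(** A flow without broadcast edges is balanced on each level separately, so its rendezvous on the
    level of [e] alone have no net effect. *)
Lemma rdz_cycle_loop U e : e \in edges Q -> rdz_cycle Q lev U e ->
  exists a sg, [/\ acts a e, 0 < count_mem a sg & rdz_loop U (lev (src e)) sg].
Proof.
move=> He [g [Hg gU gb ge]].
have be : ~~ is_bc e by apply/negP => be; move: ge; rewrite gb.
have [a Ha] := rdz_acts be; pose i := lev (src e).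
pose sg := flatten [seq nseq (firing g i a) a | a <- enum Act].
have tot F y : amount F sg y = \sum_a firing g i a * F a y.
  rewrite /amount big_flatten big_map big_enum /=.
  by apply: eq_bigr => b _; rewrite big_nseq iter_addn_0 mulnC.
have sg_gt0 b : b \in sg -> 0 < firing g i b.
  by move=> /flattenP[s /mapP[b' _ ->] /nseqP[-> //]].
exists a, sg; split=> //.
  rewrite -has_count has_pred1; apply/flattenP; exists (nseq (firing g i a) a).
    by apply/map_f; rewrite mem_enum.
  by rewrite mem_nseq (firingE Hg He Ha erefl) ge eqxx.
split=> [b /sg_gt0/firing_gt0[e' [He' Hb Hi' ge']]|y].
  by exists e'; split=> //; apply: gU.
have gb0 (p : pred edg) : \sum_(e' | p e' && is_bc e') g e' = 0.
  by rewrite big1 // => e' /andP[_ /gb].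
rewrite !tot; have := flow_balance Hg i y; rewrite /leaving /entering.
by case: ifP => _ //; rewrite (gb0 (fun e' => src e' == y)) (gb0 (fun e' => tgt e' == y)).
Qed.

(** Input places that hold the total consumption make every order of the loop fireable, by
    [fires_big]. *)
Lemma rdz_loop_fires U i sg (q : T -> nat) : rdz_loop U i sg ->
  (forall a y, a \in sg -> 0 < pre i a y -> \sum_y amount (pre i) sg y <= q y) ->
  fires (pre i) (post i) sg q q.
Proof.
move=> [_ bal] Hq; apply: fires_big => y; last by rewrite bal.
case: (posnP (amount (pre i) sg y)) => [->//|]; rewrite {1}/amount lt0n => H.
have [a asg ay] : exists2 a, a \in sg & 0 < pre i a y.
  apply: NNPP => no; case/eqP: H; rewrite big_seq big1 // => a asg.
  by apply/eqP; rewrite -leqn0 leqNgt; apply/negP => ay; apply: no; exists a.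
by apply: leq_trans (Hq a y asg ay); rewrite (bigD1 y) //= leq_addr.
Qed.

Section Block.

Variables (U : {set edg}) (z : edg -> nat) (e : edg) (sg : seq Act) (K : nat).
Hypothesis HU : circulation Q lev U.
Hypothesis Hz : flow z.
Hypothesis zU : forall e, (0 < z e) = (e \in U).
Hypothesis eU : e \in U.
Hypothesis Hsg : rdz_loop U (lev (src e)) sg.
Hypothesis K0 : 0 < K.
Hypothesis HK : forall i, i <= m ->
  portion U z (\sum_y amount (pre (lev (src e))) sg y) i K.

Definition stocked N (i : nat) (f : config T N) : Prop :=
  (forall p, lev (f p) = i) /\ forall y, K * entering z i y <= count_at f y.

Lemma active_enabled i a : a \in active U i -> enabled_at i a.
Proof.
rewrite inE => /existsP[e' /and3P[e'U Ha /eqP Hi]].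
by exists e' => //; apply: circulation_edge HU _ e'U.
Qed.

(** [u1] marks all touched states, [u2] is the place for [h] rounds of the rendezvous loop, inserted
    only on the level of [e], and [u3] finishes the portion and broadcasts. *)
Lemma circulation_block N i (f : config T N) h :
  n0 <= i -> i <= m -> stocked i f ->
  exists u1 u2 u3, let w := u1 ++ u2 ++ u3 in
    [/\ okpath (@transition _ _ _ Q N) f w, stocked (nxt i) (endpoint f w),
        all (fun x => isSome x.1.2) u2, has (fun x => ~~ isSome x.1.2) u3
      & i = lev (src e) -> 0 < \sum_(x <- w) takers e x /\
          forall a, acts a e -> 0 < count_mem a sg -> h <= \sum_(x <- u2) takers e x].
Proof.
move=> ni im [Hf Hc]; have [s1 [s2 [q [F1 F2 Hs Hq]]]] := HK im.
have eQ := circulation_edge HU eU.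
pose sgh := if i == lev (src e) then flatten (nseq h sg) else [::].
have sgh_act a : a \in sgh -> a \in active U i.
  rewrite /sgh; case: eqP => // Ei /flattenP[s /nseqP[-> _] /(proj1 Hsg)[e' [e'U Ha Hi]]].
  by rewrite inE; apply/existsP; exists e'; rewrite e'U Ha Hi Ei eqxx.
have Fh : fires (pre i) (post i) sgh q q.
  rewrite /sgh; case: eqP => [Ei|_]; last by constructor.
  apply: fires_loop; rewrite Ei; apply: (rdz_loop_fires Hsg) => a y asg ay.
  apply: Hq; rewrite Ei in sgh_act *; apply: (pre_touched HU) ay.
  have [e' [e'U Ha Hi]] := proj1 Hsg a asg.
  by rewrite inE; apply/existsP; exists e'; rewrite e'U Ha Hi eqxx.
have [a as1|w1] := lift_fires rdz_lev rdz_uniq rdz_complete F1 Hf Hc _.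
  by apply: active_enabled; rewrite -Hs mem_cat as1.
set f1 := endpoint f w1 => -[ok1 lev1 cnt1 _ tk1].
have [a as2|w2] := lift_fires rdz_lev rdz_uniq rdz_complete Fh lev1 cnt1 _.
  by apply: active_enabled; apply: sgh_act.
set f2 := endpoint f1 w2 => -[ok2 lev2 cnt2 some2 tk2].
have [a as2|w3] := lift_fires rdz_lev rdz_uniq rdz_complete F2 lev2 cnt2 _.
  by apply: active_enabled; rewrite -Hs mem_cat as2 orbT.
set f3 := endpoint f2 w3 => -[ok3 lev3 cnt3 _ tk3].
have [|g [Htr Hg Hcg tkg]] := lift_bcast (z := fun e => K * z e) bcast_lev Qtemplate lev3.
  move=> x; apply: leq_trans (cnt3 x); rewrite -big_distrr leq_mul2l /leaving.
  apply/orP; right; case: eqP => [Ex|nx].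
    rewrite big_mkcond [leqRHS]big_mkcond; apply: leq_sum => e' _.
    by case: (e' \in _) => //=; case: (is_bc e'); case: (src e' == x); case: (_ == i).
  rewrite big1 // => e' /and3P[_ /andP[_ /eqP Hi] /eqP E]; by case: nx; rewrite -E.
exists w1, w2, (w3 ++ [:: (f3, None, g)]) => w.
have Eend : endpoint f w = g by rewrite /w !endpoint_cat.
split=> //.
- do 3 (apply/okpath_cat; split=> //).
- rewrite Eend; split=> // y; apply: leq_trans (Hcg y).
  rewrite -big_distrr leq_mul2l /entering; apply/orP; right; case: eqP => // Ey.
  rewrite big_mkcond [leqRHS]big_mkcond; apply: leq_sum => e' _.
  case: (posnP (z e')) => [->|]; first by case: ifP.
  rewrite zU => e'U; case: eqP => //= Et; case: (boolP (is_bc e')) => //= be'.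
  have e'Q := circulation_edge HU e'U.
  (* [nxt] is injective on the levels of the loop, so an edge of [U] that enters the next level by
     broadcast starts on level [i]. *)
  have := circulation_level HU e'U; have := bc_edge_lev e'Q be'.
  rewrite e'Q Et Ey /= => En nl.
  suff -> : lev (src e') = i by rewrite eqxx.
  move: En (lev_le (src e')); rewrite /nxt; move: (lev _) nl => j nl; case: (ltnP i m); case: (ltnP j m); lia.
- by rewrite has_cat /= orbT.
- move=> Ei; split=> [|a Ha ca]; last first.
    apply: leq_trans (tk2 a e eQ Ha (esym Ei)).
    rewrite /sgh Ei eqxx count_flatten map_nseq sumn_nseq.
    by rewrite mulnC leq_pmulr.
  rewrite /w !big_cat /= big_seq1; case: (boolP (is_bc e)) => be.
    have := tkg e eQ be (esym Ei); have : 0 < K * z e by rewrite muln_gt0 K0 zU.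
    by lia.
  have [a Ha] := rdz_acts be.
  have : a \in s1 ++ s2 by rewrite Hs inE; apply/existsP; exists e; rewrite eU Ha Ei eqxx.
  have := tk1 a e eQ Ha (esym Ei); have := tk3 a e eQ Ha (esym Ei).
  by rewrite mem_cat -!has_pred1 !has_count => ? ? /orP[?|?]; lia.
Qed.

End Block.

(** Process 1 must exist; asking for [M.+1] processes per state ensures it. *)
Lemma populated_pos x M :
  exists N (f0 : config T N.+1) (w : seq (config T N.+1 * glab N.+1 * config T N.+1)),
    [/\ forall p, f0 p \in init Q, okpath (@transition _ _ _ Q N.+1) f0 w,
        forall p, lev (endpoint f0 w p) = lev x
      & forall y, lev y = lev x -> M <= count_at (endpoint f0 w) y].
Proof.
have [[|N] [f0 [w [H1 H2 H3 H4]]]] := Qpop x M.+1.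
  by have := H4 x erefl; rewrite /count_at big_ord0.
by exists N, f0, w; split=> // y /H4/ltnW.
Qed.

(** A prefix populates the level of [e]; then the blocks go round the loop of levels. Block [r]
    performs [r] rounds of pumping when it is on the level of [e], which recurs periodically, so the
    number of rounds is unbounded. *)
Lemma circulation_run U e sg :
  circulation Q lev U -> e \in U -> rdz_loop U (lev (src e)) sg ->
  exists N (c : nat -> config T N.+1) (l : nat -> glab N.+1),
    [/\ is_run Q c l, forall t, exists2 t', t <= t' & l t' = None,
        forall t, exists2 t', t <= t' & 0 < takers e (c t', l t', c t'.+1)
      & forall a, acts a e -> 0 < count_mem a sg ->
          forall r, exists t n, (forall s, t <= s < t + n -> l s <> None) /\
            r <= \sum_(t <= s < t + n) takers e (c s, l s, c s.+1)].
Proof.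
move=> HU eU Hsg; have [z Hz zU] := circulation_flow HU.
have [K K0 HK] := portion_uniform HU (\sum_y amount (pre (lev (src e))) sg y) Hz zU.
pose i0 := lev (src e); pose lv r := iter r nxt i0.
have lvP r : n0 <= lv r /\ lv r <= m.
  elim: r => [|r [H1 H2]]; last exact: nxt_loop.
  by split; [apply: circulation_level HU _ eU|apply: lev_le].
have [N [f0 [w0 [Hinit ok0 lev0 cnt0]]]] := populated_pos (src e) (\sum_y K * entering z i0 y).
have stock0 : stocked z K (lv 0) (endpoint f0 w0).
  split=> // y; case: (eqVneq (lev y) i0) => [Ey|ny].
    by apply: leq_trans (cnt0 y Ey); rewrite (bigD1 y) //= leq_addr.
  by rewrite /entering (negbTE ny) muln0.
(* The populating prefix becomes part of block 0, hence the different invariant at its start. *)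
pose Inv r (f : config T N.+1) := if r is 0 then f = f0 else stocked z K (lv r) f.
pose Good r (w : seq (config T N.+1 * glab N.+1 * config T N.+1)) :=
  exists u1 u2 u3, [/\ w = u1 ++ u2 ++ u3,
    all (fun x => isSome x.1.2) u2, has (fun x => ~~ isSome x.1.2) u3
  & lv r = i0 -> 0 < \sum_(x <- w) takers e x /\
      forall a, acts a e -> 0 < count_mem a sg -> r <= \sum_(x <- u2) takers e x].
have step r f : Inv r f -> exists w, [/\ 0 < size w,
    okpath (@transition _ _ _ Q N.+1) f w, Inv r.+1 (endpoint f w) & Good r w].
  move=> Hinv; have [H1 H2] := lvP r.
  have [w [okw Hw]] : exists w, okpath (@transition _ _ _ Q N.+1) f w /\
      stocked z K (lv r) (endpoint f w).
    by case: r Hinv {H1 H2} => [->|r Hr]; [exists w0|exists [::]].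
  have [u1 [u2 [u3 [ok' Hs' some2 none3 tk']]]] :=
    circulation_block HU zU eU Hsg K0 HK r H1 H2 Hw.
  exists (w ++ u1 ++ u2 ++ u3); split.
  - by rewrite !size_cat; case: u3 none3 {ok' Hs' tk'} => //= *; rewrite !addnS.
  - exact/okpath_cat.
  - by rewrite endpoint_cat.
  - exists (w ++ u1), u2, u3; split=> //; first by rewrite catA.
    move=> /tk'[H3 H4]; split=> //; rewrite big_cat /=.
    by apply: leq_trans H3 _; rewrite leq_addl.
have [c [l [tau [Ec Hstep Htau HGood]]]] := infinite_path (erefl : Inv 0 f0) step.
have Hret r : lv (r * (m - n0).+1) = i0.
  by apply: nxt_return; have [] := lvP 0.
have big r : r <= r * (m - n0).+1 by rewrite leq_pmulr.
exists N, c, l; split.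
- by split=> [p|//]; rewrite Ec.
- move=> t; have [u1 [u2 [u3 [Eseg _ + _]]]] := HGood t.
  have [_ E2] := segment_of_cat Eseg; have [_ E3] := segment_of_cat (esym E2).
  rewrite E3 => /hasP[x /mapP[s]]; rewrite mem_iota => /andP[Hs _] ->.
  by rewrite /=; case El: (l s) => // _; exists s => //; have := Htau t; lia.
- move=> t; have [u1 [u2 [u3 [_ _ _ /(_ (Hret t))[]]]]] := HGood (t * (m - n0).+1).
  rewrite sum_segment_of; set a := tau _; set b := _ - _ => H _.
  have [s [Hs1 Hs2]] : exists s, a <= s /\ 0 < takers e (c s, l s, c s.+1).
    apply: NNPP => no; move: H; rewrite big_nat big1 // => s /andP[Hs _].
    by apply/eqP; rewrite -leqn0 leqNgt; apply/negP => Hs'; apply: no; exists s.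
  exists s => //; apply: leq_trans Hs1; apply: leq_trans (big t) _; exact: Htau.
- move=> a Ha ca r.
  have [u1 [u2 [u3 [Eseg some2 _ /(_ (Hret r))[_ /(_ a Ha ca) H]]]]] := HGood (r * (m - n0).+1).
  have [_ E2] := segment_of_cat Eseg; have [E3 _] := segment_of_cat (esym E2).
  set t := _ + size u1 in E3; exists t, (size u2); split.
    move=> s Hs lsN; move/allP: some2; rewrite E3 => /(_ (c s, l s, c s.+1)).
    rewrite /= lsN => H'; suff: false by []; apply: H'.
    by rewrite -lsN; apply: map_f; rewrite mem_iota.
  by rewrite -sum_segment_of -E3; apply: leq_trans (big r) H.
Qed.

Lemma recurrent_execution e : recurrent Q lev e ->
  exists xi, [/\ infinite_execution Q xi, infinitely_often (pred1 e) xi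
    & infinitely_often is_bc xi].
Proof.
move=> [U [HU eU]].
have [|N [c [l [Hrun Hb He _]]]] := circulation_run (sg := [::]) HU eU.
  by split=> // y; rewrite /amount !big_nil.
have [xi [H1 H2 H3 _]] := run_infinitely_often Hrun He.
by exists xi; split=> //; apply: H3.
Qed.

Lemma pumpable_green e : pumpable Q lev e -> green Q e.
Proof.
move=> [U [HU eU /(rdz_cycle_loop (circulation_edge HU eU))[a [sg [Ha ca Hsg]]]]].
have [N [c [l [Hrun Hb He Hp]]]] := circulation_run HU eU Hsg.
by apply: run_green Hrun Hb _; apply: Hp Ha ca.
Qed.

(** Once the level of [e] is populated, the rendezvous loop can be repeated forever; broadcasts
    occur in the prefix only. *)
Lemma rdz_cycle_execution e : e \in edges Q -> rdz_cycle Q lev (edges Q) e ->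
  exists xi, [/\ infinite_execution Q xi, infinitely_often (pred1 e) xi
    & finitely_often is_bc xi].
Proof.
move=> He /(rdz_cycle_loop He)[a [sg [Ha ca Hsg]]].
pose i0 := lev (src e); pose M := \sum_y amount (pre i0) sg y.
have [N [f0 [w0 [Hinit ok0 lev0 cnt0]]]] := populated_pos (src e) M.
pose q y := if lev y == i0 then M else 0.
have Fq : fires (pre i0) (post i0) sg q q.
  apply: (rdz_loop_fires Hsg) => b y _ /weight_gt0[e' [_ _ Hi' <-]].
  by rewrite /q Hi' eqxx.
pose full (f : config T N.+1) := (forall p, lev (f p) = i0) /\ forall y, q y <= count_at f y.
pose Inv r (f : config T N.+1) := if r is 0 then f = f0 else full f.
pose Good r (w : seq (config T N.+1 * glab N.+1 * config T N.+1)) :=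
  0 < \sum_(x <- w) takers e x /\ (0 < r -> all (fun x => isSome x.1.2) w).
have blk f : full f -> exists w, [/\ okpath (@transition _ _ _ Q N.+1) f w,
    full (endpoint f w), all (fun x => isSome x.1.2) w & 0 < \sum_(x <- w) takers e x].
  move=> [Hf1 Hf2].
  have [b bs|w [ok' lev' cnt' some' tk']] := lift_fires rdz_lev rdz_uniq rdz_complete Fq Hf1 Hf2 _.
    by have [e' [e'Q Hb Hi]] := proj1 Hsg b bs; exists e'.
  by exists w; split=> //; apply: leq_trans (tk' a e He Ha erefl).
have step r f : Inv r f -> exists w, [/\ 0 < size w,
    okpath (@transition _ _ _ Q N.+1) f w, Inv r.+1 (endpoint f w) & Good r w].
  move=> Hinv.
  have [w [okw Hw Hwr]] : exists w, [/\ okpath (@transition _ _ _ Q N.+1) f w,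
      full (endpoint f w) & 0 < r -> w = [::]].
    case: r Hinv => [->|r Hr]; [exists w0; split=> //|by exists [::]].
    by split=> // y; rewrite /q; case: eqP => // /cnt0.
  have [w' [ok' Hs' some' tk']] := blk _ Hw.
  exists (w ++ w'); split.
  - by rewrite size_cat; case: w' tk' {ok' Hs' some'} => [|*]; rewrite ?big_nil // addnS.
  - exact/okpath_cat.
  - by rewrite endpoint_cat.
  - split=> [|/Hwr ->//]; rewrite big_cat /=; apply: leq_trans tk' _; exact: leq_addl.
have [c [l [tau [Ec Hstep Htau HGood]]]] := infinite_path (erefl : Inv 0 f0) step.
have Hrun : is_run Q c l by split=> [p|//]; rewrite Ec.
have [|xi [H1 H2 _ H3]] := run_infinitely_often (e := e) Hrun.
  move=> t; have [] := HGood t; rewrite sum_segment_of => H _.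
  apply: NNPP => no; move: H; rewrite big_nat big1 // => s /andP[Hs _].
  apply/eqP; rewrite -leqn0 leqNgt; apply/negP => Hs'; apply: no; exists s => //.
  exact: leq_trans (Htau t) Hs.
exists xi; split=> //; apply: H3; exists (tau 1) => t.
suff H r : tau 1 <= t -> t < tau r -> l t <> None.
  by move=> Ht; apply: (H t.+1) => //; apply: Htau.
have tau_lt s : tau s < tau s.+1.
  have [H _] := HGood s; rewrite ltnNge -subn_eq0; apply/negP => /eqP E.
  by move: H; rewrite E /segment_of big_nil.
elim: r => [|r IH] H4 H5; first by have := tau_lt 0; lia.
case: (ltnP t (tau r)) => [|Hr]; first exact: IH.
have [_ some] := HGood r.
have r0 : 0 < r by case: (r) Hr H5 H4 => //; lia.
move/allP: (some r0) => /(_ (c t, l t, c t.+1)) Hin lt; move: Hin; rewrite lt /=.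
move=> H; suff: false by []; apply: H; rewrite -lt; apply: map_f.
by rewrite mem_iota; lia.
Qed.

End Sufficiency.

(** * The reachability-unwinding *)

Section Unwinding.

Variables (k : nat) (Act S : finType) (P : lts k Act S).
Local Notation edg := (edge k Act S).

Definition fireable (X : {set S}) (a : Act) : bool :=
  [forall j : 'I_k, exists e' in edges P, (e'.1.2 == rdz a j) && (e'.1.1 \in X)].

Lemma fireableP (X : {set S}) a : reflect
  (forall j, exists s t, (s, rdz a j, t) \in edges P /\ s \in X) (fireable X a).
Proof.
apply: (iffP forallP) => H j; last first.
  have [s [t [He Hs]]] := H j; apply/existsP; exists (s, rdz a j, t).
  by rewrite He /= eqxx.
have /existsP[[[s l] t] /andP[He /andP[/= /eqP El Hs]]] := H j.
by exists s, t; rewrite -El.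
Qed.

Lemma fireable_sub (X Y : {set S}) a : X \subset Y -> fireable X a -> fireable Y a.
Proof.
move=> /subsetP XY /fireableP H; apply/fireableP => j.
by have [s [t [He /XY Hs]]] := H j; exists s, t.
Qed.

Definition rdz_closed (Y : {set S}) : Prop :=
  forall s a j t, (s, rdz a j, t) \in edges P -> fireable Y a -> t \in Y.

(** Whichever edges the steps pick, they stay inside every closed set above [I], and a step that
    changes anything adds a new edge; so the iteration ends at the least closed set. *)
Lemma saturateP (I : {set S}) : let XR := saturate P I in
  [/\ I \subset XR.1,
      forall s a j t, (s, rdz a j, t) \in XR.2 =
        ((s, rdz a j, t) \in edges P) && fireable XR.1 a,
      forall s t, (s, bcast k Act, t) \notin XR.2,
      rdz_closed XR.1
    & forall Y : {set S}, I \subset Y -> rdz_closed Y -> XR.1 \subset Y].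
Proof.
move=> XR.
pose inv (XR : {set S} * {set edg}) := [/\ I \subset XR.1, XR.2 \subset edges P,
  forall e, e \in XR.2 -> (if e.1.2 is Some (a, _) then fireable XR.1 a else false) /\ e.2 \in XR.1
  & forall Y : {set S}, I \subset Y -> rdz_closed Y -> XR.1 \subset Y].
have inv_step YR : inv YR -> inv (saturate_step P YR).
  case: YR => [Y R] [/= H1 H2 H3 H4]; rewrite /saturate_step.
  case: pickP => //= -[[s l] t]; rewrite /addable inE /= => /andP[/andP[eR eP] Hl].
  split=> /=.
  - by apply: subset_trans H1 _; apply: subsetUr.
  - by rewrite subUset sub1set eP.
  - have mono a : fireable Y a -> fireable (t |: Y) a by apply/fireable_sub/subsetUr.
    move=> e; rewrite !inE => /orP[/eqP ->|/H3[He1 He2]] /=.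
      by rewrite eqxx; split=> //; case: l Hl {eR eP} => [[a j]|] //; apply: mono.
    rewrite He2 orbT; split=> //; case: e.1.2 He1 => [[a j]|] //; exact: mono.
  - move=> Z IZ Zcl; rewrite subUset sub1set H4 // andbT.
    case: l Hl eP {eR} => [[a j]|] // Ha eP; apply: (Zcl _ _ _ _ eP).
    exact: fireable_sub (H4 _ IZ Zcl) Ha.
have inv_iter n : inv (iter n (saturate_step P) (I, set0)).
  by elim: n => [|n IH]; [split=> //= [|e]; rewrite ?sub0set ?inE|apply: inv_step].
have progress n : n <= #|(iter n (saturate_step P) (I, set0)).2| \/
    saturate_step P (iter n (saturate_step P) (I, set0)) = iter n (saturate_step P) (I, set0).
  elim: n => [|n [IH|IH]]; [by left| |by right; rewrite /= IH].
  rewrite iterS; move: (iter n _ _) IH => YR IH.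
  rewrite /saturate_step; case: pickP => [e|no]; last by right; case: pickP => // e; rewrite no.
  by rewrite /addable inE => /andP[/andP[eR _] _]; left; rewrite /= cardsU1 eR.
have [H1 H2 H3 H4] := inv_iter #|edges P|.
have noadd e : ~~ addable P XR.1 XR.2 e.
  have := progress #|edges P|; rewrite -/(saturate P I) -/XR => -[le|fix_].
    have /eqP E : XR.2 == edges P by rewrite eqEcard H2 le.
    by rewrite /addable E inE andNb.
  move: fix_; rewrite /saturate_step; case: pickP => [e' He' E|-> //].
  move: He'; rewrite /addable inE => /andP[/andP[+ _] _].
  by rewrite -E /= !inE eqxx.
have HR s a j t : ((s, rdz a j, t) \in XR.2) =
    ((s, rdz a j, t) \in edges P) && fireable XR.1 a.
  apply/idP/andP => [eR|[eP Ha]].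
    by split; [apply: (subsetP H2)|have [] := H3 _ eR].
  have := noadd (s, rdz a j, t); rewrite /addable inE /= eP andbT.
  by rewrite -/(fireable XR.1 a) Ha andbT negbK.
split=> //.
- by move=> s t; apply/negP => /H3[].
- by move=> s a j t eP Ha; have [] := H3 (s, rdz a j, t); rewrite ?HR ?eP.
Qed.

Definition entry (i : nat) : {set S} := (layer P i).1.

Lemma layerE i : layer P i = (entry i, saturate P (entry i)).
Proof. by rewrite /entry; case: i. Qed.

Lemma layer_statesE i : layer_states P i = (saturate P (entry i)).1.
Proof. by rewrite /layer_states layerE. Qed.

Lemma entryS i : entry i.+1 = bcast_image P (layer_states P i).
Proof. by []. Qed.

Lemma entry_sub i : entry i \subset layer_states P i.
Proof. by rewrite layer_statesE; have [] := saturateP (entry i). Qed.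

Lemma layer_closed i : rdz_closed (layer_states P i).
Proof. by rewrite layer_statesE; have [] := saturateP (entry i). Qed.

Lemma layer_least i (Y : {set S}) :
  entry i \subset Y -> rdz_closed Y -> layer_states P i \subset Y.
Proof. by rewrite layer_statesE; have [_ _ _ _] := saturateP (entry i); apply. Qed.

Lemma layer_edgesE i s a j t : ((s, rdz a j, t) \in layer_edges P i) =
  ((s, rdz a j, t) \in edges P) && fireable (layer_states P i) a.
Proof.
by rewrite layer_statesE /layer_edges layerE; have [] := saturateP (entry i).
Qed.

Lemma lasso_endP : layer P (lasso_end P).+1 \in mkseq (layer P) (lasso_end P).+1.
Proof. by rewrite /lasso_end; case: ex_minnP. Qed.

Lemma lasso_start_le : lasso_start P <= lasso_end P.
Proof.
by have := lasso_endP; rewrite -index_mem size_mkseq.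
Qed.

Lemma lasso_startE : layer P (lasso_start P) = layer P (lasso_end P).+1.
Proof.
have := lasso_endP => H; rewrite -[RHS](nth_index (layer P 0) H) nth_mkseq //.
by rewrite ltnS lasso_start_le.
Qed.

Local Notation T := (ustate P).
Local Notation Q := (unwinding P).
Local Notation m := (lasso_end P).
Local Notation n0 := (lasso_start P).
Local Notation lev := (@level k Act S P).

Lemma ustate_eq (x y : T) : base x = base y -> lev x = lev y -> x = y.
Proof.
move=> Eb El; apply: val_inj; move: Eb El; rewrite /base /level.
by case: (val x) (val y) => [s i] [t j] /= -> /val_inj ->.
Qed.

Lemma ustate_states (x : T) : base x \in layer_states P (lev x).
Proof. exact: (valP x). Qed.

Lemma level_le (x : T) : lev x <= m.
Proof. by rewrite -ltnS /level ltn_ord. Qed.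

Lemma ustate_ex s i : i <= m -> s \in layer_states P i ->
  exists x : T, base x = s /\ lev x = i.
Proof.
rewrite -ltnS => Hi Hs.
by exists (exist (fun x : S * 'I_m.+1 => x.1 \in layer_states P x.2) (s, Ordinal Hi) Hs).
Qed.

Lemma uedge_rdz (x y : T) a j : ((x, rdz a j, y) \in edges Q) =
  [&& lev y == lev x, (base x, rdz a j, base y) \in edges P
    & fireable (layer_states P (lev x)) a].
Proof. by rewrite inE /= layer_edgesE. Qed.

Lemma uedge_bcast (x y : T) : ((x, bcast k Act, y) \in edges Q) =
  (lev y == nxt m n0 (lev x)) && ((base x, bcast k Act, base y) \in edges P).
Proof. by rewrite inE. Qed.

Hypothesis Ptemplate : is_template P.
Hypothesis Puniq : rdz_unique P.

Lemma u_rdz_lev (x : T) a j y : (x, rdz a j, y) \in edges Q -> lev y = lev x.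
Proof. by rewrite uedge_rdz => /and3P[/eqP]. Qed.

Lemma u_bcast_lev (x y : T) :
  (x, bcast k Act, y) \in edges Q -> lev y = nxt m n0 (lev x).
Proof. by rewrite uedge_bcast => /andP[/eqP]. Qed.

Lemma u_rdz_uniq a j (x y x' y' : T) :
  (x, rdz a j, y) \in edges Q -> (x', rdz a j, y') \in edges Q ->
  lev x = lev x' -> x = x' /\ y = y'.
Proof.
rewrite !uedge_rdz => /and3P[/eqP Hy He _] /and3P[/eqP Hy' He' _] Hx.
have [E1 E2] := Puniq He He'.
by split; apply: ustate_eq => //; rewrite Hy Hy'.
Qed.

Lemma u_init_lev (x : T) : x \in init Q -> lev x = 0.
Proof. by rewrite inE => /andP[_ /eqP]. Qed.

(** At the end of the lasso [nxt] wraps to [lasso_start], whose layer equals the one after the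
    end. *)
Lemma layer_next i : layer_states P (nxt m n0 i) = layer_states P i.+1 \/ m < i.
Proof.
rewrite /nxt; case: (ltngtP i m) => [_|mi|->]; [by left|by right|left].
by rewrite /layer_states lasso_startE.
Qed.

Lemma u_template : is_template Q.
Proof.
move=> x; have [t Ht] := Ptemplate (base x).
have [E|] := layer_next (lev x); last by rewrite ltnNge level_le.
have [||y [Ey Ly]] := @ustate_ex t (nxt m n0 (lev x)).
- by have := nxt_loop lasso_start_le; rewrite /nxt; case: ltnP => //; rewrite lasso_start_le.
- rewrite E; apply: (subsetP (entry_sub _)); rewrite entryS inE.
  by apply/existsP; exists (base x); rewrite ustate_states.
by exists y; rewrite uedge_bcast Ly Ey eqxx.
Qed.

(** An action of a layer is fireable there: each role has an edge with its source in the layer, and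
    saturation contains the target. *)
Lemma u_rdz_complete (x : T) a j y j' : (x, rdz a j, y) \in edges Q ->
  exists x' y', (x', rdz a j', y') \in edges Q /\ lev x' = lev x.
Proof.
rewrite uedge_rdz => /and3P[_ _ Ha].
have [s [t [He Hs]]] := fireableP _ _ Ha j'.
have [x' [Ex' Lx']] := ustate_ex (level_le x) Hs.
have [y' [Ey' Ly']] := ustate_ex (level_le x) (layer_closed He Ha).
by exists x', y'; rewrite uedge_rdz Lx' Ly' Ex' Ey' eqxx He.
Qed.

(** * Populating all states of a level *)

Definition reached_with (Z : T -> bool) (i M : nat) : Prop :=
  exists N (f0 : config T N) (w : seq (config T N * glabel k Act N * config T N)),
    [/\ forall p, f0 p \in init Q, okpath (@transition _ _ _ Q N) f0 w,
        forall p, lev (endpoint f0 w p) = i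
      & forall x, lev x = i -> Z x -> M <= count_at (endpoint f0 w) x].

Lemma reached_init M : reached_with (fun x => base x \in entry 0) 0 M.
Proof.
pose J : finType := ({x : T | x \in init Q} * 'I_M)%type.
exists #|J|, [ffun p => val (enum_val p).1], [::]; split=> //.
- by move=> p; rewrite ffunE; apply: (valP (enum_val p).1).
- by move=> p; rewrite /endpoint /= ffunE; apply/u_init_lev/(valP (enum_val p).1).
- move=> x Lx Ex.
  have Hx : x \in init Q by rewrite inE Lx eqxx andbT.
  pose q (r : 'I_M) : 'I_#|J| := enum_rank (exist _ x Hx : {x : T | x \in init Q}, r).
  have qinj : injective q by move=> r r' /enum_rank_inj [].
  have := sum_injective_le (fun p => ([ffun p => val (enum_val p).1] p == x) : nat) qinj.
  apply: leq_trans; apply: (@leq_trans (\sum_(r < M) 1)).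
    by rewrite sum_nat_const card_ord muln1.
  apply: leq_sum => r _.
  by rewrite ffunE /q enum_rankK /= eqxx.
Qed.

(** Any set of places that contains the entry states and is closed under the net of the level
    contains the whole layer, by minimality of the saturation; so [fires_cover] marks all states of
    the level at once. *)
Lemma reached_saturate i : i <= m ->
  (forall M, reached_with (fun x => base x \in entry i) i M) ->
  forall M, populated Q lev i M.
Proof.
move=> im Hpop M.
pose V := [set a | [exists e in edges Q, performs a e && (lev (source e) == i)]].
pose c (y : T) : nat := (lev y == i) && (base y \in entry i).
have [|n [sg [d [sgV F Hd]]]] := @fires_cover T Act (consumption Q lev i) (production Q lev i)
    V [set y | lev y == i] c.
  move=> X Hc Hr; apply/subsetP => y; rewrite inE => /eqP Ly.
  pose Y := [set s in layer_states P i | [exists x in X, (base x == s) && (lev x == i)]].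
  have YS : Y \subset layer_states P i by apply/subsetP => s; rewrite inE => /andP[].
  have HY x : lev x = i -> base x \in Y -> x \in X.
    move=> Lx; rewrite inE => /andP[_ /existsP[x' /and3P[x'X /eqP Eb /eqP Lx']]].
    by rewrite (@ustate_eq x x') // Lx.
  apply: (HY y) => //; suff /subsetP : layer_states P i \subset Y.
    by apply; rewrite -Ly ustate_states.
  apply: layer_least => [|s a j t He Ha].
    apply/subsetP => s Hs; have Hs' := subsetP (entry_sub i) _ Hs; rewrite inE Hs'.
    have [x [Ex Lx]] := ustate_ex im Hs'.
    by apply/existsP; exists x; rewrite Ex Lx !eqxx !andbT Hc // /c Ex Lx eqxx Hs.
  have Ha' := fireable_sub YS Ha; have Ht := layer_closed He Ha'.
  have [y' [Ey' Ly']] := ustate_ex im Ht.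
  rewrite inE Ht; apply/existsP; exists y'; rewrite Ey' Ly' !eqxx !andbT.
  (* Role [j] of the fireable action has its source in [Y], and since the edge of a role is unique,
     this source is [s]. *)
  have [s' [t' [He' Hs']]] := fireableP _ _ Ha j.
  have [Es Et] := Puniq He He'; subst s' t'.
  have [x' [Ex' Lx']] := ustate_ex im (subsetP YS _ Hs').
  have HeQ : (x', rdz a j, y') \in edges Q.
    by rewrite uedge_rdz Lx' Ly' Ex' Ey' eqxx He.
  have Hacts : performs a ((x', rdz a j, y') : edge k Act T) by rewrite /performs /= eqxx.
  apply: (Hr a) => [|x /weight_gt0[e2 []]|].
  - by rewrite inE; apply/existsP; exists (x', rdz a j, y'); rewrite HeQ Hacts /= Lx'.
  - case: e2 => [[x2 [[b j2]|]] y2]; rewrite /performs /source //= => He2 /eqP Eb Li <-.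
    rewrite Eb in He2; apply: HY => //.
    move: He2; rewrite uedge_rdz => /and3P[_ He2 _].
    have [s2 [t2 [He3 Hs2]]] := fireableP _ _ Ha j2.
    by have [-> _] := Puniq He2 He3.
  - by have := weight_ge (@target _ _ _) HeQ Hacts Lx'.
have [N [f0 [w [Hinit okw Lw Cw]]]] := Hpop (M * n).
have [x|a asg|w' [ok' L' C' _ _]] := lift_fires u_rdz_lev u_rdz_uniq u_rdz_complete
    (fires_mul M F) Lw _ _.
- rewrite mulnA /c; case: eqP => [Lx|_]; last by rewrite muln0.
  by case: (boolP (base x \in entry i)) => Hx; rewrite /= ?muln0 ?muln1 //; apply: Cw.
- have /sgV : a \in sg by case/flattenP: asg => s /nseqP[-> _].
  by rewrite inE => /existsP[e /and3P[He Ha /eqP Hi]]; exists e.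
exists N, f0, (w ++ w'); split=> //.
- exact/okpath_cat.
- by move=> p; rewrite endpoint_cat.
- move=> x Lx; rewrite endpoint_cat; apply: leq_trans (C' x).
  by rewrite leq_pmulr // Hd // inE Lx.
Qed.

(** [M] processes are assigned to every broadcast edge, so [M] times the number of edges suffices in
    each state. *)
Lemma reached_bcast i : i < m -> (forall M, populated Q lev i M) ->
  forall M, reached_with (fun x => base x \in entry i.+1) i.+1 M.
Proof.
move=> im Hpop M; have [N [f0 [w [Hinit okw Lw Cw]]]] := Hpop (#|edge k Act T| * M).
have [|g [Htr Lg Cg _]] := lift_bcast (z := fun=> M) u_bcast_lev u_template Lw.
  move=> x; case: (eqVneq (lev x) i) => [Lx|nx].
    apply: leq_trans (Cw x Lx); rewrite -sum_nat_const big_mkcond.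
    by apply: leq_sum => e _; case: ifP.
  rewrite big1 // => e /and3P[_ /andP[_ /eqP Hi] /eqP E].
  by case/eqP: nx; rewrite -E.
exists N, f0, (w ++ [:: (endpoint f0 w, None, g)]); split=> //.
- by apply/okpath_cat; split.
- by move=> p; rewrite endpoint_cat /= Lg /nxt im.
- move=> y Ly; rewrite entryS inE => /existsP[s /andP[Hs He]].
  have [x [Ex Lx]] := ustate_ex (ltnW im) Hs.
  rewrite endpoint_cat; apply: leq_trans (Cg y).
  have HeQ : (x, bcast k Act, y) \in edges Q.
    by rewrite uedge_bcast Ly Lx Ex He /nxt im eqxx.
  rewrite (bigD1 (x, bcast k Act, y)) ?leq_addr //=.
  by rewrite HeQ /source /target /= Lx !eqxx.
Qed.

Lemma u_populated (x : T) M : populated Q lev (lev x) M.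
Proof.
suff H i : i <= m -> forall M, populated Q lev i M by apply/H/level_le.
elim: i => [|i IH] im; apply: reached_saturate => //; first exact: reached_init.
by apply: reached_bcast => //; apply/IH/ltnW.
Qed.

(** [pumpable] implies [recurrent], hence this order of the tests; a rendezvous cycle makes an edge
    blue only if the edge is not recurrent. *)
Definition semantic_color (e : edge k Act T) : color :=
  if asb (pumpable Q lev e) then Green
  else if asb (recurrent Q lev e) then Orange
  else if asb (rdz_cycle Q lev (edges Q) e) then Blue else Red.

Lemma semantic_colorP e : e \in edges Q -> has_type Q e (semantic_color e).
Proof.
move=> He.
have exrec xi : infinite_execution Q xi -> infinitely_often (pred1 e) xi ->
    infinitely_often (@is_bcast k Act T) xi -> recurrent Q lev e.
  move=> [N [c [l [phi [Hrun phi_homo phiP phi_xi]]]]].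
  exact: (execution_recurrent u_rdz_lev u_bcast_lev u_rdz_uniq u_init_lev Hrun phi_homo phi_xi).
have excyc xi : infinite_execution Q xi -> infinitely_often (pred1 e) xi ->
    finitely_often (@is_bcast k Act T) xi -> rdz_cycle Q lev (edges Q) e.
  move=> [N [c [l [phi [Hrun phi_homo phiP phi_xi]]]]].
  exact: (execution_rdz_cycle u_rdz_lev u_bcast_lev u_rdz_uniq u_init_lev Hrun phi_homo phiP phi_xi).
have expump xi : infinite_execution Q xi -> infinitely_often (@is_bcast k Act T) xi ->
    (forall r, exists i n, let s := [seq xi j | j <- iota i n] in
     ~~ has (@is_bcast k Act T) s /\ r <= count_mem e s) -> pumpable Q lev e.
  move=> [N [c [l [phi [Hrun phi_homo phiP phi_xi]]]]].
  exact: (execution_pumpable u_rdz_lev u_bcast_lev u_rdz_uniq u_init_lev Hrun phi_homo phiP phi_xi).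
have Hgreen : green Q e <-> pumpable Q lev e.
  split=> [[xi [H1 H2 H3]]|]; first exact: expump H1 H2 H3.
  exact: (pumpable_green lasso_start_le level_le u_rdz_lev u_bcast_lev u_rdz_uniq
            u_template u_rdz_complete u_populated).
have Hrec := recurrent_execution lasso_start_le level_le u_rdz_lev u_bcast_lev u_rdz_uniq
            u_template u_rdz_complete u_populated (e := e).
have Hcyc := rdz_cycle_execution lasso_start_le u_rdz_lev u_rdz_uniq u_rdz_complete u_populated He.
rewrite /semantic_color; case: asbP => [/Hgreen //|Hnp].
case: asbP => [HB|HnB] /=.
  have [xi [H1 H2 H3]] := Hrec HB; split.
  - by move=> /(_ xi H1); apply.
  - by move=> [_ /(_ xi H1 H3)]; apply.
  - by move=> /Hgreen.
case: asbP => [HA|HnA] /=.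
  split; first by have [xi [H1 H2 H3]] := Hcyc HA; exists xi.
  by move=> xi H1 H3 H2; apply: HnB; apply: exrec H1 H2 H3.
move=> xi H1 H2; case: (classic (infinitely_often (@is_bcast k Act T) xi)) => H3.
  by apply: HnB; apply: exrec H1 H2 H3.
by apply: HnA; apply: excyc H1 H2 H3.
Qed.

End Unwinding.

(** * The decision procedure on numbers *)

Lemma computable_all_seq d (A : Type) (s : seq A) (P : A -> seq nat -> bool) :
  (forall a, computable d (fun v => P a v)) ->
  computable d (fun v => all (P^~ v) s).
Proof.
move=> HP; elim: s => [|a s IH] /=; first exact: computable_const.
exact: computable_and.
Qed.

Lemma computable_has_seq d (A : Type) (s : seq A) (P : A -> seq nat -> bool) :
  (forall a, computable d (fun v => P a v)) ->
  computable d (fun v => has (P^~ v) s).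
Proof.
move=> HP; elim: s => [|a s IH] /=; first exact: computable_const.
exact: computable_or.
Qed.

Definition digit (D w i : nat) : nat := w %/ D ^ i %% D.
Definition bit (w i : nat) : bool := digit 2 w i == 1.

(** Proves computability along the syntax of a term; [tac] handles the functions defined so far and
    is extended with each new one. *)
Ltac computes_with tac := lazymatch goal with
| |- computable _ (fun v => nat_of_bool (andb (@?P v) (@?Q v))) =>
    apply: computable_and; computes_with tac
| |- computable _ (fun v => nat_of_bool (orb (@?P v) (@?Q v))) =>
    apply: computable_or; computes_with tac
| |- computable _ (fun v => nat_of_bool (implb (@?P v) (@?Q v))) =>
    apply: computable_imp; computes_with tac
| |- computable _ (fun v => nat_of_bool (negb (@?P v))) =>
    apply: computable_neg; computes_with tac
| |- computable _ (fun v => nat_of_bool (eq_op (@?P v) (@?Q v))) =>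
    apply: computable_eq; computes_with tac
| |- computable _ (fun v => nat_of_bool (leq (@?P v) (@?Q v))) =>
    apply: computable_leq; computes_with tac
| |- computable _ (fun v => nat_of_bool (all (@?P v) (iota 0 (@?n v)))) =>
    apply: computable_all; computes_with tac
| |- computable _ (fun v => nat_of_bool (has (@?P v) (iota 0 (@?n v)))) =>
    apply: computable_has; computes_with tac
| |- computable _ (fun v => find (@?P v) (iota 0 (@?n v))) =>
    apply: computable_find; computes_with tac
| |- computable _ (fun v => bsum (@?n v) (@?F v)) =>
    apply: computable_bsum; computes_with tac
| |- computable _ (fun v => iter (@?n v) (@?F v) (@?b v)) =>
    apply: computable_iter; computes_with tac
| |- computable _ (fun v => nat_of_bool (all (@?P v) (enum _))) =>
    apply: (@computable_all_seq _ _ _ _) => ?; computes_with tac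
| |- computable _ (fun v => nat_of_bool (has (@?P v) (enum _))) =>
    apply: (@computable_has_seq _ _ _ _) => ?; computes_with tac
| |- computable _ (fun v => addn (@?a v) (@?b v)) =>
    apply: (computable2 computable_add); computes_with tac
| |- computable _ (fun v => muln (@?a v) (@?b v)) =>
    apply: (computable2 computable_mul); computes_with tac
| |- computable _ (fun v => expn (@?a v) (@?b v)) =>
    apply: (computable2 computable_exp); computes_with tac
| |- computable _ (fun v => divn (@?a v) (@?b v)) =>
    apply: (computable2 computable_div); computes_with tac
| |- computable _ (fun v => modn (@?a v) (@?b v)) =>
    apply: (computable2 computable_mod); computes_with tac
| |- computable _ (fun v => S (@?a v)) =>
    apply: (computable1 computable_succ); computes_with tac
| |- computable _ (fun v => head 0 (@?w v)) => computes_leaf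
| |- computable _ (fun v => proj ?i (@?w v)) => computes_leaf
| |- computable _ (proj _) => computes_leaf
| |- computable _ (head _) => computes_leaf
| |- _ => first [ exact: computable_const | tac; computes_with tac
          | apply: computable_if; computes_with tac ]
end.

Ltac no_tactic := fail.
Ltac computes0 := computes_with no_tactic.

Lemma computable_digit : computable 3 (fun v => digit (proj 0 v) (proj 1 v) (proj 2 v)).
Proof. rewrite /digit. computes0. Qed.

Lemma computable_bit d a b : computable d a -> computable d b ->
  computable d (fun v => bit (a v) (b v)).
Proof.
move=> Ha Hb; apply: (computable2 (F := fun x y => bit x y) _ Ha Hb); rewrite /bit.
apply: computable_eq; last exact: computable_const.
by apply: (computable3 computable_digit); computes_leaf.
Qed.

Ltac computes_bits := first
  [ apply: computable_bit | apply: (computable3 computable_digit) ].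

Section Algorithm.

Variables (k : nat) (Act : finType).

Definition nlabels : nat := #|{: label k Act}|.
Definition rdz_code (a : Act) (j : 'I_k) : nat := label_code (rdz a j).
Definition bcast_code : nat := label_code (bcast k Act).

Definition nedge (n R s l t : nat) : bool := bit R ((s * n + t) * nlabels + l).

Lemma computable_nedge d n R s l t :
  computable d n -> computable d R -> computable d s -> computable d l ->
  computable d t -> computable d (fun v => nedge (n v) (R v) (s v) (l v) (t v)).
Proof.
apply: (computable5 (F := fun a b c d e => nedge a b c d e)); rewrite /nedge.
computes_with computes_bits.
Qed.

Definition nfireable (a : Act) (n R X : nat) : bool :=
  all (fun j : 'I_k => has (fun s => has (fun t =>
    nedge n R s (rdz_code a j) t && bit X s) (iota 0 n)) (iota 0 n)) (enum 'I_k).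

Ltac computes_edges := first [ computes_bits | apply: computable_nedge ].

Lemma computable_nfireable (a : Act) d n R X :
  computable d n -> computable d R -> computable d X ->
  computable d (fun v => nfireable a (n v) (R v) (X v)).
Proof.
apply: (computable3 (F := fun b c d => nfireable a b c d)); rewrite /nfireable.
computes_with computes_edges.
Qed.

Definition nclosed (n R Y : nat) : bool :=
  all (fun a : Act => nfireable a n R Y ==>
    all (fun j : 'I_k => all (fun s => all (fun t =>
      nedge n R s (rdz_code a j) t ==> bit Y t) (iota 0 n)) (iota 0 n))
    (enum 'I_k)) (enum Act).

Ltac computes_fire := first [ computes_edges | apply: computable_nfireable ].

Lemma computable_nclosed d n R X :
  computable d n -> computable d R -> computable d X ->
  computable d (fun v => nclosed (n v) (R v) (X v)).
Proof.
apply: (computable3 (F := fun b c d => nclosed b c d)); rewrite /nclosed.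
computes_with computes_fire.
Qed.

(** A subset never has a larger code, so the least code of a closed set above [I] belongs to the
    least such set. *)
Definition nsaturate (n R I : nat) : nat :=
  find (fun Y => all (fun s => bit I s ==> bit Y s) (iota 0 n) && nclosed n R Y)
    (iota 0 (2 ^ n)).

Ltac computes_closed := first [ computes_fire | apply: computable_nclosed ].

Lemma computable_nsaturate :
  computable 3 (fun v => nsaturate (proj 0 v) (proj 1 v) (proj 2 v)).
Proof. rewrite /nsaturate. computes_with computes_closed. Qed.

Definition nimage (n R X : nat) : nat :=
  find (fun Z => all (fun s => all (fun t =>
      bit X s && nedge n R s bcast_code t ==> bit Z t) (iota 0 n)) (iota 0 n))
    (iota 0 (2 ^ n)).

Lemma computable_nimage :
  computable 3 (fun v => nimage (proj 0 v) (proj 1 v) (proj 2 v)).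
Proof. rewrite /nimage. computes_with computes_closed. Qed.

(** A layer is determined by its entry set, so only entry sets are iterated and compared. *)
Definition nentry (n I R i : nat) : nat :=
  iter i (fun X => nimage n R (nsaturate n R X)) I.

Ltac computes_image := first [ computes_closed
  | apply: (computable3 computable_nsaturate) | apply: (computable3 computable_nimage) ].

Lemma computable_nentry :
  computable 4 (fun v => nentry (proj 0 v) (proj 1 v) (proj 2 v) (proj 3 v)).
Proof. rewrite /nentry. computes_with computes_image. Qed.

Definition nend (n I R : nat) : nat :=
  find (fun m => has (fun j => nentry n I R m.+1 == nentry n I R j) (iota 0 m.+1))
    (iota 0 (2 ^ n).+1).

Ltac computes_entry := first [ computes_image | apply: (computable4 computable_nentry) ].

Lemma computable_nend : computable 3 (fun v => nend (proj 0 v) (proj 1 v) (proj 2 v)).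
Proof. rewrite /nend. computes_with computes_entry. Qed.

Definition nstart (n I R : nat) : nat :=
  find (fun j => nentry n I R (nend n I R).+1 == nentry n I R j)
    (iota 0 (nend n I R).+1).

Ltac computes_end := first [ computes_entry | apply: (computable3 computable_nend) ].

Lemma computable_nstart :
  computable 3 (fun v => nstart (proj 0 v) (proj 1 v) (proj 2 v)).
Proof. rewrite /nstart. computes_with computes_end. Qed.

Ltac computes_start := first [ computes_end | apply: (computable3 computable_nstart) ].

Definition nstates (n I R i : nat) : nat := nsaturate n R (nentry n I R i).

Lemma computable_nstates :
  computable 4 (fun v => nstates (proj 0 v) (proj 1 v) (proj 2 v) (proj 3 v)).
Proof. rewrite /nstates. computes_with computes_start. Qed.

(* The state [x] of the unwinding is numbered [level x * n + base x], and its *)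
(* edge [(x, l, y)] is numbered [(x * W + y) * nlabels + l].                  *)
Definition nwidth (n I R : nat) : nat := (nend n I R).+1 * n.
Definition nbound (n I R : nat) : nat := nwidth n I R * nwidth n I R * nlabels.

Lemma computable_nwidth :
  computable 3 (fun v => nwidth (proj 0 v) (proj 1 v) (proj 2 v)).
Proof. rewrite /nwidth. computes_with computes_start. Qed.

Ltac computes_width := first [ computes_start | apply: (computable4 computable_nstates)
  | apply: (computable3 computable_nwidth) ].

Lemma computable_nbound :
  computable 3 (fun v => nbound (proj 0 v) (proj 1 v) (proj 2 v)).
Proof. rewrite /nbound. computes_with computes_width. Qed.

Ltac computes_bound := first [ computes_width | apply: (computable3 computable_nbound) ].

Definition nside (b : bool) (n I R p : nat) : nat :=
  if b then p %/ nlabels %% nwidth n I R else p %/ nlabels %/ nwidth n I R.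

Lemma computable_nside b :
  computable 4 (fun v => nside b (proj 0 v) (proj 1 v) (proj 2 v) (proj 3 v)).
Proof. rewrite /nside; case: b; computes_with computes_bound. Qed.

Ltac computes_side := first [ computes_bound | apply: (computable4 (computable_nside _)) ].

Definition nstate (n I R x : nat) : bool :=
  (x %/ n <= nend n I R) && bit (nstates n I R (x %/ n)) (x %% n).

Lemma computable_nstate d n I R x :
  computable d n -> computable d I -> computable d R -> computable d x ->
  computable d (fun v => nstate (n v) (I v) (R v) (x v)).
Proof.
apply: (computable4 (F := fun a b c d => nstate a b c d)); rewrite /nstate.
computes_with computes_side.
Qed.

Ltac computes_state := first [ computes_side | apply: computable_nstate ].

Definition nacts (a : Act) (l : nat) : bool :=
  has (fun j : 'I_k => l == rdz_code a j) (enum 'I_k).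

Lemma computable_nacts a d l :
  computable d l -> computable d (fun v => nacts a (l v)).
Proof.
apply: (computable1 (F := fun x => nacts a x)); rewrite /nacts.
computes0.
Qed.

Ltac computes_acts := first [ computes_state | apply: computable_nacts ].

Definition nuwedge (n I R p : nat) : bool :=
  let x := nside false n I R p in
  let y := nside true n I R p in
  let l := p %% nlabels in
  [&& nstate n I R x, nstate n I R y, nedge n R (x %% n) l (y %% n) &
    (l == bcast_code) && (y %/ n == if x %/ n < nend n I R then (x %/ n).+1
                                    else nstart n I R)
    || (l != bcast_code) && (y %/ n == x %/ n) &&
       all (fun a => nacts a l ==> nfireable a n R (nstates n I R (x %/ n))) (enum Act)].

Lemma computable_nuwedge d n I R x :
  computable d n -> computable d I -> computable d R -> computable d x ->
  computable d (fun v => nuwedge (n v) (I v) (R v) (x v)).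
Proof.
apply: (computable4 (F := fun a b c d => nuwedge a b c d)); rewrite /nuwedge.
computes_with computes_acts.
Qed.

Definition nsame (n I R p q : nat) : bool :=
  has (fun a => nacts a (p %% nlabels) && nacts a (q %% nlabels)) (enum Act) &&
  (nside false n I R p %/ n == nside false n I R q %/ n).

Lemma computable_nsame d n I R x y :
  computable d n -> computable d I -> computable d R -> computable d x -> computable d y ->
  computable d (fun v => nsame (n v) (I v) (R v) (x v) (y v)).
Proof.
apply: (computable5 (F := fun a b c d e => nsame a b c d e)); rewrite /nsame.
computes_with computes_acts.
Qed.

(** One more than the bound on a small flow: the iteration is [solution_bound] for [nbound]
    unknowns, with one equation per state and per pair of edges. A flow is then the digit sequence
    of a number in this base. *)
Definition nbase (n I R : nat) : nat :=
  (iter (nwidth n I R + nbound n I R * nbound n I R)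
     (fun b => 2 * (nbound n I R * b) * b) 1).+1.

Lemma computable_nbase :
  computable 3 (fun v => nbase (proj 0 v) (proj 1 v) (proj 2 v)).
Proof. rewrite /nbase. computes_with computes_acts. Qed.

Ltac computes_uedge := first [ computes_acts | apply: computable_nuwedge
  | apply: computable_nsame | apply: (computable3 computable_nbase) ].

Definition nflow (n I R w : nat) : bool :=
  all (fun x =>
    bsum (nbound n I R) (fun p => (nuwedge n I R p && (nside false n I R p == x)) *
                                  digit (nbase n I R) w p) ==
    bsum (nbound n I R) (fun p => (nuwedge n I R p && (nside true n I R p == x)) *
                                  digit (nbase n I R) w p))
    (iota 0 (nwidth n I R)) &&
  all (fun p => all (fun q =>
      [&& nuwedge n I R p, nuwedge n I R q & nsame n I R p q] ==>
      (digit (nbase n I R) w p == digit (nbase n I R) w q))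
    (iota 0 (nbound n I R))) (iota 0 (nbound n I R)).

Lemma computable_nflow d n I R x :
  computable d n -> computable d I -> computable d R -> computable d x ->
  computable d (fun v => nflow (n v) (I v) (R v) (x v)).
Proof.
apply: (computable4 (F := fun a b c d => nflow a b c d)); rewrite /nflow.
computes_with computes_uedge.
Qed.

Ltac computes_flow := first [ computes_uedge | apply: computable_nflow ].

Definition nflow_in (rdz_only : bool) (n I R u p : nat) : bool :=
  has (fun w => [&& nflow n I R w,
      all (fun q => nuwedge n I R q &&
             (~~ bit u q || rdz_only && (q %% nlabels == bcast_code)) ==>
           (digit (nbase n I R) w q == 0)) (iota 0 (nbound n I R))
    & 0 < digit (nbase n I R) w p])
  (iota 0 (nbase n I R ^ nbound n I R)).

Lemma computable_nflow_in b d n I R u x :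
  computable d n -> computable d I -> computable d R -> computable d u -> computable d x ->
  computable d (fun v => nflow_in b (n v) (I v) (R v) (u v) (x v)).
Proof.
apply: (computable5 (F := fun a a' c d e => nflow_in b a a' c d e)); rewrite /nflow_in.
computes_with computes_flow.
Qed.

(** [b] tells which end is to be covered, [false] standing for the sources; the sets [X] are
    enumerated by their codes. *)
Definition ncovers (b : bool) (n I R u : nat) : bool :=
  let U p := nuwedge n I R p && bit u p in
  let edges := iota 0 (nbound n I R) in
  all (fun X =>
    all (fun p => U p && (p %% nlabels == bcast_code) ==>
                  bit X (nside (~~ b) n I R p)) edges &&
    all (fun p => [&& U p, p %% nlabels != bcast_code &
         all (fun q => U q && nsame n I R p q ==> bit X (nside b n I R q)) edges] ==>
       bit X (nside (~~ b) n I R p)) edges ==>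
    all (fun p => U p ==> bit X (nside b n I R p)) edges)
  (iota 0 (2 ^ nwidth n I R)).

Lemma computable_ncovers b d n I R u :
  computable d n -> computable d I -> computable d R -> computable d u ->
  computable d (fun v => ncovers b (n v) (I v) (R v) (u v)).
Proof.
apply: (computable4 (F := fun a a' c d => ncovers b a a' c d)); rewrite /ncovers.
computes_with computes_flow.
Qed.

Ltac computes_cover := first [ computes_flow | apply: computable_nflow_in
  | apply: computable_ncovers ].

Definition ncirculation (n I R u : nat) : bool :=
  [&& all (fun p => nuwedge n I R p && bit u p ==> nflow_in false n I R u p)
        (iota 0 (nbound n I R)),
      ncovers false n I R u & ncovers true n I R u].

Lemma computable_ncirculation d n I R u :
  computable d n -> computable d I -> computable d R -> computable d u ->
  computable d (fun v => ncirculation (n v) (I v) (R v) (u v)).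
Proof.
apply: (computable4 (F := fun a a' c d => ncirculation a a' c d)); rewrite /ncirculation.
computes_with computes_cover.
Qed.

Ltac computes_circulation := first [ computes_cover | apply: computable_ncirculation ].

Definition nrecurrent (n I R p : nat) : bool :=
  has (fun u => ncirculation n I R u && bit u p) (iota 0 (2 ^ nbound n I R)).

Definition npumpable (n I R p : nat) : bool :=
  has (fun u => [&& ncirculation n I R u, bit u p & nflow_in true n I R u p])
    (iota 0 (2 ^ nbound n I R)).

(** A code [u] containing all edges lifts the restriction on the support in [nflow_in]. *)
Definition nrdz_cycle (n I R p : nat) : bool :=
  has (fun u => all (fun q => nuwedge n I R q ==> bit u q) (iota 0 (nbound n I R)) &&
                nflow_in true n I R u p) (iota 0 (2 ^ nbound n I R)).

Definition ncolor (n I R p : nat) : nat :=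
  if npumpable n I R p then color_code Green
  else if nrecurrent n I R p then color_code Orange
  else if nrdz_cycle n I R p then color_code Blue else color_code Red.

Lemma computable_ncolor :
  computable 4 (fun v => ncolor (proj 0 v) (proj 1 v) (proj 2 v) (proj 3 v)).
Proof.
rewrite /ncolor /npumpable /nrecurrent /nrdz_cycle.
computes_with computes_circulation.
Qed.

(** The arguments are the three of [template_code], then base and level of the source, the label,
    and base and level of the target. *)
Definition nedge_color (v : seq nat) : nat :=
  let n := proj 0 v in let I := proj 1 v in let R := proj 2 v in
  ncolor n I R (((proj 4 v * n + proj 3 v) * nwidth n I R
                 + (proj 7 v * n + proj 6 v)) * nlabels + proj 5 v).

Lemma computable_nedge_color : computable 8 nedge_color.
Proof.
rewrite /nedge_color; apply: (computable4 computable_ncolor);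
  computes_with computes_circulation.
Qed.

End Algorithm.

(** * Correctness of the decision procedure *)

Lemma all_iotaP (p : pred nat) n :
  reflect (forall i, i < n -> p i) (all p (iota 0 n)).
Proof.
by apply: (iffP allP) => H i; have := H i; rewrite mem_iota.
Qed.

Lemma has_iotaP (p : pred nat) n :
  reflect (exists2 i, i < n & p i) (has p (iota 0 n)).
Proof.
by apply: (iffP hasP) => -[i Hi pi]; exists i => //; move: Hi; rewrite mem_iota.
Qed.

Lemma find_iota_least (p : pred nat) m n : m < n -> p m ->
  (forall j, j < m -> ~~ p j) -> find p (iota 0 n) = m.
Proof.
move=> mn pm no; apply/eqP; rewrite eqn_leq; apply/andP; split.
  rewrite leqNgt; apply/negP => /(before_find 0).
  by rewrite nth_iota // pm.
rewrite leqNgt; apply/negP => lt; have := no _ lt; apply/negP; rewrite negbK.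
have Hh : has p (iota 0 n) by apply/has_iotaP; exists m.
by have := nth_find 0 Hh; rewrite nth_iota // -[X in _ < X](size_iota 0 n) -has_find.
Qed.

(** * Positional encodings of functions and sets *)

Section Digits.

Variables (D : nat) (D0 : 0 < D).

Lemma digit_sum_lt (f : nat -> nat) B : (forall i, f i < D) ->
  \sum_(i < B) f i * D ^ i < D ^ B.
Proof.
move=> Hf; elim: B => [|B IH]; first by rewrite big_ord0.
rewrite big_ord_recr /= expnS; apply: (@leq_trans (D ^ B + f B * D ^ B)).
  by rewrite ltn_add2r.
by rewrite -mulSn leq_mul2r Hf orbT.
Qed.

Lemma digit_sum (f : nat -> nat) B j : (forall i, f i < D) -> j < B ->
  digit D (\sum_(i < B) f i * D ^ i) j = f j.
Proof.
move=> Hf; rewrite /digit; elim: B => // B IH; rewrite ltnS leq_eqVlt big_ord_recr /= addnC.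
case/orP => [/eqP ->|jB].
  rewrite divnMDl ?expn_gt0 ?D0 // divn_small ?addn0; last exact: digit_sum_lt.
  by rewrite modn_small.
have -> : f B * D ^ B = (f B * D ^ (B - j.+1) * D) * D ^ j.
  rewrite -!mulnA -expnS -expnD; congr (_ * _ ^ _); lia.
by rewrite divnMDl ?expn_gt0 ?D0 // modnMDl IH.
Qed.

Lemma sum_digit w B : \sum_(i < B) digit D w i * D ^ i = w %% D ^ B.
Proof.
elim: B => [|B IH]; first by rewrite big_ord0 modn1.
rewrite big_ord_recr /= IH /digit addnC.
have lt : w %/ D ^ B %% D * D ^ B + w %% D ^ B < D ^ B.+1.
  rewrite expnS; apply: (@leq_trans ((w %/ D ^ B %% D).+1 * D ^ B)).
    by rewrite mulSn addnC ltn_add2r ltn_mod expn_gt0 D0.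
  by rewrite leq_mul2r ltn_mod D0 orbT.
have E : w = w %/ D ^ B %/ D * D ^ B.+1 + (w %/ D ^ B %% D * D ^ B + w %% D ^ B).
  rewrite {1}(divn_eq w (D ^ B)) {1}(divn_eq (w %/ D ^ B) D).
  by rewrite mulnDl -mulnA -expnS addnA.
by rewrite [in RHS]E modnMDl (modn_small lt).
Qed.

Variables (X : finType) (c : X -> nat).
Hypothesis cinj : injective c.

(** Positional notation with [f x] at place [c x]; places that are not of this form carry the digit
    0. *)
Definition encode (f : X -> nat) : nat := \sum_x f x * D ^ c x.

Lemma encodeE (f : X -> nat) B : (forall x, c x < B) ->
  encode f = \sum_(i < B) (\sum_(x | c x == i) f x) * D ^ i.
Proof.
move=> HB; rewrite /encode (partition_big (fun x => Ordinal (HB x)) predT) //=.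
apply: eq_bigr => i _; rewrite big_distrl /=.
by apply: eq_big => [x|x /eqP <-].
Qed.

Lemma encode_aux (f : X -> nat) i : (forall x, f x < D) -> \sum_(x | c x == i) f x < D.
Proof.
move=> Hf; case: (pickP (fun x => c x == i)) => [x /eqP <-|no]; last by rewrite big_pred0.
by rewrite (big_pred1 x) // => y /=; apply: inj_eq.
Qed.

Lemma encode_lt (f : X -> nat) B : (forall x, c x < B) -> (forall x, f x < D) ->
  encode f < D ^ B.
Proof.
move=> HB Hf; rewrite (encodeE _ HB).
by apply: (digit_sum_lt (f := fun i => \sum_(x | c x == i) f x)) => i; apply: encode_aux.
Qed.

Lemma encode_digit (f : X -> nat) x : (forall x, f x < D) ->
  digit D (encode f) (c x) = f x.
Proof.
move=> Hf.
have HB y : c y < (\max_z c z).+1 by rewrite ltnS leq_bigmax.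
rewrite (encodeE _ HB).
rewrite (digit_sum (f := fun i => \sum_(x | c x == i) f x)) //; last first.
  by move=> i; apply: encode_aux.
by rewrite (big_pred1 x) // => y /=; apply: inj_eq.
Qed.

End Digits.

Section SetCodes.

Variables (X : finType) (c : X -> nat).
Hypothesis cinj : injective c.

Definition set_code (A : {set X}) : nat := \sum_(x in A) 2 ^ c x.

Lemma set_codeE A : set_code A = encode 2 c (fun x => x \in A).
Proof.
rewrite /set_code /encode big_mkcond; apply: eq_bigr => x _.
by case: (x \in A); rewrite ?mul1n.
Qed.

Lemma bit_set_code A x : bit (set_code A) (c x) = (x \in A).
Proof.
rewrite /bit set_codeE encode_digit //; first by case: (x \in A).
by move=> y; case: (y \in A).
Qed.

Lemma set_code_lt A B : (forall x, c x < B) -> set_code A < 2 ^ B.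
Proof.
by move=> HB; rewrite set_codeE encode_lt // => x; case: (x \in A).
Qed.

Lemma set_code_inj : injective set_code.
Proof. by move=> A A' E; apply/setP => x; rewrite -!bit_set_code E. Qed.

End SetCodes.

Section Bits.

Variable n : nat.

Definition bits (w : nat) : {set 'I_n} := [set s : 'I_n | bit w s].
Local Notation code := (set_code (@nat_of_ord n)).

Lemma bitsK (A : {set 'I_n}) : bits (code A) = A.
Proof. by apply/setP => s; rewrite inE bit_set_code //; apply: ord_inj. Qed.

Lemma code_bits_le (A : {set 'I_n}) w : A \subset bits w -> code A <= w.
Proof.
move=> Aw; apply: leq_trans (leq_mod w (2 ^ n)); rewrite -sum_digit // /set_code.
rewrite big_mkcond; apply: leq_sum => s _; case: (boolP (s \in A)) => // /(subsetP Aw).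
by rewrite inE /bit => /eqP ->; rewrite mul1n.
Qed.

Lemma find_least_set (p : pred nat) (A : {set 'I_n}) :
  p (code A) -> (forall w, p w -> A \subset bits w) ->
  find p (iota 0 (2 ^ n)) = code A.
Proof.
move=> pA least; apply: find_iota_least => //; first by apply: (set_code_lt (@ord_inj n)) => s; apply: ltn_ord.
move=> j jA; apply/negP => /least /code_bits_le; lia.
Qed.

End Bits.

Section Correctness.

Variables (k : nat) (Act : finType) (n : nat) (P : lts k Act 'I_n).
Local Notation code := (set_code (@nat_of_ord n)).
Local Notation I := (code (init P)).
Local Notation R := (set_code (@edge_position k Act n) (edges P)).
Local Notation T := (ustate P).
Local Notation Q := (unwinding P).
Local Notation lev := (@level k Act 'I_n P).
Local Notation nlabels := (nlabels k Act).
Local Notation bcast_code := (bcast_code k Act).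

Lemma nlabels_gt0 : 0 < nlabels.
Proof. by apply/card_gt0P; exists None. Qed.

Lemma label_code_lt (l : label k Act) : label_code l < nlabels.
Proof. exact: ltn_ord. Qed.

Lemma label_code_inj : injective (@label_code k Act).
Proof. by move=> l l' /ord_inj/enum_rank_inj. Qed.

Lemma pair_code_inj d q r q' r' : r < d -> r' < d ->
  q * d + r = q' * d + r' -> q = q' /\ r = r'.
Proof.
move=> rd r'd E; have d0 : 0 < d by apply: leq_trans rd.
have := congr1 (divn^~ d) E; have := congr1 (modn^~ d) E.
by rewrite !modnMDl !modn_small // !divnMDl // !divn_small // !addn0.
Qed.

Lemma edge_position_inj : injective (@edge_position k Act n).
Proof.
move=> [[s l] t] [[s' l'] t']; rewrite /edge_position /=.
case/(pair_code_inj (label_code_lt l) (label_code_lt l')) => E /label_code_inj ->.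
by case: (pair_code_inj (ltn_ord t) (ltn_ord t') E) => /ord_inj -> /ord_inj ->.
Qed.

Lemma nedgeE (s t : 'I_n) l : nedge k Act n R s (label_code l) t = ((s, l, t) \in edges P).
Proof. exact: (bit_set_code edge_position_inj (edges P) (s, l, t)). Qed.

Lemma nfireableE a X : nfireable k a n R X = fireable P (bits n X) a.
Proof.
apply/allP/fireableP => H j.
  have /has_iotaP[s sn /has_iotaP[t tn /andP[He Hs]]] := H j (mem_enum _ _).
  exists (Ordinal sn), (Ordinal tn); rewrite -nedgeE inE.
  by split.
move=> _; have [s [t [He Hs]]] := H j.
apply/has_iotaP; exists s => //; apply/has_iotaP; exists t => //.
by move: Hs; rewrite inE => ->; rewrite (nedgeE s t (rdz a j)) He.
Qed.

Lemma nclosedE X : reflect (rdz_closed P (bits n X)) (nclosed k Act n R X).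
Proof.
apply: (iffP allP) => [H s a j t He Ha|H a _].
  have /implyP := H a (mem_enum _ _); rewrite nfireableE => /(_ Ha) /allP.
  move=> /(_ j (mem_enum _ _)) /all_iotaP /(_ s (ltn_ord s)) /all_iotaP /(_ t (ltn_ord t)).
  by rewrite (nedgeE s t (rdz a j)) He inE.
apply/implyP; rewrite nfireableE => Ha; apply/allP => j _.
apply/all_iotaP => s sn; apply/all_iotaP => t tn; apply/implyP => He.
have := H (Ordinal sn) a j (Ordinal tn); rewrite inE; apply=> //.
by rewrite -nedgeE.
Qed.

Lemma nsaturateE (A : {set 'I_n}) : nsaturate k Act n R (code A) = code (saturate P A).1.
Proof.
have [H1 _ _ H4 H5] := saturateP P A.
apply: find_least_set => [|w /andP[/all_iotaP Hw /nclosedE Hcl]].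
  apply/andP; split; last by apply/nclosedE; rewrite bitsK.
  apply/all_iotaP => s sn; rewrite -[s]/(nat_of_ord (Ordinal sn)).
  by rewrite !(bit_set_code (@ord_inj n)); apply/implyP/(subsetP H1).
apply: H5 => //; apply/subsetP => s sA; have := Hw s (ltn_ord s).
by rewrite (bit_set_code (@ord_inj n)) sA inE.
Qed.

Lemma nimageE (A : {set 'I_n}) : nimage k Act n R (code A) = code (bcast_image P A).
Proof.
apply: find_least_set => [|w /all_iotaP Hw].
  apply/all_iotaP => s sn; apply/all_iotaP => t tn; apply/implyP => /andP[Hs He].
  rewrite -[t]/(nat_of_ord (Ordinal tn)) (bit_set_code (@ord_inj n)) inE.
  apply/existsP; exists (Ordinal sn).
  by rewrite -(bit_set_code (@ord_inj n)) Hs -nedgeE.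
apply/subsetP => t; rewrite !inE => /existsP[s /andP[Hs He]].
have /all_iotaP/(_ t (ltn_ord t)) := Hw s (ltn_ord s).
by rewrite (bit_set_code (@ord_inj n)) Hs (nedgeE s t (bcast k Act)) He.
Qed.

Lemma nentryE i : nentry k Act n I R i = code (entry P i).
Proof.
elim: i => [|i IH] //; rewrite [LHS]/= -/(nentry k Act n I R i) IH.
by rewrite nsaturateE nimageE entryS layer_statesE.
Qed.

Lemma nstatesE i : nstates k Act n I R i = code (layer_states P i).
Proof. by rewrite /nstates nentryE nsaturateE layer_statesE. Qed.

Lemma nentry_eq i j : (nentry k Act n I R i == nentry k Act n I R j) = (layer P i == layer P j).
Proof.
rewrite !nentryE (inj_eq (set_code_inj (@ord_inj n))) !layerE.
by rewrite xpair_eqE; case: eqP => // ->; rewrite eqxx.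
Qed.

Lemma has_repeat j : has (fun i => nentry k Act n I R j.+1 == nentry k Act n I R i) (iota 0 j.+1) =
  (layer P j.+1 \in mkseq (layer P) j.+1).
Proof.
apply/has_iotaP/mapP => -[i Hi]; last move=> E.
  by rewrite nentry_eq => /eqP E; exists i => //; rewrite mem_iota.
by exists i; [move: Hi; rewrite mem_iota|rewrite nentry_eq E].
Qed.

(** The layers up to the end of the lasso are distinct, hence so are their entry sets; as there are
    only [2 ^ n] sets of states, the end lies within the search range. *)
Lemma nendE : nend k Act n I R = lasso_end P.
Proof.
have lasso_min j : j < lasso_end P -> layer P j.+1 \notin mkseq (layer P) j.+1.
  by rewrite /lasso_end; case: ex_minnP => m _ Hm jm; apply/negP => /Hm; lia.
apply: find_iota_least; last 2 first.
- by rewrite has_repeat lasso_endP.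
- by move=> j /lasso_min; rewrite has_repeat.
have U j : j <= lasso_end P -> uniq (mkseq (layer P) j.+1).
  elim: j => // j IH Hj.
  rewrite /mkseq -[j.+2]addn1 iotaD map_cat cats1 rcons_uniq -/(mkseq _ _).
  by rewrite lasso_min // IH // ltnW.
have Ue : uniq (mkseq (entry P) (lasso_end P).+1).
  apply: (map_uniq (f := fun X => (X, saturate P X))).
  rewrite -map_comp (eq_map (g := layer P)) ?U // => i /=.
  by rewrite layerE.
have E : #|{: {set 'I_n}}| = 2 ^ n.
  by rewrite -cardsT -powersetT card_powerset cardsT card_ord.
have := uniq_leq_size (s2 := enum {: {set 'I_n}}) Ue.
rewrite size_mkseq -cardE E => H; apply: leqW; apply: H => x _.
by rewrite mem_enum.
Qed.

Lemma nstartE : nstart k Act n I R = lasso_start P.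
Proof.
rewrite /nstart nendE; apply: find_iota_least => [||j].
- by rewrite ltnS lasso_start_le.
- by rewrite nentry_eq lasso_startE.
- move=> lt; have := before_find (layer P 0) lt; rewrite nentry_eq nth_mkseq.
    by rewrite /= eq_sym => ->.
  by apply: leq_trans lt _; apply/leqW/lasso_start_le.
Qed.

Local Notation W := (nwidth k Act n I R).
Local Notation B := (nbound k Act n I R).
Local Notation D := (nbase k Act n I R).
Local Notation edg := (edge k Act T).
Local Notation is_bc := (@is_bcast k Act T).
Local Notation src := (@source k Act T).
Local Notation tgt := (@target k Act T).
Local Notation nuedge := (@nuwedge k Act n I R).
Local Notation flow := (flow Q lev).

(** * Codes of states, edges and flows of the unwinding *)

Definition state_code (x : T) : nat := lev x * n + base x.

Definition uedge_code (e : edg) : nat :=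
  (state_code (src e) * W + state_code (tgt e)) * nlabels + label_code e.1.2.

Lemma nwidthE : W = (lasso_end P).+1 * n.
Proof. by rewrite /nwidth nendE. Qed.

Lemma state_code_lt x : state_code x < W.
Proof.
rewrite nwidthE /state_code; apply: (@leq_trans ((lev x).+1 * n)).
  by rewrite mulSn addnC ltn_add2r ltn_ord.
by rewrite leq_mul2r ltnS level_le orbT.
Qed.

Lemma n_gt0 (x : T) : 0 < n.
Proof. by apply: leq_ltn_trans (ltn_ord (base x)). Qed.

Lemma state_code_div x : state_code x %/ n = lev x.
Proof. by rewrite /state_code divnMDl ?(n_gt0 x) // divn_small ?addn0. Qed.

Lemma state_code_mod x : state_code x %% n = base x.
Proof. by rewrite /state_code modnMDl modn_small. Qed.

Lemma state_code_inj : injective state_code.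
Proof.
move=> x y E; apply: ustate_eq.
  by apply: ord_inj; rewrite -!state_code_mod E.
by rewrite -!state_code_div E.
Qed.

Lemma uedge_code_label e : uedge_code e %% nlabels = label_code e.1.2.
Proof. by rewrite /uedge_code modnMDl modn_small ?label_code_lt. Qed.

Lemma uedge_code_div e : uedge_code e %/ nlabels = state_code (src e) * W + state_code (tgt e).
Proof.
by rewrite /uedge_code divnMDl ?nlabels_gt0 // divn_small ?label_code_lt // addn0.
Qed.

Lemma nsideE b e : nside k Act b n I R (uedge_code e) = state_code (if b then tgt e else src e).
Proof.
have W0 : 0 < W by apply: leq_ltn_trans (state_code_lt (src e)).
rewrite /nside uedge_code_div; case: b.
  by rewrite modnMDl modn_small ?state_code_lt.
by rewrite divnMDl // divn_small ?state_code_lt // addn0.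
Qed.

Lemma uedge_code_inj : injective uedge_code.
Proof.
move=> [[x l] y] [[x' l'] y']; rewrite /uedge_code /source /target /=.
case/(pair_code_inj (label_code_lt l) (label_code_lt l')) => E /label_code_inj ->.
by case: (pair_code_inj (state_code_lt y) (state_code_lt y') E) => /state_code_inj -> /state_code_inj ->.
Qed.

Lemma uedge_code_lt e : uedge_code e < B.
Proof.
rewrite /uedge_code /nbound.
have := state_code_lt (src e); have := state_code_lt (tgt e); have := label_code_lt e.1.2.
move: (state_code _) (state_code _) (label_code _) W nlabels => a b c w l cl bw aw.
apply: (@leq_trans ((a * w + b).+1 * l)); first by rewrite mulSn; lia.
rewrite leq_mul2r; apply/orP; right; apply: (@leq_trans (a.+1 * w)); first by rewrite mulSn; lia.
by rewrite leq_mul2r aw orbT.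
Qed.

Lemma nstate_code x : nstate k Act n I R (state_code x).
Proof.
rewrite /nstate state_code_div state_code_mod nendE level_le nstatesE.
by rewrite (bit_set_code (@ord_inj n)) ustate_states.
Qed.

Lemma nstate_ex p : 0 < n -> nstate k Act n I R p -> exists x, state_code x = p.
Proof.
move=> n0; rewrite /nstate nendE nstatesE => /andP[Hl Hb].
have lt : p %% n < n by rewrite ltn_mod.
move: Hb; rewrite -[p %% n]/(nat_of_ord (Ordinal lt)) (bit_set_code (@ord_inj n)) => Hb.
have [x [Ex Lx]] := ustate_ex Hl Hb.
by exists x; rewrite /state_code Ex Lx /= -divn_eq.
Qed.

Lemma nactsE a (l : label k Act) : nacts k a (label_code l) = if l is Some (b, _) then b == a else false.
Proof.
apply/hasP/idP => [[j _ /eqP/label_code_inj ->]|]; first by rewrite /= eqxx.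
case: l => [[b j]|] // /eqP ->; exists j => //; exact: mem_enum.
Qed.

Lemma is_bcastE e : (uedge_code e %% nlabels == bcast_code) = is_bc e.
Proof. by rewrite uedge_code_label (inj_eq label_code_inj). Qed.

Lemma nuedgeE e : nuedge (uedge_code e) = (e \in edges Q).
Proof.
case: e => [[x l] y].
rewrite /nuwedge is_bcastE uedge_code_label !nsideE !nstate_code /source /target /is_bcast /=.
rewrite !state_code_div !state_code_mod nedgeE nendE nstartE nstatesE.
case: l => [[a j]|]; last by rewrite (uedge_bcast x y) eqxx /= orbF andbC.
rewrite (uedge_rdz x y a j) /=.
rewrite andbCA; congr (_ && (_ && _)); rewrite -[in RHS](bitsK (layer_states P (lev x))) -nfireableE.
apply/allP/idP => [H|H b _].
  by have /implyP := H a (mem_enum _ _); apply; rewrite nactsE /= eqxx.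
by apply/implyP; rewrite nactsE => /eqP <-.
Qed.

Lemma nuedge_ex p : p < B -> nuedge p -> exists2 e, e \in edges Q & uedge_code e = p.
Proof.
move=> pB Hp; move: (Hp); rewrite /nuwedge => /and4P[Hx Hy _ _].
have W0 : 0 < W.
  have : 0 < B by apply: leq_ltn_trans pB.
  by rewrite /nbound !muln_gt0 => /andP[/andP[]].
have n0 : 0 < n by move: W0; rewrite nwidthE muln_gt0 => /andP[].
have [x Ex] := nstate_ex n0 Hx; have [y Ey] := nstate_ex n0 Hy.
have lt : p %% nlabels < nlabels by rewrite ltn_mod nlabels_gt0.
pose e : edg := (x, enum_val (Ordinal lt), y).
have Ee : uedge_code e = p.
  rewrite /uedge_code /= /source /target /= Ex Ey /nside -divn_eq.
  by rewrite /label_code enum_valK /= -divn_eq.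
by exists e; rewrite // -nuedgeE Ee.
Qed.

Lemma nsameE e e' : nsame k Act n I R (uedge_code e) (uedge_code e') = synchronized lev e e'.
Proof.
rewrite /nsame !uedge_code_label !nsideE !state_code_div /synchronized.
case El: e.1.2 => [[a j]|]; last first.
  by apply/negbTE; rewrite negb_and -all_predC; apply/orP; left; apply/allP => a _; rewrite /= nactsE.
case El': e'.1.2 => [[b j']|]; last first.
  by apply/negbTE; rewrite negb_and -all_predC; apply/orP; left; apply/allP => b _; rewrite /= andbC nactsE.
congr (_ && _); apply/hasP/eqP => [[c _ /andP[]]|->].
  by rewrite !nactsE => /eqP -> /eqP ->.
by exists b; rewrite ?mem_enum // !nactsE eqxx.
Qed.

(** Numbers that code no edge of the unwinding are filtered out by [nuwedge], so summing over
    numbers is summing over edges. *)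
Lemma bsum_uedges (q : nat -> bool) (F : nat -> nat) :
  bsum B (fun p => (nuedge p && q p) * F p) =
  \sum_(e in edges Q | q (uedge_code e)) F (uedge_code e).
Proof.
rewrite (partition_big (fun e => Ordinal (uedge_code_lt e)) predT) //=.
apply: eq_bigr => i _; case: (boolP (nuedge i)) => /= Hi.
  have [e He Ee] := nuedge_ex (ltn_ord i) Hi; case: (boolP (q i)) => qi.
    rewrite (big_pred1 e) ?Ee ?mul1n // => e' /=; rewrite -val_eqE /= -Ee.
    rewrite (inj_eq uedge_code_inj); case: eqP => [->|]; last by rewrite andbF.
    by rewrite He Ee qi.
  rewrite big_pred0 // => e'; apply: contraNF qi => /andP[/andP[_ H] /eqP E].
  by move: H; rewrite -E.
rewrite big_pred0 // => e'; apply: contraNF Hi => /andP[/andP[H _] /eqP E].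
by rewrite -[nat_of_ord i]/(val i) -E /= nuedgeE.
Qed.

Definition coded_flow (w : nat) (e : edg) : nat :=
  if e \in edges Q then digit D w (uedge_code e) else 0.

Lemma bsum_side b w x :
  bsum B (fun p => (nuedge p && (nside k Act b n I R p == state_code x)) * digit D w p) =
  \sum_(e | (if b then tgt e else src e) == x) coded_flow w e.
Proof.
rewrite (bsum_uedges (fun p => nside k Act b n I R p == state_code x)) big_mkcond [RHS]big_mkcond.
apply: eq_bigr => e _; rewrite nsideE (inj_eq state_code_inj) /coded_flow.
by case: (e \in edges Q); case: (_ == x).
Qed.

Lemma nflowP w : reflect (flow (coded_flow w)) (nflow k Act n I R w).
Proof.
apply: (iffP andP) => [[/all_iotaP H1 /all_iotaP H2]|[H1 H2 H3]].
  split=> [e|x|e e' He He' ee'].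
  - by rewrite /coded_flow; case: ifP.
  - by have /eqP := H1 _ (state_code_lt x); rewrite (bsum_side false) (bsum_side true).
  - have /all_iotaP/(_ _ (uedge_code_lt e')) := H2 _ (uedge_code_lt e).
    by rewrite !nuedgeE nsameE He He' ee' /coded_flow He He' => /eqP.
split; apply/all_iotaP => p pB; last first.
  apply/all_iotaP => q qB; apply/implyP => /and3P[Hp Hq].
  have [e He <-] := nuedge_ex pB Hp; have [e' He' <-] := nuedge_ex qB Hq.
  by rewrite nsameE => /(H3 _ _ He He'); rewrite /coded_flow He He' => ->.
(* For a number that codes no state both sums are 0. *)
case: (classic (exists x, state_code x = p)) => [[x <-]|no].
  by rewrite (bsum_side false) (bsum_side true) H2.
have zero b : bsum B (fun q => (nuedge q && (nside k Act b n I R q == p)) * digit D w q) = 0.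
  rewrite /bsum big1 // => q _; case: (boolP (nuedge q)) => //= Hq.
  have [e He <-] := nuedge_ex (ltn_ord q) Hq; rewrite nsideE.
  by case: eqP => // E; case: no; exists (if b then tgt e else src e).
by rewrite !zero.
Qed.

Lemma nbaseE : D = (solution_bound B (W + B * B)).+1.
Proof. by []. Qed.

(** Every pair of edges gets an equation, trivial unless the edges are synchronized; so the number
    of equations depends only on the numbers of states and edges. *)
Definition flow_equation (i : T + edg * edg) : pred edg * pred edg :=
  match i with
  | inl x => (fun e => src e == x, fun e => tgt e == x)
  | inr (e, e') => if [&& e \in edges Q, e' \in edges Q & synchronized lev e e']
                   then (pred1 e : pred edg, pred1 e' : pred edg) else (pred0 : pred edg, pred0 : pred edg)
  end.

Lemma flow_solves g : (forall e, 0 < g e -> e \in edges Q) ->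
  flow g <-> solves [seq flow_equation i | i <- enum {: T + edg * edg}] g.
Proof.
move=> gQ; rewrite /solves size_map -cardE.
have E i : i < #|{: T + edg * edg}| -> exists j, i = enum_rank j /\
    nth (pred0 : pred edg, pred0 : pred edg)
      [seq flow_equation i | i <- enum {: T + edg * edg}] i = flow_equation j.
  move=> Hi; exists (enum_val (Ordinal Hi)); rewrite enum_valK; split=> //.
  rewrite (nth_map (enum_val (Ordinal Hi))) -?cardE //.
  by rewrite -[X in nth _ _ X]/(nat_of_ord (Ordinal Hi)) -enum_val_nth.
split=> [[_ H2 H3] i /E [j [_ ->]]|H].
  case: j => [x|[e e']] /=; first exact: H2.
  case: ifP => [/and3P[He He' ee']|_] //=.
  by rewrite /dot !big_pred1_eq; apply: H3.
have {}H j : dot (flow_equation j).1 g = dot (flow_equation j).2 g.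
  have := H (enum_rank j) (ltn_ord _).
  rewrite (nth_map j) -?cardE ?ltn_ord //.
  by rewrite nth_enum_rank.
split=> // [x|e e' He He' ee']; first exact: (H (inl x)).
by have := H (inr (e, e')); rewrite /= He He' ee' /= /dot !big_pred1_eq.
Qed.

(** The small flow stays within the support of [g], so restrictions on the edges used are
    preserved. *)
Lemma small_flow g e : flow g -> 0 < g e ->
  exists g', [/\ flow g', forall e', g' e' < D, forall e', 0 < g' e' -> 0 < g e' & 0 < g' e].
Proof.
move=> Hg ge; have gQ e' : 0 < g e' -> e' \in edges Q by case: Hg => + _ _; apply.
have /(flow_solves gQ) Hs := Hg.
have cardT : #|T| <= W.
  rewrite -[W]card_ord -(card_codom (f := fun x => Ordinal (state_code_lt x))) ?max_card //.
  by move=> x y [/state_code_inj].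
have cardE' : #|edg| <= B.
  rewrite -[B]card_ord -(card_codom (f := fun x => Ordinal (uedge_code_lt x))) ?max_card //.
  by move=> x y [/uedge_code_inj].
have edg0 : 0 < #|edg| by apply/card_gt0P; exists e.
have [g' [H1 H2 H3 H4]] := small_solution (leqnn _) Hs ge.
exists g'; split=> //.
- by apply/flow_solves => // e' /H3/gQ.
- move=> e'; rewrite nbaseE ltnS; apply: leq_trans (H2 e') _.
  apply: solution_bound_mono => //; rewrite size_map -cardE card_sum card_prod.
  by apply: leq_add => //; apply: leq_mul.
Qed.

Definition coded_set (u : nat) : {set edg} := [set e in edges Q | bit u (uedge_code e)].

Lemma coded_set_code (U : {set edg}) : U \subset edges Q ->
  coded_set (set_code uedge_code U) = U.
Proof.
move=> /subsetP UQ; apply/setP => e; rewrite inE (bit_set_code uedge_code_inj).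
by case: (boolP (e \in U)) => [/UQ ->|]; rewrite ?andbF.
Qed.

Lemma nflow_inP (b : bool) u e : e \in edges Q -> reflect
  (exists g, [/\ flow g, forall e', 0 < g e' -> e' \in coded_set u,
     b -> forall e', is_bc e' -> g e' = 0 & 0 < g e])
  (nflow_in k Act b n I R u (uedge_code e)).
Proof.
move=> He; apply: (iffP (has_iotaP _ _)) => [[w _ /and3P[/nflowP H1 /all_iotaP H2 H3]]|].
  exists (coded_flow w).
  have H e' : e' \in edges Q -> ~~ bit u (uedge_code e') || b && is_bc e' -> coded_flow w e' = 0.
    move=> He' Hb; have := H2 _ (uedge_code_lt e').
    by rewrite nuedgeE is_bcastE He' Hb /coded_flow He' => /eqP.
  split=> //.
  - move=> e'; rewrite inE; case: (boolP (e' \in edges Q)) => [He'|ne].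
      by case: (boolP (bit u _)) => // nb; rewrite H // nb.
    by rewrite /coded_flow (negbTE ne).
  - move=> Hb e' be; case: (boolP (e' \in edges Q)) => [He'|ne].
      by apply: H => //; rewrite Hb be orbT.
    by rewrite /coded_flow (negbTE ne).
  - by rewrite /coded_flow He.
move=> [g [Hg gU gb ge]]; have [g' [H1 H2 H3 H4]] := small_flow Hg ge.
have D0 : 0 < D by [].
pose w := encode D uedge_code g'.
have wE e' : coded_flow w e' = g' e'.
  rewrite /coded_flow /w encode_digit //; last exact: uedge_code_inj.
  case: ifP => // ne; apply/eqP; rewrite eq_sym -leqn0 leqNgt; apply/negP => /H3/gU.
  by rewrite inE ne.
exists w; first by apply: encode_lt => //; [exact: uedge_code_inj|exact: uedge_code_lt].
apply/and3P; split.
- apply/nflowP; case: H1 => F1 F2 F3; split=> [e'|x|e1 e2 *]; rewrite ?wE //; first exact: F1.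
    by rewrite !(eq_bigr _ (fun e _ => wE e)).
  exact: F3.
- apply/all_iotaP => q qB; apply/implyP => /andP[Hq Hbad].
  have [e' He' Eq] := nuedge_ex qB Hq; rewrite -Eq in Hbad *.
  have := wE e'; rewrite /coded_flow He' => ->; rewrite -leqn0 leqNgt; apply/negP => /H3 ge'.
  move: Hbad; rewrite is_bcastE; have := gU _ ge'; rewrite inE He' => /= ->.
  by case/andP => /gb H /H E; rewrite E in ge'.
- by move: H4; rewrite -wE /coded_flow He.
Qed.

Lemma ncoversP (b : bool) u : reflect
  (covers lev (coded_set u) (fun e => if b then tgt e else src e)
     (fun e => if ~~ b then tgt e else src e))
  (ncovers k Act b n I R u).
Proof.
pose bitset X := [set x : T | bit X (state_code x)].
have Uq q : q < B -> nuedge q && bit u q -> exists2 e, e \in coded_set u & uedge_code e = q.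
  by move=> qB /andP[Hq Hb]; have [e He Ee] := nuedge_ex qB Hq; exists e; rewrite // inE He Ee.
have UE e : nuedge (uedge_code e) && bit u (uedge_code e) = (e \in coded_set u).
  by rewrite nuedgeE [RHS]inE.
apply: (iffP (all_iotaP _ _)) => [H X Hb Hr e eU|H X XB].
  pose w := set_code state_code X.
  have wE x : bit w (state_code x) = (x \in X) by rewrite (bit_set_code state_code_inj).
  have := H w (set_code_lt state_code_inj X state_code_lt).
  rewrite implybE => /orP[/negP[]|/all_iotaP /(_ _ (uedge_code_lt e))]; last first.
    by rewrite UE eU nsideE wE.
  apply/andP; split; apply/all_iotaP => q qB; apply/implyP.
    move=> /andP[Hq]; have [e' e'U <-] := Uq q qB Hq.
    by rewrite is_bcastE nsideE wE; apply: Hb.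
  move=> /and3P[Hq]; have [e' e'U <-] := Uq q qB Hq.
  rewrite is_bcastE nsideE wE => be /all_iotaP Hs; apply: Hr => // e2 e2U ee2.
  have := Hs _ (uedge_code_lt e2); rewrite UE e2U nsameE ee2 nsideE wE; exact.
apply/implyP => /andP[/all_iotaP Hb /all_iotaP Hr].
apply/all_iotaP => q qB; apply/implyP => Hq; have [e eU <-] := Uq q qB Hq.
rewrite nsideE; have := H (bitset X); rewrite /covers => Hc.
have := Hc _ _ e eU; rewrite inE; apply.
  move=> e' e'U be; have := Hb _ (uedge_code_lt e').
  by rewrite UE e'U is_bcastE be nsideE inE.
move=> e' e'U be Hs; have := Hr _ (uedge_code_lt e').
rewrite UE e'U is_bcastE be nsideE inE /= => /implyP; apply.
apply/all_iotaP => q' q'B; apply/implyP => /andP[Hq' Hee].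
have [e2 e2U E2] := Uq q' q'B Hq'; rewrite -E2 nsideE.
have := Hs e2 e2U; rewrite inE; apply.
by rewrite -nsameE E2.
Qed.

Lemma ncirculationP u : reflect (circulation Q lev (coded_set u)) (ncirculation k Act n I R u).
Proof.
apply: (iffP and3P) => [[/all_iotaP H1 /ncoversP H2 /ncoversP H3]|[H0 H1 H2 H3]].
  split=> //; first by apply/subsetP => e; rewrite inE => /andP[].
  move=> e eU; have := eU; rewrite inE => /andP[He Hb].
  have := H1 _ (uedge_code_lt e); rewrite nuedgeE He Hb => /(nflow_inP _ _ He).
  by move=> [g [? ? _ ?]]; exists g.
split; [|exact/ncoversP|exact/ncoversP].
apply/all_iotaP => q qB; apply/implyP => /andP[Hq Hb].
have [e He Ee] := nuedge_ex qB Hq; rewrite -Ee; apply/nflow_inP => //.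
have [|g [? ? ?]] := H1 e; first by rewrite inE He Ee.
by exists g.
Qed.

Lemma code_set_lt U : set_code uedge_code U < 2 ^ B.
Proof. exact: (set_code_lt uedge_code_inj U uedge_code_lt). Qed.

Lemma circulation_coded U : circulation Q lev U -> U = coded_set (set_code uedge_code U).
Proof. by move=> [UQ _ _ _]; rewrite coded_set_code. Qed.

Lemma nrecurrentP e : e \in edges Q ->
  reflect (recurrent Q lev e) (nrecurrent k Act n I R (uedge_code e)).
Proof.
move=> He; apply: (iffP (has_iotaP _ _)) => [[u _ /andP[/ncirculationP HU Hb]]|[U [HU eU]]].
  by exists (coded_set u); rewrite inE He Hb.
exists (set_code uedge_code U); first exact: code_set_lt.
rewrite (bit_set_code uedge_code_inj) eU andbT; apply/ncirculationP.
by rewrite -circulation_coded.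
Qed.

Lemma npumpableP e : e \in edges Q ->
  reflect (pumpable Q lev e) (npumpable k Act n I R (uedge_code e)).
Proof.
move=> He; apply: (iffP (has_iotaP _ _)) => [[u _ /and3P[/ncirculationP HU Hb Hc]]|[U [HU eU [g [? ? ? ?]]]]].
  exists (coded_set u); rewrite inE He Hb; split=> //.
  by have /nflow_inP-/(_ He)[g [? ? ? ?]] := Hc; exists g; split=> // e' be; auto.
exists (set_code uedge_code U); first exact: code_set_lt.
rewrite (bit_set_code uedge_code_inj) eU; apply/and3P; split=> //.
  by apply/ncirculationP; rewrite -circulation_coded.
by apply/nflow_inP => //; rewrite -circulation_coded //; exists g.
Qed.

Lemma nrdz_cycleP e : e \in edges Q ->
  reflect (rdz_cycle Q lev (edges Q) e) (nrdz_cycle k Act n I R (uedge_code e)).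
Proof.
move=> He; apply: (iffP (has_iotaP _ _)) => [[u _ /andP[_ Hc]]|[g [? ? ? ?]]].
  have /nflow_inP-/(_ He)[g [H1 H2 ? ?]] := Hc; exists g; split=> //; last by auto.
  by case: H1.
exists (set_code uedge_code (edges Q)); first exact: code_set_lt.
apply/andP; split.
  apply/all_iotaP => q qB; apply/implyP => /(nuedge_ex qB)[e' He' <-].
  by rewrite (bit_set_code uedge_code_inj).
by apply/nflow_inP => //; rewrite coded_set_code //; exists g.
Qed.

Lemma ncolorE e : e \in edges Q ->
  ncolor k Act n I R (uedge_code e) = color_code (semantic_color e).
Proof.
move=> He; rewrite /ncolor /semantic_color.
rewrite (sameP (npumpableP He) (asbP _)) (sameP (nrecurrentP He) (asbP _)).
rewrite (sameP (nrdz_cycleP He) (asbP _)).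
by do 3?[case: (asb _) => //].
Qed.

End Correctness.

Theorem theorem4 (k : nat) (Act : finType) (hk : 0 < k) :
  exists prog : recfun,
    forall (n : nat) (P : lts k Act 'I_n),
      is_template P -> rdz_unique P ->
      forall e : edge k Act (ustate P),
        e \in edges (unwinding P) ->
        exists c : color,
          has_type (unwinding P) e c /\
          computes prog (template_code P ++ unwinding_edge_code e) (color_code c).
Proof.
have [prog Hprog] := computable_nedge_color k Act.
exists prog => n P Ptemplate Puniq e He; exists (semantic_color e).
split; first exact: semantic_colorP.
rewrite -ncolorE //; case: e He => [[x l] y] _.
exact: (Hprog (template_code P ++ unwinding_edge_code ((x, l, y) : edge k Act (ustate P))) erefl).
Qed.
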